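(* Let $(\Omega,\mathscr F,\mathbb P)$ be a probability space with a binary filtration $(\mathscr F_n)_{n\ge 0}$ and associated collection of atoms $\mathscr A$, let $S$ be a finite-dimensional linear space of $\mathscr F$-measurable scalar-valued functions on $\Omega$ satisfying the stability inequality on all atoms of $\mathscr A$, and let $1<p<\infty$, $0<\tau<p$. Then the Bernstein inequality $\operatorname{BI}(\mathscr A,S,p,\tau)$ holds if and only if the following condition holds: there exist a number $\rho\in(0,1)$ and a constant $M$ such that for each finite sequence $X_0\supset X_1\supset\cdots\supset X_n$ of atoms in $\mathscr A$ with $|X_n|\ge \rho|X_0|$ and $X_j\in\{X_{j-1}',X_{j-1}''\}$ for each $j=1,\dots,n$, we have $$\Big(\sum_{i=1}^n \|f\,\mathbf 1_{X_{i-1}\setminus X_i}\|_p^\tau\Big)^{1/\tau}\le M\,\|f\,\mathbf 1_{X_0\setminus X_n}\|_p\qquad\text{for all } f\in S.$$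
   Context: Write $|A|=\mathbb P(A)$; $\|\cdot\|_p$ is the $L^p(\Omega,\mathbb P)$ (quasi-)norm and $\mathbf 1_A$ the characteristic function of $A$. Binary filtration: $\mathscr F_0=\{\emptyset,\Omega\}$ and, for each $n\ge1$, $\mathscr F_n\subset\mathscr F$ is generated by $\mathscr F_{n-1}$ and the subdivision of exactly one atom $A_n$ of $\mathscr F_{n-1}$ into two atoms $A_n',A_n''$ of $\mathscr F_n$ with $|A_n''|\ge|A_n'|>0$. $\mathscr A_n$ is the collection of atoms of $\mathscr F_n$ and $\mathscr A=\bigcup_n\mathscr A_n$. If $A\in\mathscr A$ strictly contains another element of $\mathscr A$, there is a unique $n\ge1$ with $A=A_n$, and then $A':=A_n'$, $A'':=A_n''$. Stability inequality on atoms: there are constants $c_1,c_2\in(0,1]$ such that for each $A\in\mathscr A$, $$|\{\omega\in A:|f(\omega)|\ge c_1\|f\|_A\}|\ge c_2|A|\qquad\text{for all } f\in S,$$ where $\|f\|_A$ is the $L^\infty$-norm of $f$ on $A$. (In particular $S\subset L^\infty(\Omega)$.) Let $S_n$ be the space of scalar functions $f$ on $\Omega$ such that for each atom $A$ of $\mathscr F_n$ there is $g\in S$ with $f\mathbf 1_A=g\mathbf 1_A$. $P_n$ is the $L^2$-orthogonal projector onto $S_n$ (it extends to $L^1(\Omega)$), $P_{-1}=0$, and $Q_n=P_n-P_{n-1}$ for $n\ge0$. For $n\ge1$ let $\Sigma_n(S)=\{\sum_{i=1}^n v_i\mathbf 1_{A_i}: v_i\in S,\ A_i\in\mathscr A\}$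 (here the $A_i$ are arbitrary elements of $\mathscr A$, not necessarily disjoint). Bernstein inequality $\operatorname{BI}(\mathscr A,S,p,\tau)$: with $\beta=1/\tau-1/p$, there is a constant $C$ such that for all positive integers $n$ and all $g\in\Sigma_n(S)$, $$\Big(\sum_{j\ge0}\|Q_jg\|_p^\tau\Big)^{1/\tau}\le C\,n^\beta\|g\|_p.$$ *)

(* Defs.v *)
From HB Require Import structures.
From mathcomp Require Import all_boot all_order all_algebra.
From mathcomp Require Import complex.
From mathcomp Require Import all_classical all_reals all_analysis.

Set Implicit Arguments.
Unset Strict Implicit.
Unset Printing Implicit Defensive.

Import Order.TTheory GRing.Theory Num.Theory.

Local Open Scope classical_set_scope.
Local Open Scope complex_scope.
Local Open Scope ring_scope.

(* Scalars are real or complex. All functions take values in R[i]; in the real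
   case values and coefficients are confined to the real axis. *)
Variant scalar_field := RealScalars | ComplexScalars.

Definition scalars (R : realType) (K : scalar_field) : set R[i] :=
  match K with
  | RealScalars => [set z | complex.Im z = 0]
  | ComplexScalars => setT
  end.

Section scalar_functions.
Context d (T : measurableType d) (R : realType) (P : probability T R).
Implicit Types (f g h u : T -> R[i]) (S : set (T -> R[i])) (A : set T).

Definition measurable_scalar f :=
  measurable_fun setT (fun x => complex.Re (f x)) /\
  measurable_fun setT (fun x => complex.Im (f x)).

Definition finite_dim_space (K : scalar_field) S :=
  exists (k : nat) (b : 'I_k -> T -> R[i]),
    (forall i, measurable_scalar (b i) /\ forall x, scalars K (b i x)) /\
    S = [set f | exists c : 'I_k -> R[i], (forall i, scalars K (c i)) /\
                   f = (fun x => \sum_(i < k) c i * b i x)].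

Definition Lpnorm (q : \bar R) f : \bar R :=
  Lnorm P q (fun x => (Normc.normc (f x))%:E).

Definition restr f A : T -> R[i] := fun x => f x * \1_A x.

Definition inner f g : R[i] :=
  (\int[P]_x complex.Re (f x * (g x)^*)) +i*
  (\int[P]_x complex.Im (f x * (g x)^*)).

End scalar_functions.

Definition atoms (T : Type) (G : set (set T)) : set (set T) :=
  [set A | [/\ G A, A !=set0 &
     forall B, G B -> B `<=` A -> B = set0 \/ B = A]].

(* The fields [bf_split], [bf_small], [bf_large] are n |-> A_n, A_n', A_n'';
   they are meaningful only for n >= 1. That A_n' and A_n'' are atoms of F_n
   follows from the other fields. *)
Record binary_filtration d (T : measurableType d) (R : realType)
    (P : probability T R) := BinaryFiltration {
  bf_sigma :> nat -> set (set T);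
  bf_split : nat -> set T;
  bf_small : nat -> set T;
  bf_large : nat -> set T;
  bf_measurable : forall n, bf_sigma n `<=` measurable;
  bf_sigma0 : bf_sigma 0%N = [set set0; setT];
  bf_split_atom : forall n, atoms (bf_sigma n) (bf_split n.+1);
  bf_cover : forall n, bf_small n.+1 `|` bf_large n.+1 = bf_split n.+1;
  bf_disj : forall n, bf_small n.+1 `&` bf_large n.+1 = set0;
  bf_small_gt0 : forall n, (0 < P (bf_small n.+1))%E;
  bf_small_le : forall n, (P (bf_small n.+1) <= P (bf_large n.+1))%E;
  bf_sigmaS : forall n, bf_sigma n.+1 =
    <<s bf_sigma n `|` [set bf_small n.+1; bf_large n.+1] >>
}.

Section statement_notions.
Context d (T : measurableType d) (R : realType) (P : probability T R).
Variables (F : binary_filtration P) (S : set (T -> R[i])).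
Implicit Types (f g h u : T -> R[i]) (A X Y : set T) (p tau : R).

Definition all_atoms : set (set T) := \bigcup_n atoms (F n).

(* [Y] is one of X', X''. *)
Definition is_child X Y :=
  exists n, X = bf_split F n.+1 /\
            (Y = bf_small F n.+1 \/ Y = bf_large F n.+1).

Definition stable :=
  exists c1 c2 : R, [/\ 0 < c1 <= 1, 0 < c2 <= 1 &
    forall A, all_atoms A -> forall f, S f ->
      (c2%:E * P A <=
       P (A `&` [set x | c1%:E * Lpnorm P +oo (restr f A)
                         <= (Normc.normc (f x))%:E]))%E].

Definition piecewise n : set (T -> R[i]) :=
  [set f | forall A, atoms (F n) A ->
     exists2 g, S g & restr f A = restr g A].

(* The L^2-orthogonal projector onto S_n, in the form that makes sense on L^1
   because S_n consists of bounded functions. The projection is unique up to a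
   null set; [xget] selects a representative. *)
Definition orth_proj n g : T -> R[i] :=
  xget (fun=> 0) [set h | piecewise n h /\
    forall u, piecewise n u -> inner P (fun x => g x - h x) u = 0].

Definition diff_proj n g : T -> R[i] :=
  match n with
  | 0%N => orth_proj 0%N g
  | m.+1 => fun x => orth_proj m.+1 g x - orth_proj m g x
  end.

Definition Sigma n : set (T -> R[i]) :=
  [set g | exists (v : 'I_n -> T -> R[i]) (A : 'I_n -> set T),
     (forall i, S (v i) /\ all_atoms (A i)) /\
     g = (fun x => \sum_(i < n) restr (v i) (A i) x)].

Definition bernstein p tau :=
  exists C : R, forall n, (0 < n)%N -> forall g, Sigma n g ->
    ((\sum_(0 <= j <oo) Lpnorm P p%:E (diff_proj j g) `^ tau) `^ tau^-1
     <= C%:E * (n%:R `^ (tau^-1 - p^-1))%:E * Lpnorm P p%:E g)%E.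

Definition chain_condition p tau :=
  exists rho M : R, 0 < rho < 1 /\
    forall n (X : nat -> set T),
      (forall j, (j <= n)%N -> all_atoms (X j)) ->
      (rho%:E * P (X 0%N) <= P (X n))%E ->
      (forall j, (j < n)%N -> is_child (X j) (X j.+1)) ->
      forall f, S f ->
        ((\sum_(1 <= i < n.+1)
            Lpnorm P p%:E (restr f (X i.-1 `\` X i)) `^ tau) `^ tau^-1
         <= M%:E * Lpnorm P p%:E (restr f (X 0%N `\` X n)))%E.

End statement_notions.

(* Main.v *)
(** Put [th = tau / p] and [q_j = \|Q_{j+1} g\|_p^p]. The step from [F_j] to
    [F_{j+1}] splits an atom [X] into [X'] and [X'']; by stability the
    projections onto [S] are bounded by averages, and [q_j] is at most a constant
    times [|X'| (avg_{X'} |g| + avg_X |g|)^p].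

    Sufficiency. The atoms occurring in [g], together with the [O(n)] atoms at
    which they branch, cut the tree of atoms into [O(n)] chains; along a chain
    [X_a, ..., X_b], the function [g] agrees with an element of [S] on
    [X_a \ X_b]. While the measure drops by a factor at most [rho], the chain
    condition bounds the sum of [q_j^th]; over successive groups of this kind
    the contributions decay geometrically. With the maximal function [g*] this
    gives [\sum_j q_j^th <= C (n t^th + t^(th-1) \|g*\|_p^p)] for all [t > 0],
    and Doob's inequality together with [t = \|g\|_p^p / n] concludes.

    Necessity. Let [g] be [f] restricted to [X_0 \ X_n], and [u_j] its projection
    over [X_j]. Since [g = f] on [X_{j-1} \ X_j], the [j]-th step dominates
    [f - u_{j-1}] there. When [|X_n|] is close to [|X_0|], the [u_j] are
    combinations of a frame of [S] over [X_0] with coefficients so small that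
    they can be absorbed. *)

Require Import Defs.
From mathcomp Require Import all_boot all_order all_algebra.
From mathcomp Require Import complex ring lra.
From mathcomp Require Import all_classical all_reals all_analysis.
From mathcomp Require Import measurable_realfun ess_sup_inf.

Set Implicit Arguments.
Unset Strict Implicit.
Unset Printing Implicit Defensive.

Import Order.TTheory GRing.Theory Num.Theory.
Local Open Scope classical_set_scope.
Local Open Scope ring_scope.

(** The chain condition speaks of one element of [S], whereas the projections along a chain change
    with every step. A frame of [S] over the top atom removes this obstacle in both directions:
    stability bounds the frame functions by an absolute constant and the coefficients by averages,
    so the condition, or the Bernstein inequality, is only applied to one given function and to
    [ss_dim] frame functions, with constants independent of the chain. Enlarging [rho] weakens the
    chain condition. It may thus be taken so close to 1 that, within a group, everything removed is
    a small fraction of the atom it is removed from; stability then carries bounds from the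
    remainder to the whole atom. Between two groups lies one step crossing the factor [rho], which
    the condition does not see. High up in a chain such steps join the geometric sum; near its lower
    end a bounded number [L] of them is set aside. Those and the branching steps are the O(n)
    exceptional ones, bounded by counting and the maximal function. Powers with exponent [th < 1]
    are not additive over chains; the free threshold [t] replaces them by affine bounds, which add
    up over disjoint sets. *)

(** * Integrals of essentially bounded functions *)

Section essentially_bounded.
Context d (T : measurableType d) (R : realType) (P : probability T R).
Implicit Types (f g : T -> R) (A B : set T).

(** A class closed under all operations used below. As [P] is finite, its members are integrable on
    every measurable set, so real-valued integrals obey the linear rules without further
    integrability conditions. *)
Definition essb f := measurable_fun setT f /\
  exists M : R, {ae P, forall x, `|f x| <= M}.

Lemma essb_cst c : essb (fun=> c).
Proof. by split=> //; exists `|c|; apply: aeW. Qed.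

Lemma essbD f g : essb f -> essb g -> essb (fun x => f x + g x).
Proof.
move=> [mf [M fM]] [mg [N gN]]; split; first exact: measurable_funD.
exists (M + N); apply: filterS2 fM gN => x fx gx.
by rewrite (le_trans (ler_normD _ _)) ?lerD.
Qed.

Lemma essbM f g : essb f -> essb g -> essb (fun x => f x * g x).
Proof.
move=> [mf [M fM]] [mg [N gN]]; split; first exact: measurable_funM.
exists (M * N); apply: filterS2 fM gN => x fx gx.
by rewrite normrM ler_pM.
Qed.

Lemma essbZ c f : essb f -> essb (fun x => c * f x).
Proof. by move=> hf; apply: essbM => //; apply: essb_cst. Qed.

Lemma essbN f : essb f -> essb (fun x => - f x).
Proof.
by move=> /(essbZ (-1)) h; under eq_fun do rewrite -mulN1r.
Qed.

Lemma essbB f g : essb f -> essb g -> essb (fun x => f x - g x).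
Proof. by move=> hf /essbN; apply: essbD. Qed.

Lemma essb_sum (I : Type) (r : seq I) (Q : pred I) (F : I -> T -> R) :
  (forall i, essb (F i)) -> essb (fun x => \sum_(i <- r | Q i) F i x).
Proof.
move=> h; elim: r => [|i r IH]; first by under eq_fun do rewrite big_nil; exact: essb_cst.
under eq_fun do rewrite big_cons.
by case: (Q i) => //; apply: essbD.
Qed.

Lemma essb_indic A : measurable A -> essb (\1_A).
Proof.
move=> mA; split; first exact: measurable_indic.
by exists 1; apply: aeW => x; rewrite indicE; case: (_ \in _); rewrite /= ?normr1 ?normr0.
Qed.

Lemma essb_norm f : essb f -> essb (fun x => `|f x|).
Proof.
move=> [mf [M fM]]; split; first exact: measurableT_comp.
by exists M; apply: filterS fM => x; rewrite normr_id.
Qed.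

Lemma essb_max f g : essb f -> essb g -> essb (fun x => Num.max (f x) (g x)).
Proof.
move=> [mf [M fM]] [mg [N gN]]; split; first exact: measurable_maxr.
exists (M + N); apply: filterS2 fM gN => x fx gx.
have M0 := le_trans (normr_ge0 _) fx; have N0 := le_trans (normr_ge0 _) gx.
by rewrite maxElt; case: ifP => _; [apply: (le_trans gx)|apply: (le_trans fx)];
  rewrite ?lerDl ?lerDr.
Qed.

Lemma essb_min f g : essb f -> essb g -> essb (fun x => Num.min (f x) (g x)).
Proof.
move=> hf hg; rewrite (_ : (fun x => _) = fun x => f x + g x - Num.max (f x) (g x)).
  by apply: essbB; [exact: essbD|exact: essb_max].
by apply/funext => x; rewrite -(addr_max_min (f x) (g x)) addrAC subrr add0r.
Qed.

Lemma essb_powR f (r : R) : 0 <= r -> (forall x, 0 <= f x) -> essb f ->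
  essb (fun x => f x `^ r).
Proof.
move=> r0 f0 [mf [M fM]]; split; first exact: (measurableT_comp (measurable_powR r)).
exists (M `^ r); apply: filterS fM => x fx.
rewrite ger0_norm ?powR_ge0// ge0_ler_powR// ?nnegrE//.
  exact: le_trans (normr_ge0 _) fx.
by rewrite (le_trans (ler_norm _)).
Qed.

Lemma essb_integrable A f : measurable A -> essb f ->
  P.-integrable A (EFin \o f).
Proof.
move=> mA [mf [M fM]].
have mf' : measurable_fun A f by exact: measurable_funTS.
apply/integrableP; split; first exact/measurable_EFinP.
apply: (@le_lt_trans _ _ (\int[P]_(x in A) (`|M|)%:E)%E).
  apply: ae_ge0_le_integral => //.
  - exact/measurable_EFinP/measurableT_comp.
  - by apply: filterS fM => x fx Ax /=; rewrite lee_fin (le_trans fx) // ler_norm.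
rewrite integral_cst//= lte_mul_pinfty//.
by rewrite (le_lt_trans (probability_le1 P mA))// ltry.
Qed.

Definition integ A f := \int[P]_(x in A) f x.
Local Notation J := integ.

Definition mass A : R := fine (P A).
Local Notation m := mass.

Lemma m_ge0 A : 0 <= m A. Proof. exact/fine_ge0/measure_ge0. Qed.

Lemma EFin_m A : measurable A -> (m A)%:E = P A.
Proof. by move=> mA; rewrite fineK // fin_num_measure. Qed.

Lemma m_setT : m setT = 1. Proof. by rewrite /m probability_setT. Qed.
Lemma m_set0 : m set0 = 0. Proof. by rewrite /m measure0. Qed.

Lemma le_m A B : measurable A -> measurable B -> A `<=` B -> m A <= m B.
Proof.
by move=> mA mB AB; rewrite -lee_fin !EFin_m// le_measure ?inE.
Qed.

Lemma mU A B : measurable A -> measurable B -> A `&` B = set0 ->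
  m (A `|` B) = m A + m B.
Proof.
move=> mA mB AB; apply: EFin_inj; rewrite EFinD !EFin_m //; last exact: measurableU.
by rewrite measureU.
Qed.

Lemma mD A B : measurable A -> measurable B -> B `<=` A ->
  m (A `\` B) = m A - m B.
Proof.
move=> mA mB BA; have -> : m A = m (B `|` A `\` B) by rewrite setDUK.
rewrite mU//; [ring|exact: measurableD|].
by rewrite setDE setICA setICr setI0.
Qed.

Lemma le_mU A B : measurable A -> measurable B -> m (A `|` B) <= m A + m B.
Proof.
move=> mA mB; rewrite -lee_fin EFinD !EFin_m //; last exact: measurableU.
exact: measureU2.
Qed.

Lemma JD A f g : measurable A -> essb f -> essb g ->
  J A (fun x => f x + g x) = J A f + J A g.
Proof. by move=> mA hf hg; apply: RintegralD => //; apply: essb_integrable. Qed.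

Lemma JZ A c f : measurable A -> essb f -> J A (fun x => c * f x) = c * J A f.
Proof. by move=> mA hf; apply: RintegralZl => //; apply: essb_integrable. Qed.

Lemma JN A f : measurable A -> essb f -> J A (fun x => - f x) = - J A f.
Proof. by move=> mA hf; rewrite -mulN1r -JZ//; congr J; apply/funext => x; rewrite mulN1r. Qed.

Lemma JB A f g : measurable A -> essb f -> essb g ->
  J A (fun x => f x - g x) = J A f - J A g.
Proof. by move=> mA hf hg; apply: RintegralB => //; apply: essb_integrable. Qed.

Lemma J_sum A (I : Type) (r : seq I) (Q : pred I) (F : I -> T -> R) :
  measurable A -> (forall i, essb (F i)) ->
  J A (fun x => \sum_(i <- r | Q i) F i x) = \sum_(i <- r | Q i) J A (F i).
Proof.
move=> mA h; elim: r => [|i r IH].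
  rewrite big_nil; under [X in J A X]eq_fun do rewrite big_nil.
  by rewrite /J Rintegral_cst // mul0r.
rewrite big_cons; under [X in J A X]eq_fun do rewrite big_cons.
case: (Q i) => //; rewrite JD // ?IH//; exact: essb_sum.
Qed.

Lemma J_cst A c : measurable A -> J A (fun=> c) = c * m A.
Proof. by move=> mA; rewrite /J Rintegral_cst. Qed.

Lemma J_ge0 A f : (forall x, A x -> 0 <= f x) -> 0 <= J A f.
Proof. exact: Rintegral_ge0. Qed.

Lemma J_set0 f : J set0 f = 0. Proof. exact: Rintegral_set0. Qed.

Lemma eq_J A f g : (forall x, A x -> f x = g x) -> J A f = J A g.
Proof. by move=> h; apply: eq_Rintegral => x; rewrite inE => /h. Qed.

Lemma ae_eq_J A f g : measurable A -> essb f -> essb g ->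
  {ae P, forall x, A x -> f x = g x} -> J A f = J A g.
Proof.
move=> mA [mf _] [mg _] h; congr fine; apply: ae_eq_integral => //.
- by apply/measurable_EFinP; apply: measurable_funTS.
- by apply/measurable_EFinP; apply: measurable_funTS.
- by apply: filterS h => x fg Ax; rewrite /= fg.
Qed.

Lemma le_J A f g : measurable A -> essb f -> essb g ->
  {ae P, forall x, A x -> f x <= g x} -> J A f <= J A g.
Proof.
move=> mA hf hg h.
(* The inequality holds only almost everywhere; [min f g] lies below [g] at every point and agrees
   with [f] almost everywhere on [A]. *)
rewrite -(_ : J A (fun x => Num.min (f x) (g x)) = J A f).
  apply: le_Rintegral => //; try exact: essb_integrable.
    by apply: essb_integrable => //; exact: essb_min.
  by move=> x Ax; rewrite ge_min lexx orbT.
apply: ae_eq_J => //; first exact: essb_min.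
by apply: filterS h => x fg Ax; rewrite min_l// fg.
Qed.

Lemma JU A B f : measurable A -> measurable B -> A `&` B = set0 -> essb f ->
  J (A `|` B) f = J A f + J B f.
Proof.
move=> mA mB AB hf; apply: Rintegral_setU => //; last by apply/disj_setPS; rewrite AB.
by apply: essb_integrable => //; apply: measurableU.
Qed.

Lemma J_indic A B f : J A (fun x => f x * \1_B x) = J (A `&` B) f.
Proof.
rewrite /J Rintegral_mkcondr; apply: eq_Rintegral => x _.
by rewrite patchE indicE; case: (x \in B); rewrite ?mulr1 ?mulr0.
Qed.

Lemma JDset A B f : measurable A -> measurable B -> B `<=` A -> essb f ->
  J (A `\` B) f = J A f - J B f.
Proof.
move=> mA mB BA hf; have -> : J A f = J (B `|` A `\` B) f by rewrite setDUK.
rewrite JU//; [ring|exact: measurableD|].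
by rewrite setDE setICA setICr setI0.
Qed.

Lemma le_J_set A B f : measurable A -> measurable B -> A `<=` B -> essb f ->
  (forall x, 0 <= f x) -> J A f <= J B f.
Proof.
move=> mA mB AB hf f0; rewrite -subr_ge0 -JDset //; exact: J_ge0.
Qed.

Lemma J_eq0 A f : measurable A -> essb f -> (forall x, 0 <= f x) ->
  J A f = 0 -> {ae P, forall x, A x -> f x = 0}.
Proof.
move=> mA hf f0 Jf.
have mf : measurable_fun A (EFin \o f).
  by apply/measurable_EFinP/measurable_funTS; case: hf.
have [+ _] := ae_eq_integral_abs P mA mf; rewrite /ae_eq/=.
move=> H; have : (\int[P]_(x in A) `|(f x)%:E| = 0)%E.
  have fin : (\int[P]_(x in A) (f x)%:E)%E \is a fin_num.
    exact: integrable_fin_num (essb_integrable mA hf).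
  under eq_integral do rewrite gee0_abs ?lee_fin//.
  by rewrite -(fineK fin); congr EFin.
by move=> /H; apply: filterS => x h /h [].
Qed.

End essentially_bounded.

(** * Inequalities for real powers *)

Section power_inequalities.
Context {R : realType}.
Implicit Types (a b c x y t p th : R).

Lemma ler_powR2 p x y : 0 <= p -> 0 <= x -> x <= y -> x `^ p <= y `^ p.
Proof.
by move=> p0 x0 xy; rewrite ge0_ler_powR// nnegrE// (le_trans x0).
Qed.

Lemma powRK p x : p != 0 -> 0 <= x -> (x `^ p) `^ p^-1 = x.
Proof. by move=> p0 x0; rewrite -powRrM divff// powRr1. Qed.

Lemma powRVK p x : p != 0 -> 0 <= x -> (x `^ p^-1) `^ p = x.
Proof. by move=> p0 x0; rewrite -powRrM mulVf// powRr1. Qed.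

(** Each [a i] is at most the [p]-th root of the sum of all [p]-th powers. No convexity enters, so
    every [p > 0] is covered, at the price of a constant that is not sharp. *)
Lemma powR_sum_le p (k : nat) (a : 'I_k -> R) : 0 < p -> (forall i, 0 <= a i) ->
  (\sum_i a i) `^ p <= k%:R `^ p * \sum_i a i `^ p.
Proof.
move=> p0 a0; set s := \sum_i a i `^ p.
have s0 : 0 <= s by apply: sumr_ge0 => i _; exact: powR_ge0.
rewrite -[s](@powRVK p) ?gt_eqF// -powRM ?powR_ge0//.
apply: ler_powR2; [exact: ltW|exact: sumr_ge0|].
rewrite mulr_natl -[k in X in _ <= X]card_ord -sumr_const; apply: ler_sum => i _.
rewrite -[a i](@powRK p) ?gt_eqF//; apply: ler_powR2; [by rewrite invr_ge0 ltW|exact: powR_ge0|].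
by rewrite /s (bigD1 i)//= lerDl sumr_ge0// => j _; exact: powR_ge0.
Qed.

Lemma powRD_le p a b : 0 < p -> 0 <= a -> 0 <= b ->
  (a + b) `^ p <= 2 `^ p * (a `^ p + b `^ p).
Proof.
move=> p0 a0 b0; have /= := @powR_sum_le p 2 (fun i => if i == 0 then a else b) p0.
rewrite !big_ord_recl !big_ord0/= !addr0; apply => i.
by case: ifP.
Qed.

Lemma powR_subadd th a b : 0 <= th <= 1 -> 0 <= a -> 0 <= b ->
  (a + b) `^ th <= a `^ th + b `^ th.
Proof.
move=> /andP[th0 th1] a0 b0.
have [s0|s0] := eqVneq (a + b) 0.
  have -> : a = 0 by lra. have -> : b = 0 by lra.
  by rewrite addr0 lerDl powR_ge0.
have sp : 0 < a + b by rewrite lt_neqAle eq_sym s0 addr_ge0.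
(* A ratio in [0, 1] is at most its power with exponent [th <= 1]; the two ratios of [a] and [b] to
   [a + b] sum to 1. *)
have H z : 0 <= z <= a + b -> z / (a + b) * (a + b) `^ th <= z `^ th.
  move=> /andP[z0 zs]; rewrite -[X in _ <= X `^ _](@divfK _ (a + b))//.
  have zd := divr_ge0 z0 (ltW sp); rewrite (powRM _ zd (ltW sp)); apply: ler_wpM2r; first exact: powR_ge0.
  have [->|zn0] := eqVneq z 0; first by rewrite mul0r powR_ge0.
  apply: ger1_powR => //; rewrite ler_pdivrMr// mul1r zs andbT divr_gt0//.
  by rewrite lt_neqAle eq_sym zn0.
rewrite -[leLHS]mul1r -(divff s0) mulrDl mulrDl.
by apply: lerD; apply: H; lra.
Qed.

Lemma powR_subadd_sum th (I : Type) (r : seq I) (Q : pred I) (a : I -> R) :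
  0 < th <= 1 -> (forall i, 0 <= a i) ->
  (\sum_(i <- r | Q i) a i) `^ th <= \sum_(i <- r | Q i) a i `^ th.
Proof.
move=> /andP[th0 th1] a0; elim: r => [|i r IH].
  by rewrite !big_nil powR0 // gt_eqF.
rewrite !big_cons; case: (Q i) => //.
apply: (le_trans (powR_subadd _ _ _)) => //; first by rewrite ltW.
  exact: sumr_ge0.
by rewrite lerD2l.
Qed.

(** The graph of the [p]-th power lies above its tangent at [c]. This form, affine in [x], can be
    integrated over an atom with [c] fixed; it yields Hölder's and Doob's inequalities. *)
Lemma young p c x : 1 < p -> 0 <= c -> 0 <= x ->
  p * c `^ (p - 1) * x <= (p - 1) * c `^ p + x `^ p.
Proof.
move=> p1 c0 x0; have p0 : 0 < p by lra. have q0 : 0 < p - 1 by lra.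
have := @conjugate_powR _ x (c `^ (p - 1)) p (p / (p - 1)) x0 (powR_ge0 _ _) p0.
rewrite -powRrM [(p - 1) * _]mulrC divfK ?gt_eqF// => H.
have {}H := H (divr_gt0 p0 q0) _.
rewrite -(ler_pM2l (_ : 0 < p^-1)) ?invr_gt0//.
have -> : p^-1 * (p * c `^ (p - 1) * x) = x * c `^ (p - 1).
  by field; rewrite gt_eqF.
apply: (le_trans (H _)).
  by rewrite invf_div; field; rewrite gt_eqF.
rewrite le_eqVlt; apply/orP; left; apply/eqP; field.
by rewrite !gt_eqF.
Qed.

(** Below [t] the first term suffices; above [t], write the power as [x] times a negative power of
    [x], which is largest at [t]. The right side is affine in [x], so it can be summed over disjoint
    sets. *)
Lemma powR_threshold th t x : 0 < th < 1 -> 0 < t -> 0 <= x ->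
  x `^ th <= t `^ th + x * t `^ (th - 1).
Proof.
move=> /andP[th0 th1] t0 x0; have [xt|xt] := lerP x t.
  by rewrite (le_trans (ler_powR2 (ltW th0) x0 xt))// lerDl mulr_ge0// powR_ge0.
apply: (@le_trans _ _ (x * t `^ (th - 1))); last by rewrite lerDr powR_ge0.
have xp := lt_trans t0 xt.
rewrite -(mulr_powRB1 (ltW xp) th0) ler_pM2l//.
have -> : th - 1 = - (1 - th) by ring.
rewrite !powRN lef_pV2 ?posrE ?powR_gt0//; apply: ler_powR2; lra.
Qed.

Lemma powR_lt1 a e : 1 < a -> 0 < e -> a `^ (- e) < 1.
Proof.
move=> a1 e0; have a0 : 0 < a by lra.
rewrite powRN invf_lt1 ?powR_gt0// -[X in X < _](@powRr0 _ a) /powR gt_eqF//.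
by rewrite ltr_expR ltr_pM2r// ln_gt0.
Qed.

End power_inequalities.

Section holder.
Context d (T : measurableType d) (R : realType) (P : probability T R).

(** Integrate [young] over [A] with [c] the mean value of [f] on [A]. If [A] is null, both sides
    vanish because [f] is essentially bounded. *)
Lemma J_holder (A : set T) (f : T -> R) (p : R) : 1 < p -> measurable A ->
  essb P f -> (forall x, 0 <= f x) ->
  integ P A f `^ p <= mass P A `^ (p - 1) * integ P A (fun x => f x `^ p).
Proof.
move=> p1 mA hf f0; have p0 : 0 < p by lra.
have hfp : essb P (fun x => f x `^ p) by apply: essb_powR => //; exact: ltW.
have Y c : 0 <= c -> p * c `^ (p - 1) * integ P A f <=
    (p - 1) * c `^ p * mass P A + integ P A (fun x => f x `^ p).
  move=> c0; rewrite -JZ// -J_cst// -JD//; last exact: essb_cst.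
  apply: le_J => //; [exact: essbZ| exact: essbD (essb_cst _ _) _|].
  by apply: aeW => x _; exact: young.
have [mA0|mA0] := eqVneq (mass P A) 0.
  suff -> : integ P A f = 0 by rewrite powR0 ?gt_eqF// mulr_ge0 ?powR_ge0// J_ge0// => x _; exact: powR_ge0.
  have [M [fM]] : exists M : R, essb P (fun=> M) /\ {ae P, forall x, A x -> f x <= M}.
    have [_ [M fM]] := hf; exists M; split; first exact: essb_cst.
    by apply: filterS fM => x fx _; rewrite (le_trans (ler_norm _)).
  move=> /(le_J mA hf fM); rewrite J_cst// mA0 mulr0 => h; apply/eqP.
  by rewrite eq_le h J_ge0.
have mp : 0 < mass P A by rewrite lt_neqAle eq_sym mA0 m_ge0.
have Jp : 0 <= integ P A f by exact: J_ge0.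
have := Y (integ P A f / mass P A) (divr_ge0 Jp (ltW mp)).
set c := integ P A f / mass P A => {}Y; have c0 : 0 <= c by exact: divr_ge0 Jp (ltW mp).
have e : integ P A f = c * mass P A by rewrite divfK.
rewrite e in Y *; rewrite powRM ?(ltW mp)// -(mulr_powRB1 (ltW mp) p0).
rewrite mulrCA mulrA mulrC ler_wpM2l ?powR_ge0//.
have -> : mass P A * c `^ p = p * (c `^ p * mass P A) - (p - 1) * c `^ p * mass P A by ring.
rewrite lerBlDl; apply: le_trans Y; rewrite -{1}(mulr_powRB1 c0 p0) le_eqVlt.
by apply/orP; left; apply/eqP; ring.
Qed.

End holder.

(** * Atoms of a binary filtration *)

Section filtration.
Context d (T : measurableType d) (R : realType) (P : probability T R).
Variable F : binary_filtration P.
Implicit Types (A B : set T) (x y : T) (n : nat).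

Local Notation Sp n := (bf_split F n.+1).
Local Notation Sm n := (bf_small F n.+1).
Local Notation La n := (bf_large F n.+1).
Local Notation m := (mass P).

(** The atom of level [n] around [x], by recursion on the splits instead of through the generated
    sigma-algebras; [atomsE] identifies the two notions. Most inductions on levels run over this
    function. *)
Fixpoint atom_at n x : set T :=
  if n is k.+1 then
    if x \in Sm k then Sm k else if x \in La k then La k else atom_at k x
  else setT.
Local Notation cls := atom_at.

Lemma sm_sub n : Sm n `<=` Sp n.
Proof. by rewrite -bf_cover; exact: subsetUl. Qed.
Lemma la_sub n : La n `<=` Sp n.
Proof. by rewrite -bf_cover; exact: subsetUr. Qed.

Lemma cls_sm n x : Sm n x -> cls n.+1 x = Sm n.
Proof. by move=> h; rewrite /= mem_set. Qed.

Lemma sm_la n x : Sm n x -> La n x -> False.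
Proof. by move=> h1 h2; have : (Sm n `&` La n) x by []; rewrite bf_disj. Qed.

Lemma cls_la n x : La n x -> cls n.+1 x = La n.
Proof.
move=> h; rewrite /= ifF; first by rewrite mem_set.
by apply/memNset => h'; exact: sm_la h' h.
Qed.

Lemma cls_other n x : ~ Sp n x -> cls n.+1 x = cls n x.
Proof.
move=> h; rewrite /= !ifF//; apply/memNset => h'; apply: h.
  exact: la_sub.
exact: sm_sub.
Qed.

Lemma sp_cases n x : Sp n x -> Sm n x \/ La n x.
Proof. by rewrite -bf_cover. Qed.

(** The members of [F n] are the unions of classes. The three claims need each other in the
    induction: that the split atom is a class rests on all of them at the previous level. *)
Lemma cls_invariant n : [/\ forall x, cls n x x,
   forall x y, cls n x y -> cls n y = cls n x &
   forall B, F n B <-> forall x, B x -> cls n x `<=` B].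
Proof.
elim: n => [|n [IH1 IH2 IH3]].
  split=> // B; rewrite bf_sigma0; split.
    by case=> -> //.
  move=> h; have [->|/set0P[x Bx]] := eqVneq B set0; first by left.
  by right; apply/seteqP; split=> //; exact: h Bx.
have spcls x : Sp n x -> cls n x = Sp n.
  move=> Sx; have [FS _ atom] := bf_split_atom F n.
  have cS : cls n x `<=` Sp n by apply: (IH3 _).1.
  have /atom/(_ cS)[] // : F n (cls n x).
    by apply/IH3 => y /IH2 ->.
  by move=> c0; have := IH1 x; rewrite c0.
have self x : cls n.+1 x x.
  have [/sp_cases[h|h]|h] := pselect (Sp n x).
  - by rewrite cls_sm.
  - by rewrite cls_la.
  - by rewrite cls_other.
have trans x y : cls n.+1 x y -> cls n.+1 y = cls n.+1 x.
  have [/sp_cases[h|h]|h] := pselect (Sp n x).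
  - by rewrite cls_sm// => /cls_sm.
  - by rewrite cls_la// => /cls_la.
  - rewrite cls_other// => xy; have e := IH2 _ _ xy.
    rewrite cls_other // => Sy; apply: h; rewrite -(spcls _ Sy) e; exact: IH1.
split=> // B; rewrite bf_sigmaS; split.
  move: B; apply: smallest_sub.
    split.
    - by [].
    - move=> B hB x [_ nBx]; move=> y xy; split=> // By; apply: nBx.
      by apply: (hB _ By); rewrite (trans _ _ xy); exact: self.
    - move=> A hA x [k _ Ax] y xy; exists k => //; exact: hA Ax _ xy.
  move=> B [/IH3 hB|[->|->]] x Bx; [|by rewrite cls_sm|by rewrite cls_la].
    have [/sp_cases[h|h]|h] := pselect (Sp n x).
    - rewrite cls_sm//; apply: subset_trans (hB _ Bx).
      by rewrite spcls; [exact: sm_sub|exact: sm_sub].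
    - rewrite cls_la//; apply: subset_trans (hB _ Bx).
      by rewrite spcls; [exact: la_sub|exact: la_sub].
    - by rewrite cls_other//; exact: hB.
move=> hB; have [_ _ atom] := bf_split_atom F n.
set G := <<s _ >>.
have G0 : G set0 by exact: sigma_algebra0.
have sub A : (F n `|` [set Sm n; La n]) A -> G A by exact: sub_gen_smallest.
have GU A1 A2 : G A1 -> G A2 -> G (A1 `|` A2).
  move=> h1 h2; rewrite -bigcup2E; apply: sigma_algebra_bigcup => i.
  by rewrite /bigcup2; case: i => [|[|i]].
(* Each of the three pieces is empty or a generator: the first belongs to [F n], and a union of
   classes that meets a child contains it. *)
rewrite (_ : B = (B `\` Sp n) `|` (B `&` Sm n) `|` (B `&` La n)); last first.
  apply/seteqP; split=> [x Bx|x [[[]|[]]|[]]]//.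
  have [/sp_cases[h|h]|h] := pselect (Sp n x).
  - by left; right.
  - by right.
  - by left; left.
apply: (GU); [apply: (GU)|].
- apply: sub; left; apply/IH3 => x [Bx nSx] y xy; split.
    by apply: (hB _ Bx); rewrite cls_other.
  by move=> Sy; apply: nSx; rewrite -(spcls _ Sy) (IH2 _ _ xy); exact: IH1.
- have [->//|/set0P[x [Bx Sx]]] := eqVneq (B `&` Sm n) set0.
  apply: sub; right; left; apply/seteqP; split=> [y []//|y Sy]; split=> //.
  by apply: (hB _ Bx); rewrite cls_sm.
- have [->//|/set0P[x [Bx Sx]]] := eqVneq (B `&` La n) set0.
  apply: sub; right; right; apply/seteqP; split=> [y []//|y Sy]; split=> //.
  by apply: (hB _ Bx); rewrite cls_la.
Qed.

Lemma cls_self n x : cls n x x.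
Proof. by have [] := cls_invariant n. Qed.

Lemma cls_eq n x y : cls n x y -> cls n y = cls n x.
Proof. by have [_ h _] := cls_invariant n; exact: h. Qed.

Lemma sigmaE n B : F n B <-> forall x, B x -> cls n x `<=` B.
Proof. by have [_ _ h] := cls_invariant n. Qed.

Lemma atomsE n A : atoms (F n) A <-> exists x, A = cls n x.
Proof.
split=> [[/sigmaE FA [x Ax] h]|[x ->]].
  exists x; have [||//] := h (cls n x) _ (FA _ Ax); first by apply/sigmaE => y /cls_eq ->.
  by move=> e; have := cls_self n x; rewrite e.
split; [by apply/sigmaE => y /cls_eq ->|by exists x; exact: cls_self|].
move=> B /sigmaE FB Bx; have [->|/set0P[y By]] := eqVneq B set0; first by left.
by right; apply/seteqP; split=> //; rewrite -(cls_eq (Bx _ By)); exact: FB.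
Qed.

Lemma all_atomsE A : all_atoms F A <-> exists n x, A = cls n x.
Proof.
split=> [[n _ /atomsE[x ->]]|[n [x ->]]]; first by exists n, x.
by exists n => //; apply/atomsE; exists x.
Qed.

Lemma all_atoms_cls n x : all_atoms F (cls n x).
Proof. by apply/all_atomsE; exists n, x. Qed.

Lemma cls_sp n x : Sp n x -> cls n x = Sp n.
Proof. by have /atomsE[y ->] := bf_split_atom F n; exact: cls_eq. Qed.

Lemma cls_measurable n x : measurable (cls n x).
Proof. by apply: (@bf_measurable _ _ _ _ F n); apply/sigmaE => y /cls_eq ->. Qed.

Lemma atom_measurable A : all_atoms F A -> measurable A.
Proof. by move=> /all_atomsE[n [x ->]]; exact: cls_measurable. Qed.

Lemma sm_nonempty n : exists x, Sm n x.
Proof.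
apply/set0P/eqP => e; have := bf_small_gt0 F n; by rewrite e measure0 ltxx.
Qed.

Lemma la_nonempty n : exists x, La n x.
Proof.
apply/set0P/eqP => e; have := lt_le_trans (bf_small_gt0 F n) (bf_small_le F n).
by rewrite e measure0 ltxx.
Qed.

Lemma sp_atom n : all_atoms F (Sp n).
Proof. by exists n => //; exact: bf_split_atom. Qed.

Lemma sm_atom n : all_atoms F (Sm n).
Proof. by have [x h] := sm_nonempty n; rewrite -(cls_sm h); exact: all_atoms_cls. Qed.

Lemma la_atom n : all_atoms F (La n).
Proof. by have [x h] := la_nonempty n; rewrite -(cls_la h); exact: all_atoms_cls. Qed.

Lemma sm_gt0 n : 0 < m (Sm n).
Proof.
have := bf_small_gt0 F n; rewrite -EFin_m ?lte_fin//.
exact/atom_measurable/sm_atom.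
Qed.

Lemma sm_le_la n : m (Sm n) <= m (La n).
Proof.
have := bf_small_le F n; rewrite -!EFin_m ?lee_fin//; apply: atom_measurable;
  [exact: la_atom|exact: sm_atom].
Qed.

Lemma la_gt0 n : 0 < m (La n).
Proof. exact: lt_le_trans (sm_gt0 n) (sm_le_la n). Qed.

Lemma m_sp n : m (Sp n) = m (Sm n) + m (La n).
Proof.
rewrite -bf_cover mU//; [exact/atom_measurable/sm_atom|exact/atom_measurable/la_atom|].
exact: bf_disj.
Qed.

Lemma cls_gt0 n x : 0 < m (cls n x).
Proof.
elim: n => [|n IH]; first by rewrite m_setT.
have [/sp_cases[h|h]|h] := pselect (Sp n x).
- by rewrite cls_sm// sm_gt0.
- by rewrite cls_la// la_gt0.
- by rewrite cls_other.
Qed.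

Lemma atom_gt0 A : all_atoms F A -> 0 < m A.
Proof. by move=> /all_atomsE[n [x ->]]; exact: cls_gt0. Qed.

Lemma cls_subS n x : cls n.+1 x `<=` cls n x.
Proof.
have [Sx|h] := pselect (Sp n x).
  rewrite (cls_sp Sx); case: (sp_cases Sx) => h.
    by rewrite cls_sm//; exact: sm_sub.
  by rewrite cls_la//; exact: la_sub.
by rewrite cls_other.
Qed.

Lemma cls_sub n k x : (n <= k)%N -> cls k x `<=` cls n x.
Proof.
elim: k => [|k IH]; first by rewrite leqn0 => /eqP ->.
rewrite leq_eqVlt => /predU1P[->//|]; rewrite ltnS => /IH.
by move=> h; apply: subset_trans h; exact: cls_subS.
Qed.

Lemma laminar A B x : all_atoms F A -> all_atoms F B -> A x -> B x ->
  A `<=` B \/ B `<=` A.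
Proof.
move=> /all_atomsE[n [y ->]] /all_atomsE[k [z ->]] Ax Bx.
rewrite -(cls_eq Ax) -(cls_eq Bx).
by have [/cls_sub|/ltnW/cls_sub] := leqP n k; [right|left].
Qed.

Lemma atom_level A x : all_atoms F A -> A x -> exists n, A = cls n x.
Proof. by move=> /all_atomsE[n [y ->]] /cls_eq <-; exists n. Qed.

Lemma atom_nonempty A : all_atoms F A -> exists x, A x.
Proof. by move=> /all_atomsE[n [y ->]]; exists y; exact: cls_self. Qed.

Lemma atom_in_child n A : all_atoms F A -> A `<=` Sp n -> A <> Sp n ->
  A `<=` Sm n \/ A `<=` La n.
Proof.
move=> aA AS neq; have [x Ax] := atom_nonempty aA.
have [k e] := atom_level aA Ax.
have [kn|nk] := leqP k n.
  exfalso; apply: neq; apply/seteqP; split=> //.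
  by rewrite -(cls_sp (AS _ Ax)) e; exact: cls_sub.
have := cls_sub (x := x) nk; rewrite -e.
by case: (sp_cases (AS _ Ax)) => h; [rewrite cls_sm//; left|rewrite cls_la//; right].
Qed.

Lemma sm_neq n : Sm n <> Sp n.
Proof. by move=> e; have := m_sp n; rewrite -e; have := la_gt0 n; lra. Qed.

Lemma la_neq n : La n <> Sp n.
Proof. by move=> e; have := m_sp n; rewrite -e; have := sm_gt0 n; lra. Qed.

Lemma sp_gt_level n k x : (n < k)%N -> Sp k x -> Sp n x ->
  Sm n x /\ Sp k `<=` Sm n \/ La n x /\ Sp k `<=` La n.
Proof.
move=> nk Skx Snx; have := cls_sub (x := x) nk; rewrite (cls_sp Skx).
by case: (sp_cases Snx) => h; [rewrite cls_sm//; left|rewrite cls_la//; right].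
Qed.

(** Induction on the level avoids an enumeration of the atoms: the two children contribute zero, and
    [f] cut off outside the split atom has zero integral over every atom of the level before. *)
Lemma J_atoms_eq0 n (f : T -> R) : essb P f ->
  (forall x, integ P (cls n x) f = 0) -> integ P setT f = 0.
Proof.
have [mS mL mSp] : [/\ forall n, measurable (Sm n), forall n, measurable (La n) &
    forall n, measurable (Sp n)].
  by split=> k; apply: atom_measurable;
    [exact: sm_atom|exact: la_atom|exact: sp_atom].
elim: n f => [|n IH] f hf h; first by have := h point.
have -> : integ P setT f = integ P (~` Sp n) f + integ P (Sp n) f.
  by rewrite -JU ?setUCl ?setICl//; exact: measurableC.
have -> : integ P (Sp n) f = 0.
  rewrite -bf_cover JU// ?bf_disj//.
  have [x /cls_sm <-] := sm_nonempty n; have [y /cls_la <-] := la_nonempty n.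
  by rewrite !h addr0.
rewrite addr0 -[~` _]setTI -J_indic IH//.
  by apply: essbM => //; apply: essb_indic; exact: measurableC.
move=> x; rewrite J_indic; have [Sx|h'] := pselect (Sp n x).
  by rewrite cls_sp// setICr J_set0.
rewrite -[RHS](h x) cls_other//; congr integ; apply/setIidPl => y xy Sy.
by apply: h'; rewrite -(cls_sp Sy) (cls_eq xy); exact: cls_self.
Qed.

End filtration.

Arguments atom_at : simpl never.

(** * Scalars as points of the Euclidean plane *)

Section plane.
Context {R : rcfType}.
Implicit Types (z w : R[i]%C) (r : R).
Local Notation normc := (@Normc.normc R).

(** The real part of [z] times the conjugate of [w], that is, the real inner product on the
    plane. *)
Definition dot z w : R := complex.Re z * complex.Re w + complex.Im z * complex.Im w.

Lemma normc_ge0 z : 0 <= normc z.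
Proof. by case: z => a b; exact: sqrtr_ge0. Qed.

Lemma normc_sqr z : normc z ^+ 2 = dot z z.
Proof.
case: z => a b; rewrite /Normc.normc /dot sqr_sqrtr ?addr_ge0 ?sqr_ge0//.
Qed.

Lemma normcD_le z w : normc (z + w) <= normc z + normc w.
Proof. exact: le_normcD. Qed.

Lemma normcZ r z : normc (r%:C%C * z) = `|r| * normc z.
Proof.
rewrite Normc.normcM; congr (_ * _).
by rewrite /Normc.normc /= expr0n addr0 sqrtr_sqr.
Qed.

Lemma normcN_eq z : normc (- z) = normc z.
Proof. exact: normcN. Qed.

Lemma normcB_le z w : normc (z - w) <= normc z + normc w.
Proof. by have := normcD_le z (- w); rewrite normcN_eq. Qed.

Lemma ReD z w : complex.Re (z + w) = complex.Re z + complex.Re w.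
Proof. by case: z; case: w. Qed.
Lemma ImD z w : complex.Im (z + w) = complex.Im z + complex.Im w.
Proof. by case: z; case: w. Qed.
Lemma ReZ r z : complex.Re (r%:C%C * z) = r * complex.Re z.
Proof. by case: z => a b /=; rewrite mul0r subr0. Qed.
Lemma ImZ r z : complex.Im (r%:C%C * z) = r * complex.Im z.
Proof. by case: z => a b /=; rewrite mul0r addr0. Qed.

Lemma dotDl z1 z2 w : dot (z1 + z2) w = dot z1 w + dot z2 w.
Proof. by rewrite /dot ReD ImD; ring. Qed.
Lemma dotZl r z w : dot (r%:C%C * z) w = r * dot z w.
Proof. by rewrite /dot ReZ ImZ; ring. Qed.
Lemma dotC z w : dot z w = dot w z.
Proof. by rewrite /dot; ring. Qed.
Lemma dot0l w : dot 0 w = 0.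
Proof. by rewrite /dot /=; ring. Qed.
Lemma dotNl z w : dot (- z) w = - dot z w.
Proof. by case: z => a b; rewrite /dot /=; ring. Qed.
Lemma dotBl z1 z2 w : dot (z1 - z2) w = dot z1 w - dot z2 w.
Proof. by rewrite dotDl dotNl. Qed.

Lemma dot_le z w : `|dot z w| <= normc z * normc w.
Proof.
rewrite -ler_sqr ?nnegrE ?mulr_ge0 ?normc_ge0// real_normK ?num_real// exprMn.
rewrite !normc_sqr /dot -subr_ge0.
set a := complex.Re z; set b := complex.Im z; set c := complex.Re w; set e := complex.Im w.
rewrite (_ : _ - _ = (a * e - b * c) ^+ 2); last by ring.
exact: sqr_ge0.
Qed.

Lemma Re_le_normc z : `|complex.Re z| <= normc z.
Proof.
rewrite -ler_sqr ?nnegrE ?normc_ge0// real_normK ?num_real// normc_sqr /dot.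
by rewrite expr2 lerDl -expr2 sqr_ge0.
Qed.

Lemma Im_le_normc z : `|complex.Im z| <= normc z.
Proof.
rewrite -ler_sqr ?nnegrE ?normc_ge0// real_normK ?num_real// normc_sqr /dot.
by rewrite expr2 lerDr -expr2 sqr_ge0.
Qed.

Lemma Re_sum (I : Type) (s : seq I) (Q : pred I) (a : I -> R[i]%C) :
  complex.Re (\sum_(i <- s | Q i) a i) = \sum_(i <- s | Q i) complex.Re (a i).
Proof. by apply: (big_morph (@complex.Re R)) => //; exact: ReD. Qed.
Lemma Im_sum (I : Type) (s : seq I) (Q : pred I) (a : I -> R[i]%C) :
  complex.Im (\sum_(i <- s | Q i) a i) = \sum_(i <- s | Q i) complex.Im (a i).
Proof. by apply: (big_morph (@complex.Im R)) => //; exact: ImD. Qed.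

Lemma normc_sum_le (I : Type) (s : seq I) (Q : pred I) (a : I -> R[i]%C) :
  normc (\sum_(i <- s | Q i) a i) <= \sum_(i <- s | Q i) normc (a i).
Proof.
elim: s => [|i s IH]; first by rewrite !big_nil Normc.normc0.
rewrite !big_cons; case: (Q i) => //.
by rewrite (le_trans (normcD_le _ _))// lerD2l.
Qed.

Lemma dot_suml (I : Type) (s : seq I) (Q : pred I) (a : I -> R[i]%C) w :
  dot (\sum_(i <- s | Q i) a i) w = \sum_(i <- s | Q i) dot (a i) w.
Proof.
by apply: (big_morph (fun z => dot z w)); [move=> *; exact: dotDl|exact: dot0l].
Qed.

End plane.

Section planar_functions.
Context d (T : measurableType d) (R : realType) (P : probability T R).
Implicit Types (f g h : T -> R[i]%C) (A B : set T).

Definition nrm f : T -> R := fun x => Normc.normc (f x).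

Definition essb_scalar f := essb P (fun x => complex.Re (f x)) /\
                      essb P (fun x => complex.Im (f x)).
Local Notation vessb := essb_scalar.

Lemma nrm_ge0 f x : 0 <= nrm f x. Proof. exact: normc_ge0. Qed.

Lemma vessbD f g : vessb f -> vessb g -> vessb (fun x => f x + g x).
Proof.
move=> [f1 f2] [g1 g2]; split.
  by under eq_fun do rewrite ReD; exact: essbD.
by under eq_fun do rewrite ImD; exact: essbD.
Qed.

Lemma vessbZ r f : vessb f -> vessb (fun x => r%:C%C * f x).
Proof.
move=> [f1 f2]; split.
  by under eq_fun do rewrite ReZ; exact: essbZ.
by under eq_fun do rewrite ImZ; exact: essbZ.
Qed.

Lemma vessbN f : vessb f -> vessb (fun x => - f x).
Proof.
move=> /(vessbZ (-1)); congr vessb; apply/funext => x.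
by rewrite rmorphN1 mulN1r.
Qed.

Lemma vessbB f g : vessb f -> vessb g -> vessb (fun x => f x - g x).
Proof. by move=> hf /vessbN; exact: vessbD. Qed.

Lemma vessb_sum (I : Type) (r : seq I) (Q : pred I) (F : I -> T -> R[i]%C) :
  (forall i, vessb (F i)) -> vessb (fun x => \sum_(i <- r | Q i) F i x).
Proof.
move=> h; split.
  by under eq_fun do rewrite Re_sum; apply: essb_sum => i; case: (h i).
by under eq_fun do rewrite Im_sum; apply: essb_sum => i; case: (h i).
Qed.

Lemma restrE f A x : restr f A x = if x \in A then f x else 0.
Proof. by rewrite /restr indicE; case: ifP; rewrite ?mulr1 ?mulr0. Qed.

Lemma restr_in f A x : A x -> restr f A x = f x.
Proof. by move=> Ax; rewrite restrE mem_set. Qed.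

Lemma restr_out f A x : ~ A x -> restr f A x = 0.
Proof. by move=> Ax; rewrite restrE memNset. Qed.

Lemma vessb_restr f A : measurable A -> vessb f -> vessb (restr f A).
Proof.
move=> mA [f1 f2]; have hA := essb_indic P mA.
have e x : (restr f A x) = (\1_A x)%:C%C * f x.
  rewrite restrE indicE; case: ifP => _; first by rewrite rmorph1 mul1r.
  by rewrite rmorph0 mul0r.
split; under eq_fun do rewrite e ?ReZ ?ImZ; exact: essbM.
Qed.

Lemma essb_dot f g : vessb f -> vessb g -> essb P (fun x => dot (f x) (g x)).
Proof. by move=> [? ?] [? ?]; apply: essbD; exact: essbM. Qed.

Lemma essb_nrm f : vessb f -> essb P (nrm f).
Proof.
move=> [hr hi].
have -> : nrm f = fun x => (dot (f x) (f x)) `^ 2^-1.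
  apply/funext => x; rewrite -normc_sqr powR12_sqrt ?sqr_ge0// sqrtr_sqr.
  by rewrite ger0_norm// nrm_ge0.
apply: essb_powR; first by lra.
  by move=> x; rewrite -normc_sqr sqr_ge0.
exact: essb_dot.
Qed.

Definition Re_inner A f g : R := integ P A (fun x => dot (f x) (g x)).
Local Notation ip := Re_inner.

Lemma ipC A f g : ip A f g = ip A g f.
Proof. by apply: eq_J => x _; exact: dotC. Qed.

Section ip_lemmas.
Variable A : set T.
Hypothesis mA : measurable A.

Lemma ipDl f1 f2 g : vessb f1 -> vessb f2 -> vessb g ->
  ip A (fun x => f1 x + f2 x) g = ip A f1 g + ip A f2 g.
Proof.
by move=> h1 h2 hg; rewrite /ip -JD//; [apply: eq_J => x _; exact: dotDl|
  exact: essb_dot..].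
Qed.

Lemma ipZl r f g : vessb f -> vessb g ->
  ip A (fun x => r%:C%C * f x) g = r * ip A f g.
Proof.
by move=> hf hg; rewrite /ip -JZ//; [apply: eq_J => x _; exact: dotZl|
  exact: essb_dot].
Qed.

Lemma ipBl f1 f2 g : vessb f1 -> vessb f2 -> vessb g ->
  ip A (fun x => f1 x - f2 x) g = ip A f1 g - ip A f2 g.
Proof.
by move=> h1 h2 hg; rewrite /ip -JB//; [apply: eq_J => x _; exact: dotBl|
  exact: essb_dot..].
Qed.

Lemma ip_suml (I : Type) (r : seq I) (Q : pred I) (a : I -> T -> R[i]%C) g :
  (forall i, vessb (a i)) -> vessb g ->
  ip A (fun x => \sum_(i <- r | Q i) a i x) g = \sum_(i <- r | Q i) ip A (a i) g.
Proof.
move=> ha hg; rewrite /ip -J_sum//; last by move=> i; exact: essb_dot.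
by apply: eq_J => x _; exact: dot_suml.
Qed.

Lemma ae_eq_ipl f1 f2 g : vessb f1 -> vessb f2 -> vessb g ->
  {ae P, forall x, A x -> f1 x = f2 x} -> ip A f1 g = ip A f2 g.
Proof.
move=> h1 h2 hg h; apply: ae_eq_J => //; [exact: essb_dot..|].
by apply: filterS h => x e Ax; rewrite e.
Qed.

Lemma ip_ge0 f : 0 <= ip A f f.
Proof. by apply: J_ge0 => x _; rewrite -normc_sqr sqr_ge0. Qed.

Lemma ip_eq0 f : vessb f -> ip A f f = 0 -> {ae P, forall x, A x -> f x = 0}.
Proof.
move=> hf /(J_eq0 mA (essb_dot hf hf)) h.
have {}h := h _; apply: filterS (h _) => [x e Ax|x]; last by rewrite -normc_sqr sqr_ge0.
apply: Normc.eq0_normc; apply/eqP; rewrite -sqrf_eq0 normc_sqr; apply/eqP; exact: e.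
Qed.

Lemma ip_le f g c : vessb f -> vessb g -> 0 <= c ->
  {ae P, forall x, A x -> nrm g x <= c} -> `|ip A f g| <= c * integ P A (nrm f).
Proof.
move=> hf hg c0 h; apply: (@le_trans _ _ (integ P A (fun x => `|dot (f x) (g x)|))).
  by apply: le_normr_Rintegral => //; apply: essb_integrable => //; exact: essb_dot.
rewrite -JZ//; last exact: essb_nrm.
apply: le_J => //; [exact/essb_norm/essb_dot|exact/essbZ/essb_nrm|].
apply: filterS h => x gc Ax; apply: (le_trans (dot_le _ _)).
by rewrite mulrC ler_wpM2r// ?normc_ge0// gc.
Qed.

End ip_lemmas.

End planar_functions.

(** * Projections onto a stable space *)

Section stable_spaces.
Context d (T : measurableType d) (R : realType) (P : probability T R).
Variable F : binary_filtration P.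
Implicit Types (A B : set T) (f g u v w : T -> R[i]%C).
Local Notation m := (mass P).
Local Notation J := (integ P).
Local Notation ip := (Re_inner P).
Local Notation vessb := (essb_scalar P).

(* Scalars are regarded as points of the plane and [S] as a real vector space, so
   that the real and the complex case become one. *)
Record stable_space (S : set (T -> R[i]%C)) := StableSpace {
  ss_dim : nat;
  ss_c1 : R;
  ss_c2 : R;
  ss_c1_gt0 : 0 < ss_c1;
  ss_c2_gt0 : 0 < ss_c2;
  ss_c1_le1 : ss_c1 <= 1;
  ss_c2_le1 : ss_c2 <= 1;
  ss_zero : S (fun=> 0);
  ss_add : forall f g, S f -> S g -> S (fun x => f x + g x);
  ss_scale : forall (r : R) f, S f -> S (fun x => r%:C%C * f x);
  ss_essb : forall f, S f -> vessb f;
  ss_basis : exists b : nat -> T -> R[i]%C, (forall i, S (b i)) /\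
    forall f, S f -> exists c : nat -> R,
      f = fun x => \sum_(i < ss_dim) (c i)%:C%C * b i x;
  ss_stab : forall A f, all_atoms F A -> S f ->
    exists N : R, [/\ 0 <= N, {ae P, forall x, A x -> nrm f x <= N} &
      ss_c2 * m A <= m (A `&` [set x | ss_c1 * N <= nrm f x])] }.

Variable S : set (T -> R[i]%C).
Variable H : stable_space S.

(** The fraction of an atom that may be removed while half of the measure granted by the stability
    inequality survives. *)
Definition kappa : R := locked (ss_c2 H / 2).
Local Notation kap := kappa.
(** The inverse of [ss_c1 H * kap], as produced by [stabP]. *)
Definition stab_cst : R := locked (2 / (ss_c1 H * ss_c2 H)).
Local Notation K0 := stab_cst.

Lemma kap_gt0 : 0 < kap.
Proof. by rewrite /kap -lock divr_gt0// ss_c2_gt0. Qed.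

Lemma kap_le : kap <= 1 / 2.
Proof. by rewrite /kap -lock ler_pM2r ?invr_gt0// ss_c2_le1. Qed.

Lemma K0_ge2 : 2 <= K0.
Proof.
have := ss_c1_gt0 H; have := ss_c2_gt0 H; have := ss_c1_le1 H; have := ss_c2_le1 H.
move=> a b c e; rewrite /K0 -lock ler_pdivlMr ?mulr_gt0//; nra.
Qed.

Lemma ss_sub f g : S f -> S g -> S (fun x => f x - g x).
Proof.
move=> Sf /(ss_scale H (-1)) /(ss_add H Sf); congr S; apply/funext => x.
by rewrite rmorphN1 mulN1r.
Qed.

Lemma ss_sum (I : Type) (r : seq I) (Q : pred I) (a : I -> T -> R[i]%C) :
  (forall i, S (a i)) -> S (fun x => \sum_(i <- r | Q i) a i x).
Proof.
move=> h; elim: r => [|i r IH].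
  by under eq_fun do rewrite big_nil; exact: ss_zero H.
under eq_fun do rewrite big_cons.
by case: (Q i) => //; exact: (ss_add H (h i) IH).
Qed.

Lemma measurable_level f (c : R) : vessb f -> measurable [set x | c <= nrm f x].
Proof.
move=> /essb_nrm[mf _]; have := mf measurableT `[c, +oo[%classic (measurable_itv _).
by rewrite setTI; congr measurable; apply/seteqP; split => x /=;
  rewrite in_itv/= andbT.
Qed.

(** The set where [|f|] is at least [c1] times its bound [N] on [A] has measure at least
    [2 * kap * m A], and at most [kap * m A] of it is lost outside [B]. The remaining part of the
    integral over [B] controls [N]. *)
Lemma stabP A B f : all_atoms F A -> measurable B -> B `<=` A ->
  m (A `\` B) <= kap * m A -> S f ->
  {ae P, forall x, A x -> nrm f x <= K0 / m A * J B (nrm f)}.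
Proof.
move=> aA mB BA hm Sf; have [N [N0 fN hN]] := ss_stab H aA Sf.
have mA := atom_measurable aA; have A0 := atom_gt0 aA.
have vf := ss_essb H Sf; have hnf := essb_nrm vf.
set E := A `&` _ in hN.
have mE : measurable E by apply: measurableI => //; exact: measurable_level.
have EB : kap * m A <= m (E `&` B).
  have : m E <= m (E `&` B) + m (A `\` B).
    apply: le_trans (le_mU _ _ _); [|exact: measurableI|exact: measurableD].
    apply: le_m => //; first by apply: measurableU; [exact: measurableI|exact: measurableD].
    by move=> x [Ax h]; have [Bx|nBx] := pselect (B x); [left|right].
  by move: hm hN; rewrite /kap -lock; lra.
have JN : ss_c1 H * N * m (E `&` B) <= J B (nrm f).
  have mEB : measurable (E `&` B) by exact: measurableI.
  apply: (@le_trans _ _ (J (E `&` B) (nrm f))).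
    rewrite -J_cst//; apply: le_J => //; first exact: essb_cst.
    by apply: aeW => x [[_ ?] _].
  by apply: le_J_set => //; exact: nrm_ge0.
have {}JN : ss_c1 H * N * (kap * m A) <= J B (nrm f).
  by apply: le_trans JN; rewrite ler_wpM2l// mulr_ge0// ltW// ss_c1_gt0.
apply: filterS fN => x fx Ax; apply: (le_trans (fx Ax)).
have c1 := ss_c1_gt0 H; have c2 := ss_c2_gt0 H.
have -> : K0 / m A = (ss_c1 H * (kap * m A))^-1.
  by rewrite /K0 /kap -!lock; field; rewrite !gt_eqF.
rewrite ler_pdivlMl ?mulr_gt0 ?kap_gt0//.
by move: JN; rewrite mulrAC.
Qed.

Lemma stab_self A f : all_atoms F A -> S f ->
  {ae P, forall x, A x -> nrm f x <= K0 / m A * J A (nrm f)}.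
Proof.
move=> aA Sf; have mA := atom_measurable aA; apply: stabP => //.
by rewrite setDv m_set0 mulr_ge0 ?m_ge0// ltW// kap_gt0.
Qed.

(** Expansion in an orthogonal family. The divisor [m A] fits vectors of squared norm [m A] instead
    of 1, a normalisation that keeps their values bounded whatever the size of [A]. *)
Definition ss_expand A (e : nat -> T -> R[i]%C) n v : T -> R[i]%C :=
  fun x => \sum_(i < n) (ip A v (e i) / m A)%:C%C * e i x.

Lemma ss_expandS A e n v :
  ss_expand A e n.+1 v = fun x => ss_expand A e n v x + (ip A v (e n) / m A)%:C%C * e n x.
Proof. by apply/funext => x; rewrite /ss_expand big_ord_recr. Qed.

Lemma ss_expand_in A e n v : (forall i, S (e i)) -> S (ss_expand A e n v).
Proof. by move=> Se; apply: ss_sum => i; exact: ss_scale H _ _ (Se _). Qed.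

Definition ss_fix A e n v := {ae P, forall x, A x -> v x = ss_expand A e n v x}.

Lemma ss_expandD A e n u v : measurable A -> (forall i, S (e i)) -> S u -> S v ->
  ss_expand A e n (fun x => u x + v x) =
  fun x => ss_expand A e n u x + ss_expand A e n v x.
Proof.
move=> mA Se Su Sv; apply/funext => x; rewrite /ss_expand -big_split.
apply: eq_bigr => i _ /=; rewrite ipDl//; try exact: (ss_essb H).
by rewrite mulrDl rmorphD mulrDl.
Qed.

Lemma ss_expandZ A e n r v : measurable A -> (forall i, S (e i)) -> S v ->
  ss_expand A e n (fun x => r%:C%C * v x) = fun x => r%:C%C * ss_expand A e n v x.
Proof.
move=> mA Se Sv; apply/funext => x; rewrite /ss_expand mulr_sumr.
apply: eq_bigr => i _ /=; rewrite ipZl//; try exact: (ss_essb H).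
by rewrite -mulrA rmorphM mulrA.
Qed.

Lemma ss_fixD A e n u v : measurable A -> (forall i, S (e i)) -> S u -> S v ->
  ss_fix A e n u -> ss_fix A e n v -> ss_fix A e n (fun x => u x + v x).
Proof.
move=> mA Se Su Sv hu hv; rewrite /ss_fix ss_expandD//.
by apply: filterS2 hu hv => x hu hv Ax; rewrite -hu// -hv.
Qed.

Lemma ss_fixZ A e n r v : measurable A -> (forall i, S (e i)) -> S v ->
  ss_fix A e n v -> ss_fix A e n (fun x => r%:C%C * v x).
Proof.
move=> mA Se Sv hv; rewrite /ss_fix ss_expandZ//.
by apply: filterS hv => x hv Ax; rewrite -hv.
Qed.

Lemma ss_fix_sum A e n k (c : nat -> R) (b : nat -> T -> R[i]%C) :
  measurable A -> (forall i, S (e i)) -> (forall i, S (b i)) ->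
  (forall i, (i < k)%N -> ss_fix A e n (b i)) ->
  ss_fix A e n (fun x => \sum_(i < k) (c i)%:C%C * b i x).
Proof.
move=> mA Se Sb; elim: k => [|k IH] h.
  apply: aeW => x _; rewrite big_ord0 /ss_expand big1// => i _.
  rewrite (_ : ip _ _ _ = 0) ?mul0r ?rmorph0 ?mul0r// /ip -(mul0r (m A)) -J_cst//.
  by apply: eq_J => y _; rewrite big_ord0 dot0l.
under eq_fun do rewrite big_ord_recr /=.
apply: ss_fixD => //.
- by apply: ss_sum => i; exact: (ss_scale H _ (Sb _)).
- exact: (ss_scale H _ (Sb _)).
- by apply: IH => i ik; apply: h; exact: ltnW.
- by apply: ss_fixZ => //; exact: h.
Qed.

(* Gram-Schmidt: the [e i] are orthogonal on [A] and of squared norm [m A] or [0]. *)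
Lemma gram_schmidt A (b : nat -> T -> R[i]%C) n : all_atoms F A ->
  (forall i, S (b i)) ->
  exists e : nat -> T -> R[i]%C, [/\ forall i, S (e i),
    forall i, ip A (e i) (e i) <= m A,
    forall i, (i < n)%N -> ss_fix A e n (e i) &
    forall i, (i < n)%N -> ss_fix A e n (b i)].
Proof.
move=> aA Sb; have mA := atom_measurable aA; have A0 := atom_gt0 aA.
elim: n => [|n [e [Se e1 ee eb]]].
  exists (fun _ _ => 0); split => //.
  - by move=> i; exact: ss_zero H.
  - move=> i; rewrite /ip (_ : J A _ = 0) ?m_ge0// -(mul0r (m A)) -J_cst//.
    by apply: eq_J => x _; exact: dot0l.
have vS f : S f -> vessb f by exact: (ss_essb H).
have SE v : S (ss_expand A e n v) by exact: ss_expand_in.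
pose r x := b n x - ss_expand A e n (b n) x.
have Sr : S r by exact: ss_sub.
(* The family [b] may be dependent on [A]. If the residual vanishes almost everywhere there, the new
   vector is zero; otherwise it gets squared norm [m A]. *)
pose lam := if ip A r r == 0 then 0 else Num.sqrt (m A / ip A r r).
pose e' i := if i == n then fun x => lam%:C%C * r x else e i.
have Se' i : S (e' i).
  by rewrite /e'; case: ifP => // _; exact: (ss_scale H _ Sr).
have expe' v : ss_expand A e' n v = ss_expand A e n v.
  by apply/funext => x; apply: eq_bigr => i _; rewrite /e' ltn_eqF.
have rr : lam * lam * ip A r r = if ip A r r == 0 then 0 else m A.
  rewrite /lam; case: ifPn => [_|h]; first by rewrite !mul0r.
  by rewrite -expr2 sqr_sqrtr ?divr_ge0 ?m_ge0 ?ip_ge0// divfK.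
have sym v : S v -> ip A (ss_expand A e n v) (b n) = ip A v (ss_expand A e n (b n)).
  move=> Sv; rewrite [RHS]ipC /ss_expand ip_suml//; [|by move=> i; apply/vS/(ss_scale H)|exact: vS].
  rewrite ip_suml//; [|by move=> i; apply/vS/(ss_scale H)|exact: vS].
  apply: eq_bigr => i _; rewrite !ipZl//; try exact: vS.
  by rewrite [ip A (e i) (b n)]ipC [ip A (e i) v]ipC; ring.
have orth v : S v -> ss_fix A e n v -> ip A v r = 0.
  move=> Sv h; rewrite ipC /r ipBl//; try exact: vS.
  rewrite [X in _ - X]ipC -sym// [X in X - _]ipC (ae_eq_ipl _ _ _ _ h)//; try exact: vS.
  by rewrite subrr.
have fix_e' v : S v -> ss_fix A e n v -> ss_fix A e' n.+1 v.
  move=> Sv h; rewrite /ss_fix ss_expandS expe' /e' eqxx.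
  rewrite ipC ipZl//; try exact: vS.
  rewrite ipC orth// mulr0 mul0r rmorph0.
  by apply: filterS h => x hx Ax; rewrite mul0r addr0 -hx.
have expr : ss_expand A e n r = fun=> 0.
  apply/funext => x; rewrite /ss_expand big1// => i _.
  by rewrite ipC orth ?mul0r ?rmorph0 ?mul0r//; exact: ee.
have expr' : ss_expand A e' n.+1 r = fun x => (lam * ip A r r / m A * lam)%:C%C * r x.
  apply/funext => x; rewrite ss_expandS expe' expr add0r /e' eqxx.
  rewrite ipC ipZl//; try exact: vS.
  by rewrite mulrA -rmorphM.
have fix_r : ss_fix A e' n.+1 r.
  rewrite /ss_fix expr'; have [r0|r0] := eqVneq (ip A r r) 0.
    apply: filterS (ip_eq0 mA (vS _ Sr) r0) => x /[apply] ->.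
    by rewrite mulr0.
  apply: aeW => x _; rewrite mulrAC [lam * _ * _]mulrAC rr (negbTE r0) divff ?gt_eqF//.
  by rewrite mul1r.
exists e'; split=> //.
- move=> i; rewrite /e'; case: ifP => // _.
  rewrite ipZl//; [|exact: vS|by apply/vS/(ss_scale H)]; rewrite ipC ipZl//; try exact: vS.
  by rewrite mulrA rr; case: ifP; rewrite ?m_ge0.
- move=> i; rewrite ltnS leq_eqVlt => /predU1P[->|lin].
    by rewrite [X in ss_fix _ _ _ X]/e' eqxx; exact: ss_fixZ.
  by rewrite [X in ss_fix _ _ _ X]/e' ltn_eqF//; apply: fix_e' => //; exact: ee.
- move=> i; rewrite ltnS leq_eqVlt => /predU1P[->|lin].
    rewrite (_ : b n = fun x => r x + ss_expand A e n (b n) x).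
      apply: ss_fixD => //; apply: fix_e' => //.
      exact: (@ss_fix_sum _ _ _ n (fun i => ip A (b n) (e i) / m A) e).
    by apply/funext => x; rewrite /r subrK.
  by apply: fix_e' => //; exact: eb.
Qed.

Lemma J_nrm_sqr A f : measurable A -> vessb f ->
  J A (nrm f) ^+ 2 <= m A * ip A f f.
Proof.
move=> mA vf.
have := @J_holder _ _ _ P A (nrm f) 2 ltac:(lra) mA (essb_nrm vf) (nrm_ge0 _).
rewrite (_ : 2 - 1 = 1); last by ring.
rewrite powRr1 ?m_ge0// powR_mulrn; last by apply: J_ge0 => y _; exact: nrm_ge0.
move=> h; apply: (le_trans h); rewrite ler_wpM2l ?m_ge0// le_eqVlt.
apply/orP; left; apply/eqP.
by apply: eq_J => y _; rewrite powR_mulrn ?nrm_ge0// -normc_sqr.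
Qed.

Definition frame A (e : nat -> T -> R[i]%C) := [/\ forall i, S (e i),
  forall i, {ae P, forall x, A x -> nrm (e i) x <= K0} &
  forall v, S v -> ss_fix A e (ss_dim H) v].

(** Gram-Schmidt applied to a spanning family. By Cauchy-Schwarz a vector of squared norm at most
    [m A] has mean modulus at most 1 on [A], and stability turns this into the uniform bound
    [K0]. *)
Lemma frame_exists A : all_atoms F A -> exists e, frame A e.
Proof.
move=> aA; have [b [Sb hb]] := ss_basis H.
have mA := atom_measurable aA; have A0 := atom_gt0 aA.
have [e [Se e1 _ eb]] := gram_schmidt (ss_dim H) aA Sb.
exists e; split=> // [i|v /hb[c ->]]; last exact: ss_fix_sum.
have ve := ss_essb H (Se i).
apply: filterS (stab_self aA (Se i)) => x h Ax; apply: (le_trans (h Ax)).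
rewrite -[leRHS]mulr1 -mulrA ler_pM2l ?(lt_le_trans _ K0_ge2)//.
rewrite mulrC ler_pdivrMr// mul1r.
rewrite -ler_sqr ?nnegrE ?m_ge0 ?J_ge0//; last by move=> y _; exact: nrm_ge0.
apply: (le_trans (J_nrm_sqr mA ve)); rewrite expr2 ler_pM2l//; exact: e1.
Qed.

(** Here [u] is an element of [S] on the whole space, determined only almost everywhere on [A]. This
    allows projections over different atoms to be compared and bounded on a common larger atom. *)
Definition is_projection A g u := S u /\
  forall v, S v -> ip A (fun x => g x - u x) v = 0.
Local Notation pr := is_projection.

Lemma pr_id A f g : measurable A -> vessb g -> S f -> (forall x, A x -> g x = f x) -> pr A g f.
Proof.
move=> mA vg Sf h; split=> // v Sv; rewrite /ip -(mul0r (m A)) -J_cst//.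
by apply: eq_J => x Ax; rewrite h// subrr dot0l.
Qed.

Lemma pr_unique A g u1 u2 : measurable A -> vessb g -> pr A g u1 -> pr A g u2 ->
  {ae P, forall x, A x -> u1 x = u2 x}.
Proof.
move=> mA vg [S1 h1] [S2 h2]; have v1 := ss_essb H S1; have v2 := ss_essb H S2.
have Sd := ss_sub S1 S2; have vd := ss_essb H Sd.
have := h2 _ Sd; have := h1 _ Sd; rewrite !ipBl// => e1 e2.
have : ip A (fun x => u1 x - u2 x) (fun x => u1 x - u2 x) = 0.
  by rewrite {1}ipBl//; lra.
by move=> /(ip_eq0 mA vd); apply: filterS => x h /h /eqP; rewrite subr_eq0 => /eqP.
Qed.

Lemma pr_sub A g f u : measurable A -> vessb g -> pr A g u -> S f ->
  pr A (fun x => g x - f x) (fun x => u x - f x).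
Proof.
move=> mA vg [Su hu] Sf; split; first exact: ss_sub.
move=> v Sv; rewrite -[RHS](hu v Sv); congr (J A _); apply/funext => x.
by congr dot; rewrite opprB addrA subrK.
Qed.

Lemma pr_exists A g : all_atoms F A -> vessb g -> exists u, pr A g u.
Proof.
move=> aA vg; have [e [Se e1 he]] := frame_exists aA.
have mA := atom_measurable aA; have A0 := atom_gt0 aA.
have vS f : S f -> vessb f by exact: (ss_essb H).
have SE v : S (ss_expand A e (ss_dim H) v) by exact: ss_expand_in.
exists (ss_expand A e (ss_dim H) g); split => // v Sv.
rewrite ipBl//; try exact: vS.
rewrite [X in X - _]ipC (ae_eq_ipl mA _ _ _ (he v Sv))//; try exact: vS.
rewrite /ss_expand !ip_suml//; try exact: vS; try by move=> i; apply/vS/(ss_scale H).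
rewrite -sumrB big1// => i _; rewrite !ipZl//; try exact: vS.
by rewrite [ip A (e i) v]ipC [ip A (e i) g]ipC; ring.
Qed.

Definition mean_abs A g : R := J A (nrm g) / m A.
Local Notation avg := mean_abs.

Lemma avg_ge0 A g : 0 <= avg A g.
Proof. by rewrite divr_ge0 ?m_ge0// J_ge0// => x _; exact: nrm_ge0. Qed.

Lemma J_avg A g : all_atoms F A -> J A (nrm g) = avg A g * m A.
Proof. by move=> aA; rewrite divfK// gt_eqF// (atom_gt0 aA). Qed.

Lemma J_le_cst A g c : measurable A -> vessb g ->
  {ae P, forall x, A x -> nrm g x <= c} -> J A (nrm g) <= c * m A.
Proof.
by move=> mA vg h; rewrite -J_cst//; apply: le_J => //; [exact: essb_nrm|exact: essb_cst].
Qed.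

(* [\int_A |u|^2 = <g, u>], and [|u|] is almost constant on [A] by stability. *)
Lemma pr_avg A g u : all_atoms F A -> vessb g -> pr A g u ->
  avg A u <= K0 * avg A g.
Proof.
move=> aA vg [Su hu]; have mA := atom_measurable aA; have A0 := atom_gt0 aA.
have vu := ss_essb H Su; have K0p : 0 < K0 by exact: lt_le_trans K0_ge2.
have Ju : 0 <= J A (nrm u) by apply: J_ge0 => x _; exact: nrm_ge0.
have e : ip A u u = ip A g u by have := hu _ Su; rewrite ipBl//; lra.
have le1 : ip A u u <= K0 / m A * J A (nrm u) * J A (nrm g).
  rewrite e; apply: (le_trans (ler_norm _)); apply: ip_le => //.
    by rewrite mulr_ge0// divr_ge0// ltW.
  exact: stab_self.
have le2 := J_nrm_sqr mA vu.
rewrite /avg mulrA ler_pM2r ?invr_gt0//.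
have [->|Jn0] := eqVneq (J A (nrm u)) 0.
  by rewrite mulr_ge0// ?(ltW K0p)// J_ge0// => x _; exact: nrm_ge0.
have Jp : 0 < J A (nrm u) by rewrite lt_neqAle eq_sym Jn0.
rewrite -(ler_pM2r Jp) -expr2; apply: (le_trans le2).
rewrite -ler_pdivlMl//; apply: (le_trans le1); rewrite le_eqVlt.
by apply/orP; left; apply/eqP; field; rewrite gt_eqF.
Qed.

Lemma pr_bound A g u : all_atoms F A -> vessb g -> pr A g u ->
  {ae P, forall x, A x -> nrm u x <= K0 ^+ 2 * avg A g}.
Proof.
move=> aA vg hu; have [Su _] := hu; apply: filterS (stab_self aA Su) => x h Ax.
have K0p : 0 < K0 by exact: lt_le_trans K0_ge2.
apply: (le_trans (h Ax)); have -> : K0 / m A * J A (nrm u) = K0 * avg A u.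
  by rewrite /avg; ring.
have -> : K0 ^+ 2 * avg A g = K0 * (K0 * avg A g) by ring.
by rewrite ler_pM2l//; exact: pr_avg.
Qed.

End stable_spaces.

(** * Integrals of [p]-th powers *)

Section power_integrals.
Context d (T : measurableType d) (R : realType) (P : probability T R).
Variable p : R.
Hypothesis p1 : 1 < p.
Implicit Types (A B : set T) (f g u v w : T -> R[i]%C).
Local Notation m := (mass P).
Local Notation J := (integ P).
Local Notation vessb := (essb_scalar P).

Let p_gt0 : 0 < p. Proof. by rewrite (lt_trans _ p1). Qed.
Let p_ge0 : 0 <= p. Proof. exact: ltW. Qed.

Definition Lpow B f : R := J B (fun x => nrm f x `^ p).
Local Notation nu := Lpow.

Lemma essb_nrmp f : vessb f -> essb P (fun x => nrm f x `^ p).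
Proof. by move=> /essb_nrm h; apply: essb_powR => //; exact: nrm_ge0. Qed.

Lemma nu_ge0 B f : 0 <= nu B f.
Proof. by apply: J_ge0 => x _; exact: powR_ge0. Qed.

Lemma nu_le_set A B f : measurable A -> measurable B -> A `<=` B -> vessb f ->
  nu A f <= nu B f.
Proof.
by move=> mA mB AB vf; apply: le_J_set => //; [exact: essb_nrmp|move=> x; exact: powR_ge0].
Qed.

Lemma nuU A B f : measurable A -> measurable B -> A `&` B = set0 -> vessb f ->
  nu (A `|` B) f = nu A f + nu B f.
Proof. by move=> mA mB AB vf; apply: JU => //; exact: essb_nrmp. Qed.

Lemma nu_eq_ae A f g : measurable A -> vessb f -> vessb g ->
  {ae P, forall x, A x -> f x = g x} -> nu A f = nu A g.
Proof.
move=> mA vf vg h; apply: ae_eq_J => //; [exact: essb_nrmp..|].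
by apply: filterS h => x h Ax; rewrite /nrm h.
Qed.

Lemma eq_nu A f g : (forall x, A x -> f x = g x) -> nu A f = nu A g.
Proof. by move=> h; apply: eq_J => x Ax; rewrite /nrm h. Qed.

Lemma nu_le_cst A f c : measurable A -> vessb f ->
  {ae P, forall x, A x -> nrm f x <= c} -> nu A f <= c `^ p * m A.
Proof.
move=> mA vf h; rewrite -J_cst//; apply: le_J => //; [exact: essb_nrmp|exact: essb_cst|].
by apply: filterS h => x h Ax; apply: ler_powR2 => //; [exact: nrm_ge0|exact: h].
Qed.

Lemma nuD_le A f g : measurable A -> vessb f -> vessb g ->
  nu A (fun x => f x + g x) <= 2 `^ p * (nu A f + nu A g).
Proof.
move=> mA vf vg; have vD := vessbD vf vg.
rewrite /nu -JD//; [|exact: essb_nrmp..]; rewrite -JZ//; last by apply: essbD; exact: essb_nrmp.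
apply: le_J => //; [exact: essb_nrmp|by apply/essbZ/essbD; exact: essb_nrmp|].
apply: aeW => x Ax; apply: le_trans (powRD_le _ _ _); rewrite ?nrm_ge0//.
by apply: ler_powR2 => //; [exact: nrm_ge0|exact: normcD_le].
Qed.

Lemma nuN A f : nu A (fun x => - f x) = nu A f.
Proof. by apply: eq_J => x _; rewrite /nrm normcN_eq. Qed.

Lemma nuB_le A f g : measurable A -> vessb f -> vessb g ->
  nu A (fun x => f x - g x) <= 2 `^ p * (nu A f + nu A g).
Proof.
move=> mA vf vg; rewrite -(nuN A g); apply: nuD_le => //; exact: vessbN.
Qed.

Lemma nu_holder A f : measurable A -> vessb f ->
  J A (nrm f) `^ p <= m A `^ (p - 1) * nu A f.
Proof. by move=> mA vf; apply: J_holder => //; [exact: essb_nrm|exact: nrm_ge0]. Qed.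

Lemma nu_set0 f : nu set0 f = 0. Proof. exact: J_set0. Qed.

Lemma nu0 A : measurable A -> nu A (fun=> 0) = 0.
Proof.
move=> mA; rewrite -(mul0r (m A)) -J_cst//; apply: eq_J => x _.
by rewrite /nrm Normc.normc0 powR0// gt_eqF.
Qed.

End power_integrals.

(** * The cost of a single split *)

Section steps.
Context d (T : measurableType d) (R : realType) (P : probability T R).
Variables (F : binary_filtration P) (S : set (T -> R[i]%C)) (H : stable_space F S).
Variable p : R.
Hypothesis p1 : 1 < p.
Implicit Types (A B X Y Z : set T) (f g u v w : T -> R[i]%C).
Local Notation m := (mass P).
Local Notation J := (integ P).
Local Notation ip := (Re_inner P).
Local Notation vessb := (essb_scalar P).
Local Notation nu := (Lpow P p).
Local Notation avg := (mean_abs P).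
Local Notation pr := (is_projection P S).
Local Notation K0 := (stab_cst H).
Local Notation kap := (kappa H).
Local Notation Sp n := (bf_split F n.+1).
Local Notation Sm n := (bf_small F n.+1).
Local Notation La n := (bf_large F n.+1).

Let p_gt0 : 0 < p. Proof. by rewrite (lt_trans _ p1). Qed.
Let p_ge0 : 0 <= p. Proof. exact: ltW. Qed.
Let K0_gt0 : 0 < K0. Proof. exact: lt_le_trans (K0_ge2 _). Qed.

(** The change on [Z] is a reaction to the one on [Y]: for [w = uZ - u], orthogonality on [X], [Y]
    and [Z] gives that the squared norm of [w] on [Z] is minus the inner product of [uY - u] and [w]
    on [Y]. As [Y] is small, stability bounds [w] on all of [X] by its mean over [Z], so one factor
    [w] cancels. *)
Lemma small_child X Y Z g u uY uZ : all_atoms F X -> measurable Y -> measurable Z ->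
  Y `|` Z = X -> Y `&` Z = set0 -> 0 < m Z -> m Y <= kap * m X -> vessb g ->
  pr X g u -> pr Y g uY -> pr Z g uZ ->
  nu Z (fun x => uZ x - u x) <= (K0 ^+ 2) `^ p * nu Y (fun x => uY x - u x).
Proof.
move=> aX mY mZ YZ dYZ Z0 hY vg [Su hu] [SY hY'] [SZ hZ'].
have mX := atom_measurable aX; have X0 := atom_gt0 aX.
have vu := ss_essb H Su; have vY := ss_essb H SY; have vZ := ss_essb H SZ.
pose w x := uZ x - u x; pose z x := uY x - u x.
have Sw : S w by exact: (ss_sub H).
have Sz : S z by exact: (ss_sub H).
have vw := ss_essb H Sw; have vz := ss_essb H Sz.
have ZX : Z `<=` X by rewrite -YZ; exact: subsetUr.
have XZ : X `\` Z = Y.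
  rewrite -YZ setDUl setDv setU0; exact/setDidPl.
have e : ip Z w w = - ip Y z w.
  have := hu _ Sw; rewrite /ip -YZ JU//; last by apply: essb_dot => //; exact: vessbB.
  have := hZ' _ Sw; have := hY' _ Sw; rewrite -!/(ip _ _ _).
  by rewrite !ipBl//; lra.
have sw : {ae P, forall x, X x -> nrm w x <= K0 / m X * J Z (nrm w)}.
  by apply: (stabP aX mZ ZX _ Sw); rewrite XZ.
have JZ0 : 0 <= J Z (nrm w) by apply: J_ge0 => x _; exact: nrm_ge0.
have JY0 : 0 <= J Y (nrm z) by apply: J_ge0 => x _; exact: nrm_ge0.
have l1 : ip Z w w <= K0 / m X * J Z (nrm w) * J Y (nrm z).
  rewrite e; apply: (le_trans (ler_norm _)); rewrite normrN; apply: ip_le => //.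
    by rewrite mulr_ge0// divr_ge0// ltW.
  by apply: filterS sw => x h Yx; apply: h; rewrite -YZ; left.
have l2 : J Z (nrm w) <= K0 * J Y (nrm z).
  have [->|Jn0] := eqVneq (J Z (nrm w)) 0; first by rewrite mulr_ge0// ltW.
  have Jp : 0 < J Z (nrm w) by rewrite lt_neqAle eq_sym Jn0.
  rewrite -(ler_pM2r Jp) -expr2; apply: (le_trans (J_nrm_sqr mZ vw)).
  apply: (@le_trans _ _ (m X * ip Z w w)).
    by apply: ler_wpM2r; [exact: ip_ge0|exact: le_m].
  rewrite -ler_pdivlMl//; apply: (le_trans l1); rewrite le_eqVlt.
  by apply/orP; left; apply/eqP; field; rewrite gt_eqF.
apply: (@le_trans _ _ ((K0 ^+ 2 / m X * J Y (nrm z)) `^ p * m Z)).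
  apply: nu_le_cst => //; apply: filterS sw => x h Zx; apply: (le_trans (h (ZX _ Zx))).
  have -> : K0 ^+ 2 / m X * J Y (nrm z) = K0 / m X * (K0 * J Y (nrm z)) by ring.
  by rewrite ler_wpM2l// divr_ge0// ltW.
have X0' := ltW X0; have K2 : 0 <= K0 ^+ 2 by exact: sqr_ge0.
rewrite -mulrA powRM// ?mulr_ge0 ?invr_ge0// -mulrA ler_wpM2l ?powR_ge0//.
rewrite powRM ?invr_ge0//.
apply: (@le_trans _ _ ((m X)^-1 `^ p * (m X `^ (p - 1) * nu Y z) * m X)).
  apply: ler_pM; rewrite ?mulr_ge0 ?powR_ge0 ?m_ge0//; last exact: le_m.
  apply: ler_wpM2l; first exact: powR_ge0.
  apply: (le_trans (nu_holder p1 mY vz)); apply: ler_wpM2r; first exact: nu_ge0.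
  apply: ler_powR2; [by rewrite subr_ge0 ltW|exact: m_ge0|apply: le_m => //].
  by rewrite -YZ; left.
rewrite -powR_inv1// -powRrM mulN1r powRN.
rewrite [X in X <= _](_ : _ = (m X `^ p)^-1 * (m X * m X `^ (p - 1)) * nu Y z); last by ring.
by rewrite mulr_powRB1// mulVf ?mul1r// gt_eqF// powR_gt0.
Qed.

Definition ss_proj : set T -> (T -> R[i]%C) -> T -> R[i]%C :=
  locked (fun A g => xget (fun=> 0) [set u | pr A g u]).

Lemma ss_projP A g : all_atoms F A -> vessb g -> pr A g (ss_proj A g).
Proof.
by move=> aA vg; rewrite /ss_proj -lock; apply: xgetPex; exact: (pr_exists H).
Qed.

Lemma eq_pr A g1 g2 u : (forall x, A x -> g1 x = g2 x) -> pr A g1 u -> pr A g2 u.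
Proof.
move=> h [Su hu]; split=> // v Sv; rewrite -[RHS](hu v Sv).
by apply: eq_J => x Ax; rewrite h.
Qed.

(* [\|Q_{n+1} g\|_p^p] *)
Definition diff_pow : nat -> (T -> R[i]%C) -> R := locked (fun n g =>
  nu (Sm n) (fun x => ss_proj (Sm n) g x - ss_proj (Sp n) g x) +
  nu (La n) (fun x => ss_proj (La n) g x - ss_proj (Sp n) g x)).
Local Notation qn := diff_pow.

Lemma qn_ge0 n g : 0 <= qn n g.
Proof. by rewrite /qn -lock addr_ge0 ?nu_ge0. Qed.

Lemma nu_pr_unique A X g u1 u2 v1 v2 : all_atoms F A -> all_atoms F X ->
  A `<=` X -> vessb g -> pr X g u1 -> pr X g u2 -> pr A g v1 -> pr A g v2 ->
  nu A (fun x => v1 x - u1 x) = nu A (fun x => v2 x - u2 x).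
Proof.
move=> aA aX AX vg hu1 hu2 hv1 hv2.
have mA := atom_measurable aA; have mX := atom_measurable aX.
have vu1 := ss_essb H hu1.1; have vu2 := ss_essb H hu2.1.
have vv1 := ss_essb H hv1.1; have vv2 := ss_essb H hv2.1.
have eX := pr_unique H mX vg hu1 hu2; have eA := pr_unique H mA vg hv1 hv2.
apply: nu_eq_ae; [exact: p1|exact: mA|exact: vessbB|exact: vessbB|].
by apply: filterS2 eX eA => x h1 h2 Ax; rewrite h1 ?h2//; exact: AX.
Qed.

Lemma qnE n g u u' u'' : vessb g -> pr (Sp n) g u -> pr (Sm n) g u' ->
  pr (La n) g u'' ->
  qn n g = nu (Sm n) (fun x => u' x - u x) + nu (La n) (fun x => u'' x - u x).
Proof.
move=> vg hu hu' hu''; have aX := sp_atom F n; have aY := sm_atom F n; have aZ := la_atom F n.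
rewrite /qn -lock (nu_pr_unique aY aX (sm_sub (n:=n)) vg (ss_projP aX vg) hu (ss_projP aY vg) hu').
by rewrite (nu_pr_unique aZ aX (la_sub (n:=n)) vg (ss_projP aX vg) hu (ss_projP aZ vg) hu'').
Qed.

Lemma eq_qn n g1 g2 : vessb g1 -> vessb g2 -> (forall x, Sp n x -> g1 x = g2 x) ->
  qn n g1 = qn n g2.
Proof.
move=> v1 v2 h.
have [u hu] := pr_exists H (sp_atom F n) v1; have [u' hu'] := pr_exists H (sm_atom F n) v1.
have [u'' hu''] := pr_exists H (la_atom F n) v1.
rewrite (qnE v1 hu hu' hu''); apply/esym/qnE => //.
- exact: eq_pr hu.
- by apply: eq_pr hu' => x /sm_sub/h.
- by apply: eq_pr hu'' => x /la_sub/h.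
Qed.

Lemma qn_sub n g f : vessb g -> S f -> qn n (fun x => g x - f x) = qn n g.
Proof.
move=> vg Sf; have vf := ss_essb H Sf.
have aX := sp_atom F n; have aY := sm_atom F n; have aZ := la_atom F n.
have [u hu] := pr_exists H aX vg; have [u' hu'] := pr_exists H aY vg.
have [u'' hu''] := pr_exists H aZ vg.
rewrite (qnE vg hu hu' hu'') (qnE (vessbB vg vf)
  (pr_sub H (atom_measurable aX) vg hu Sf) (pr_sub H (atom_measurable aY) vg hu' Sf)
  (pr_sub H (atom_measurable aZ) vg hu'' Sf)).
have e A a b : nu A (fun x => a x - f x - (b x - f x)) = nu A (fun x => a x - b x).
  by apply: eq_nu => x _; rewrite opprB addrA subrK.
by rewrite !e.
Qed.

Lemma qn_eq0 n g : vessb g -> S g -> qn n g = 0.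
Proof.
move=> vg Sg; have hX A : all_atoms F A -> pr A g g.
  by move=> aA; apply: pr_id => //; exact: atom_measurable aA.
rewrite (qnE vg (hX _ (sp_atom F n)) (hX _ (sm_atom F n)) (hX _ (la_atom F n))).
have e A : all_atoms F A -> nu A (fun x => g x - g x) = 0.
  move=> aA; rewrite -(nu0 P p1 (atom_measurable aA)).
  by apply: eq_nu => x _; rewrite subrr.
by rewrite !e ?addr0//; [exact: la_atom|exact: sm_atom].
Qed.

(** The first summand serves splits with a child of proportion at most [kap], through [small_child];
    the second serves splits into comparable parts, where the factor [1 / kap] exchanges the measure
    of the large child for that of the small one. *)
Definition step_cst : R :=
  locked ((1 + (K0 ^+ 2) `^ p) * (K0 ^+ 2) `^ p + (3 * K0 ^+ 2) `^ p / kap).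

Lemma step_cst_ge0 : 0 <= step_cst.
Proof.
by rewrite /step_cst -lock addr_ge0// mulr_ge0 ?addr_ge0 ?powR_ge0 ?invr_ge0 ?ltW ?kap_gt0.
Qed.

(** Only the measure of the small child appears, although the projection changes on both: either the
    large child merely reacts to the small one, or the two have comparable measure. *)
Lemma qn_le n g : vessb g ->
  qn n g <= step_cst * m (Sm n) * (avg (Sm n) g + avg (Sp n) g) `^ p.
Proof.
move=> vg; have aX := sp_atom F n; have aY := sm_atom F n; have aZ := la_atom F n.
have mX := atom_measurable aX; have mY := atom_measurable aY; have mZ := atom_measurable aZ.
have [u pX] := pr_exists H aX vg; have [u' pY] := pr_exists H aY vg.
have [u'' pZ] := pr_exists H aZ vg; rewrite (qnE vg pX pY pZ).
have vX := ss_essb H pX.1; have vY := ss_essb H pY.1; have vZ := ss_essb H pZ.1.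
have bX := pr_bound H aX vg pX; have bY := pr_bound H aY vg pY; have bZ := pr_bound H aZ vg pZ.
have a0 := avg_ge0 P (Sp n) g; have b0 := avg_ge0 P (Sm n) g.
have K2 : 0 <= K0 ^+ 2 by exact: sqr_ge0.
have Y0 := sm_gt0 F n; have Z0 := la_gt0 F n; have k0 := kap_gt0 H.
set s := (avg (Sm n) g + avg (Sp n) g) `^ p.
have s0 : 0 <= s by exact: powR_ge0.
have lY : nu (Sm n) (fun x => u' x - u x) <= (K0 ^+ 2) `^ p * m (Sm n) * s.
  rewrite mulrAC -powRM ?addr_ge0//; apply: nu_le_cst => //; first exact: vessbB.
  apply: filterS2 bX bY => x h1 h2 Yx; apply: (le_trans (normcB_le _ _)).
  by rewrite mulrDr lerD ?h2// h1//; exact: sm_sub.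
have pos : 0 <= (3 * K0 ^+ 2) `^ p / kap * m (Sm n) * s.
  by rewrite !mulr_ge0 ?powR_ge0 ?invr_ge0 ?m_ge0// ltW.
rewrite /step_cst -lock; have [hY|hY] := lerP (m (Sm n)) (kap * m (Sp n)).
  have := small_child aX mY mZ (bf_cover F n) (bf_disj F n) Z0 hY vg pX pY pZ.
  move=> h; rewrite 2!mulrDl; apply: ler_wpDr => //.
  rewrite -2!mulrA mulrDl mul1r mulrA; apply: lerD => //.
  by apply: (le_trans h); rewrite ler_wpM2l// powR_ge0.
have lZ : nu (La n) (fun x => u'' x - u x) <= (3 * K0 ^+ 2) `^ p / kap * m (Sm n) * s.
  apply: (@le_trans _ _ ((3 * K0 ^+ 2 * avg (Sp n) g) `^ p * m (La n))).
    apply: nu_le_cst => //; first exact: vessbB.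
    apply: filterS2 bX bZ => x h1 h2 Zx; apply: (le_trans (normcB_le _ _)).
    (* The large child fills at least half of the split atom. With the average over the split atom
       itself this gives the factor 3 in [step_cst]. *)
    have h3 : avg (La n) g <= 2 * avg (Sp n) g.
      have h4 : J (La n) (nrm g) <= J (Sp n) (nrm g).
        apply: le_J_set => //; [exact: la_sub|exact: essb_nrm|exact: nrm_ge0].
      rewrite -(ler_pM2r Z0) -(J_avg g aZ); apply: (le_trans h4).
      rewrite (J_avg g aX); have := m_sp F n; have := sm_le_la F n; nra.
    have := h2 Zx; have := h1 (la_sub Zx).
    have : K0 ^+ 2 * avg (La n) g <= K0 ^+ 2 * (2 * avg (Sp n) g) by rewrite ler_wpM2l.
    rewrite /nrm; lra.
  have K3 : 0 <= 3 * K0 ^+ 2 by rewrite mulr_ge0.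
  rewrite (powRM _ K3 a0); set k3 := (3 * K0 ^+ 2) `^ p.
  have -> : k3 / kap * m (Sm n) * s = k3 * (s * (m (Sm n) / kap)) by ring.
  rewrite -mulrA; apply: ler_wpM2l; first exact: powR_ge0.
  apply: ler_pM; rewrite ?m_ge0 ?powR_ge0//.
    by apply: ler_powR2 => //; rewrite lerDr.
  by rewrite ler_pdivlMr//; have := m_sp F n; nra.
rewrite -mulrA mulrDl; apply: lerD; last by rewrite mulrA.
rewrite -mulrA in lY; apply: (le_trans lY); rewrite ler_wpM2r//.
  by rewrite mulr_ge0 ?powR_ge0 ?m_ge0.
by rewrite mulrDl mul1r lerDl mulr_ge0 ?powR_ge0.
Qed.

End steps.

(** * The maximal function *)

Section maximal_function.
Context d (T : measurableType d) (R : realType) (P : probability T R).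
Variable F : binary_filtration P.
Variable p : R.
Hypothesis p1 : 1 < p.
Implicit Types (A B : set T) (g : T -> R[i]%C).
Local Notation m := (mass P).
Local Notation J := (integ P).
Local Notation vessb := (essb_scalar P).
Local Notation nu := (Lpow P p).
Local Notation avg := (mean_abs P).
Local Notation cls := (atom_at F).
Local Notation Sp n := (bf_split F n.+1).
Local Notation Sm n := (bf_small F n.+1).
Local Notation La n := (bf_large F n.+1).

Let p_gt0 : 0 < p. Proof. by rewrite (lt_trans _ p1). Qed.
Let p_ge0 : 0 <= p. Proof. exact: ltW. Qed.
Let pB_gt0 : 0 < p - 1. Proof. by rewrite subr_gt0. Qed.

Fixpoint running_max g n (x : T) : R :=
  if n is k.+1 then Num.max (running_max g k x) (avg (cls k.+1 x) g) else avg (cls 0 x) g.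
Local Notation mx := running_max.

Lemma mxS g n x : mx g n.+1 x = Num.max (mx g n x) (avg (cls n.+1 x) g).
Proof. by []. Qed.

Lemma mx_cls g n x y : cls n x y -> mx g n y = mx g n x.
Proof.
elim: n => [//|n IH] xy; rewrite !mxS (cls_eq xy) IH//.
exact: cls_subS xy.
Qed.

Lemma le_mx g n k x : (k <= n)%N -> avg (cls k x) g <= mx g n x.
Proof.
elim: n => [|n IH]; first by rewrite leqn0 => /eqP ->.
rewrite leq_eqVlt mxS le_max => /predU1P[->|]; first by rewrite lexx orbT.
by rewrite ltnS => /IH ->.
Qed.

Lemma mx_ge0 g n x : 0 <= mx g n x.
Proof. by rewrite (le_trans _ (le_mx g x (leq0n n)))// avg_ge0. Qed.

Lemma essb_avg_cls g n : essb P (fun x => avg (cls n x) g).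
Proof.
elim: n => [|n IH]; first exact: (essb_cst P (avg setT g)).
have mS := atom_measurable (sm_atom F n); have mL := atom_measurable (la_atom F n).
have mX := atom_measurable (sp_atom F n).
rewrite (_ : (fun x => _) = fun x => avg (cls n x) g * \1_(~` Sp n) x +
   avg (Sm n) g * \1_(Sm n) x + avg (La n) g * \1_(La n) x).
  apply: essbD; [apply: essbD|]; apply: essbM => //; try exact: essb_cst;
    apply: essb_indic => //; exact: measurableC.
apply/funext => x; rewrite !indicE.
have [h|h] := pselect (Sp n x); last first.
  rewrite cls_other// mem_set// !memNset ?mulr0 ?addr0 ?mulr1//.
    by move/la_sub.
  by move/sm_sub.
rewrite [_ \in ~` _]memNset; last by move=> /(_ h).
have [hh|hh] := sp_cases h.
  rewrite cls_sm// mem_set// memNset; last exact: sm_la hh.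
  by rewrite !mulr0 mulr1 addr0 add0r.
rewrite cls_la// memNset; last by move=> /sm_la; apply.
by rewrite mem_set// !mulr0 mulr1 !add0r.
Qed.

Lemma essb_mx g n : essb P (mx g n).
Proof.
elim: n => [|n IH]; first exact: essb_avg_cls 0.
apply: essb_max => //; exact: essb_avg_cls n.+1.
Qed.

Definition max_pow g n : R := J setT (fun x => mx g n x `^ p).

Definition doob_cst : R := 2 `^ p / (p - 1).

Lemma J_split n f : essb P f ->
  J setT f = J (~` Sp n) f + (J (Sm n) f + J (La n) f).
Proof.
move=> hf; have mS := atom_measurable (sm_atom F n); have mL := atom_measurable (la_atom F n).
have mX := atom_measurable (sp_atom F n).
rewrite -JU ?bf_disj// bf_cover -JU ?setUCl ?setICl//; exact: measurableC.
Qed.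

Let U (x y : R) := y `^ p - p / (p - 1) * y `^ (p - 1) * x.

(** For fixed [x], the function [U x] is smallest at [x], which is Young's inequality again.
    Replacing the running maximum by its next value can therefore only decrease [U]. *)
Let U_max (x c : R) : 0 <= x -> 0 <= c -> U x (Num.max c x) <= U x c.
Proof.
move=> x0 c0; have [cx|//] := leP c x; rewrite /U.
have := young p1 c0 x0; rewrite -(ler_pM2l (_ : 0 < (p - 1)^-1)) ?invr_gt0//.
have -> : (p - 1)^-1 * (p * c `^ (p - 1) * x) = p / (p - 1) * c `^ (p - 1) * x by ring.
have -> : (p - 1)^-1 * ((p - 1) * c `^ p + x `^ p) = c `^ p + (p - 1)^-1 * x `^ p.
  by field; rewrite gt_eqF.
have -> : p / (p - 1) * x `^ (p - 1) * x = p / (p - 1) * x `^ p.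
  by rewrite -[x `^ p]mulr_powRB1//; ring.
have -> : p / (p - 1) * x `^ p = x `^ p + (p - 1)^-1 * x `^ p.
  by field; rewrite gt_eqF.
lra.
Qed.

(* Burkholder's function: [J setT (U (nrm g) (mx g n))] is nonincreasing in [n]. *)
Lemma doob g n : vessb g -> max_pow g n <= doob_cst * nu setT g.
Proof.
move=> vg; have ng := essb_nrm vg; have ngp := essb_nrmp p1 vg.
pose psi k x := U (nrm g x) (mx g k x).
have epow r k : 0 <= r -> essb P (fun x => mx g k x `^ r).
  by move=> r0; apply: essb_powR => //; [exact: mx_ge0|exact: essb_mx].
have epsi k : essb P (psi k).
  apply: essbB; first exact: epow.
  apply: essbM => //; apply: essbZ; apply: epow; exact: ltW.
(* [U] is affine in its first argument, so where the running maximum is constant only the average of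
   [|g|] matters. *)
have const B k c : all_atoms F B -> (forall x, B x -> mx g k x = c) ->
    J B (psi k) = U (avg B g) c * m B.
  move=> aB h; have mB := atom_measurable aB.
  rewrite (@eq_J _ _ _ P B _ (fun x => c `^ p - p / (p - 1) * c `^ (p - 1) * nrm g x)); last first.
    by move=> x Bx; rewrite /psi h.
  rewrite JB//; [|exact: essb_cst|exact: essbZ].
  by rewrite JZ// J_cst// (J_avg g aB) /U; ring.
have psi_le k : J setT (psi k) <= 0.
  elim: k => [|k IH].
    rewrite (const _ _ (avg setT g))//; last by exists 0%N => //; apply/atomsE; exists point.
    rewrite m_setT mulr1 /U -mulrA [X in _ / _ * X]mulrC mulr_powRB1 ?avg_ge0//.
    rewrite -{1}[avg _ _ `^ p]mul1r -mulrBl mulr_le0_ge0 ?powR_ge0// subr_le0.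
    by rewrite ler_pdivlMr// mul1r gerBl.
  apply: le_trans IH; rewrite (J_split k (epsi k.+1)) (J_split k (epsi k)).
  apply: lerD; last apply: lerD.
  - rewrite le_eqVlt; apply/orP; left; apply/eqP; apply: eq_J => x h.
    rewrite /psi mxS cls_other//; congr U; apply/max_idPl; exact: le_mx.
  - have [x0 hx0] := sm_nonempty F k.
    have c1 x : Sm k x -> mx g k x = mx g k x0.
      move=> hx; apply: mx_cls; rewrite (cls_sp (sm_sub hx0)); exact: sm_sub.
    rewrite (const _ _ _ (sm_atom F k) c1).
    rewrite (const _ _ (Num.max (mx g k x0) (avg (Sm k) g)) (sm_atom F k)).
      by rewrite ler_wpM2r ?m_ge0// U_max ?avg_ge0 ?mx_ge0.
    by move=> x hx; rewrite mxS cls_sm// c1.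
  - have [x0 hx0] := la_nonempty F k.
    have c1 x : La k x -> mx g k x = mx g k x0.
      move=> hx; apply: mx_cls; rewrite (cls_sp (la_sub hx0)); exact: la_sub.
    rewrite (const _ _ _ (la_atom F k) c1).
    rewrite (const _ _ (Num.max (mx g k x0) (avg (La k) g)) (la_atom F k)).
      by rewrite ler_wpM2r ?m_ge0// U_max ?avg_ge0 ?mx_ge0.
    by move=> x hx; rewrite mxS cls_la// c1.
(* Young's inequality with [2 * nrm g x] absorbs only half of the power of the maximal function;
   this is the source of the factor 2^p in [doob_cst]. *)
have : J setT (fun x => 2^-1 * mx g n x `^ p - doob_cst / 2 * nrm g x `^ p) <= J setT (psi n).
  apply: le_J => //; first by apply: essbB; apply: essbZ => //; exact: epow.
  apply: aeW => x _; rewrite /psi /U /doob_cst.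
  have y0 := mx_ge0 g n x; have x0 : 0 <= 2 * nrm g x by rewrite mulr_ge0// nrm_ge0.
  have := young p1 y0 x0; rewrite powRM ?nrm_ge0// -(ler_pM2l (_ : 0 < (2 * (p - 1))^-1)); last first.
    by rewrite invr_gt0 mulr_gt0.
  have -> : (2 * (p - 1))^-1 * (p * mx g n x `^ (p - 1) * (2 * nrm g x)) =
    p / (p - 1) * mx g n x `^ (p - 1) * nrm g x by field; rewrite gt_eqF.
  have -> : (2 * (p - 1))^-1 * ((p - 1) * mx g n x `^ p + 2 `^ p * nrm g x `^ p) =
    2^-1 * mx g n x `^ p + 2 `^ p / (p - 1) / 2 * nrm g x `^ p by field; rewrite gt_eqF.
  lra.
rewrite JB//; [|exact/essbZ/epow|exact/essbZ].
rewrite !JZ//; [|exact: epow]; rewrite -/(max_pow g n) -/(nu _ _).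
have := psi_le n; lra.
Qed.

(* The sets [Sm j] containing [x] are nested and at least halve at each step. *)
Lemma geometric_sum (eta delta : R) N x : 0 < eta -> 0 < delta ->
  \sum_(j < N | (x \in Sm j) && (delta <= m (Sm j))) m (Sm j) `^ (- eta) <=
  (1 - 2 `^ (- eta))^-1 * delta `^ (- eta).
Proof.
move=> e0 d0; set K := (1 - _)^-1.
have k0 : 0 < 1 - 2 `^ (- eta) :> R.
  by rewrite subr_gt0; apply: powR_lt1 => //; lra.
have decr (a b : R) : 0 < a -> a <= b -> b `^ (- eta) <= a `^ (- eta).
  move=> a0 ab; rewrite !powRN lef_pV2 ?posrE ?powR_gt0//; last exact: lt_le_trans ab.
  by apply: ler_powR2 => //; exact: ltW.
have Kpos : 0 < K by rewrite invr_gt0.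
(* The induction carries the measure of the current atom of [x]: the terms increase geometrically
   towards the smallest set, and the maximum with [delta] stops the bound there. *)
suff : \sum_(j < N | (x \in Sm j) && (delta <= m (Sm j))) m (Sm j) `^ (- eta) <=
    K * Num.max delta (m (cls N x)) `^ (- eta).
  move=> /le_trans; apply; rewrite ler_pM2l// decr// le_max lexx//.
elim: N => [|N IH]; first by rewrite big_ord0 mulr_ge0 ?powR_ge0// ltW.
rewrite big_mkcond big_ord_recr -big_mkcond /=.
have mono : Num.max delta (m (cls N.+1 x)) <= Num.max delta (m (cls N x)).
  rewrite ge_max le_max lexx/= le_max; apply/orP; right.
  by apply: le_m; [exact: cls_measurable..|exact: cls_subS].
have mpos k : 0 < Num.max delta (m (cls k x)) by rewrite lt_max d0.
case: ifPn => [/andP[/set_mem hx hd]|_]; last first.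
  by rewrite addr0 (le_trans IH)// ler_pM2l// decr.
have e1 : cls N.+1 x = Sm N by exact: cls_sm.
have e2 : cls N x = Sp N by exact/cls_sp/sm_sub.
rewrite e1 max_r//; move: IH; rewrite e2 max_r; last first.
  by rewrite (le_trans hd)// le_m//; [exact/atom_measurable/sm_atom|
    exact/atom_measurable/sp_atom|exact: sm_sub].
have S0 := sm_gt0 F N.
have h2 : m (Sp N) `^ (- eta) <= 2 `^ (- eta) * m (Sm N) `^ (- eta).
  rewrite -powRM ?m_ge0//; apply: decr; first by rewrite mulr_gt0.
  by have := m_sp F N; have := sm_le_la F N; lra.
move=> IH; apply: (@le_trans _ _ (K * (2 `^ (- eta) * m (Sm N) `^ (- eta)) + m (Sm N) `^ (- eta))).
  by rewrite lerD2r (le_trans IH)// ler_pM2l.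
rewrite le_eqVlt; apply/orP; left; apply/eqP; rewrite /K; field.
by rewrite gt_eqF.
Qed.

End maximal_function.

(** * Sums over arbitrary sets of steps *)

Section exceptional_steps.
Context d (T : measurableType d) (R : realType) (P : probability T R).
Variables (F : binary_filtration P) (S : set (T -> R[i]%C)) (H : stable_space F S).
Variables p th : R.
Hypotheses (p1 : 1 < p) (th01 : 0 < th < 1).
Local Notation m := (mass P).
Local Notation J := (integ P).
Local Notation vessb := (essb_scalar P).
Local Notation avg := (mean_abs P).
Local Notation Sp n := (bf_split F n.+1).
Local Notation Sm n := (bf_small F n.+1).
Local Notation qn := (diff_pow F S p).
Local Notation mx := (running_max F).

Let p_gt0 : 0 < p. Proof. by rewrite (lt_trans _ p1). Qed.
Let p_ge0 : 0 <= p. Proof. exact: ltW. Qed.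
Let th_gt0 : 0 < th. Proof. by case/andP: th01. Qed.
Let th_lt1 : th < 1. Proof. by case/andP: th01. Qed.

Definition exceptional_cst : R :=
  locked (step_cst H p `^ th * (1 + (1 - 2 `^ (- (1 - th)))^-1 * 2 `^ p)).

Lemma exceptional_cst_ge0 : 0 <= exceptional_cst.
Proof.
rewrite /exceptional_cst -lock mulr_ge0 ?powR_ge0// addr_ge0// mulr_ge0 ?powR_ge0//.
rewrite invr_ge0 subr_ge0 ltW//.
by apply: powR_lt1; rewrite ?subr_gt0// ltr1n.
Qed.

(* Steps of size at most [t] cost [t ^ th] each; over a given point the others
   form a geometric sum. *)
Lemma exceptional_sum g (r : pred nat) N t : vessb g -> 0 < t ->
  \sum_(j < N | r j) qn j g `^ th <=
  exceptional_cst * ((\sum_(j < N | r j) 1) * t `^ th + t `^ (th - 1) * max_pow F p g N).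
Proof.
move=> vg t0; pose M j := avg (Sm j) g + avg (Sp j) g.
pose a j := m (Sm j) * M j `^ p.
have M0 j : 0 <= M j by rewrite addr_ge0 ?avg_ge0.
have a0 j : 0 <= a j by rewrite mulr_ge0 ?m_ge0 ?powR_ge0.
pose K : R := (1 - 2 `^ (- (1 - th)))^-1; rewrite /exceptional_cst -lock -/K.
have Kpos : 0 <= K by rewrite invr_ge0 subr_ge0 ltW//; apply: powR_lt1; rewrite ?subr_gt0// ltr1n.
have [mS SM] : (forall j, measurable (Sm j)) /\ forall j, 0 < m (Sm j).
  by split=> j; [exact/atom_measurable/sm_atom|exact: sm_gt0].
have qa j : qn j g `^ th <= step_cst H p `^ th * a j `^ th.
  rewrite -powRM ?step_cst_ge0//; apply: ler_powR2; [exact: ltW|exact: qn_ge0|].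
  by rewrite mulrA; exact: qn_le.
apply: (@le_trans _ _ (step_cst H p `^ th * \sum_(j < N | r j) a j `^ th)).
  by rewrite mulr_sumr; apply: ler_sum => j _; exact: qa.
rewrite -mulrA; apply: ler_wpM2l; first exact: powR_ge0.
pose big j := t < a j.
have pt x : \sum_(j < N | big j) m (Sm j) `^ (th - 1) * M j `^ (p * th) * \1_(Sm j) x <=
    K * 2 `^ p * t `^ (th - 1) * mx g N x `^ p.
  set y := mx g N x; have y0 : 0 <= y by exact: mx_ge0.
  have My j : (j < N)%N -> Sm j x -> M j <= 2 * y.
    move=> jN hx; have := le_mx F g x jN; rewrite cls_sm//.
    have := le_mx F g x (ltnW jN); rewrite (cls_sp (sm_sub hx)) /M /y; lra.
  have [ye|yn] := eqVneq y 0.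
    rewrite big1 ?mulr_ge0 ?powR_ge0//.
    move=> j bj; rewrite indicE; case: (boolP (x \in _)) => [/set_mem hx|_]; last by rewrite mulr0.
    have := My _ (ltn_ord j) hx; rewrite ye mulr0 => Mj.
    have Mj0 : M j = 0 by apply/eqP; rewrite eq_le Mj M0.
    by move: bj; rewrite /big /a Mj0 powR0 ?gt_eqF// mulr0 ltNge (ltW t0).
  have yp : 0 < y by rewrite lt_neqAle eq_sym yn.
  (* At [x] both averages in [M j] are at most the maximal function [y], so [a j > t] forces
     [m (Sm j)] above this value. The geometric sum with exponent [1 - th] then produces exactly the
     power [p] of [y]. *)
  pose delta := t / (2 * y) `^ p.
  have ypp : 0 < (2 * y) `^ p by rewrite powR_gt0// mulr_gt0.
  have d0 : 0 < delta by rewrite divr_gt0.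
  apply: (@le_trans _ _ ((2 * y) `^ (p * th) *
     \sum_(j < N | (x \in Sm j) && (delta <= m (Sm j))) m (Sm j) `^ (- (1 - th)))).
    rewrite mulr_sumr [leLHS]big_mkcond [leRHS]big_mkcond; apply: ler_sum => j _.
    rewrite indicE opprB; case: ifPn => [bj|_]; last first.
      by case: ifP => // _; rewrite mulr_ge0 ?powR_ge0.
    case: (boolP (x \in Sm j)) => [/set_mem hx|_]; last by rewrite mulr0.
    have hM := My _ (ltn_ord j) hx.
    have hp : M j `^ p <= (2 * y) `^ p by exact: ler_powR2.
    rewrite ifT /=.
      rewrite mulr1 mulrC ler_wpM2r ?powR_ge0// ler_powR2// mulr_ge0//; exact: ltW.
    rewrite ler_pdivrMr//; apply: (le_trans (ltW bj)).
    by rewrite /a ler_wpM2l ?m_ge0.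
  apply: (@le_trans _ _ ((2 * y) `^ (p * th) * (K * delta `^ (- (1 - th))))).
    apply: ler_wpM2l; first exact: powR_ge0.
    by apply: geometric_sum; rewrite ?subr_gt0.
  have iy : 0 <= ((2 * y) `^ p)^-1 by rewrite invr_ge0 ltW.
  rewrite opprB /delta (powRM _ (ltW t0) iy) -(powR_inv1 (ltW ypp)) -!powRrM.
  rewrite [X in X <= _](_ : _ = K * t `^ (th - 1) *
     ((2 * y) `^ (p * th) * (2 * y) `^ (p * (-1 * (th - 1))))); last by ring.
  rewrite -powRD; last by apply/implyP => _; rewrite gt_eqF// mulr_gt0.
  rewrite (_ : p * th + _ = p); last by ring.
  rewrite powRM// [leRHS](_ : _ = K * t `^ (th - 1) * (2 `^ p * y `^ p))//; last by ring.
have sumbig : \sum_(j < N | big j) a j `^ th <= K * 2 `^ p * (t `^ (th - 1) * max_pow F p g N).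
  (* One factor [m (Sm j)] of each summand is written as the integral of an indicator, which turns
     the sum over steps into a sum over the steps above a given point. *)
  have -> : \sum_(j < N | big j) a j `^ th =
      J setT (fun x => \sum_(j < N | big j) m (Sm j) `^ (th - 1) * M j `^ (p * th) * \1_(Sm j) x).
    rewrite J_sum//; last by move=> j; exact/essbZ/essb_indic.
    apply: eq_bigr => j _; rewrite JZ//; last exact: essb_indic.
    have -> : J setT \1_(Sm j) = m (Sm j).
      rewrite -[RHS]mul1r -J_cst// -[in RHS](setTI (Sm j)) -J_indic.
      by apply: eq_J => x _; rewrite mul1r.
    rewrite /a powRM ?m_ge0 ?powR_ge0// -powRrM mulrAC; congr (_ * _).
    by rewrite mulrC mulr_powRB1 ?m_ge0.
  rewrite /max_pow mulrA -JZ//.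
    apply: le_J => //.
    - by apply: essb_sum => j; exact/essbZ/essb_indic.
    - by apply/essbZ/essb_powR => //; [exact: mx_ge0|exact: essb_mx].
    - by apply: aeW => x _; exact: pt.
  by apply: essb_powR => //; [exact: mx_ge0|exact: essb_mx].
rewrite mulrDl mul1r.
apply: (@le_trans _ _ ((\sum_(j < N | r j) 1) * t `^ th + \sum_(j < N | big j) a j `^ th)).
  rewrite mulr_suml [leLHS]big_mkcond [X in _ <= X + _]big_mkcond [X in _ <= _ + X]big_mkcond.
  rewrite -big_split; apply: ler_sum => j _ /=; rewrite mul1r.
  case: ifP => _; case: ifPn => bj; rewrite ?addr0 ?add0r ?powR_ge0//.
    by rewrite lerDr powR_ge0.
  by apply: ler_powR2 => //; [exact: ltW|rewrite leNgt].
have tt : 0 <= t `^ th by exact: powR_ge0.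
have mm : 0 <= t `^ (th - 1) * max_pow F p g N.
  by rewrite mulr_ge0 ?powR_ge0// J_ge0// => x _; exact: powR_ge0.
have ss : 0 <= \sum_(j < N | r j) (1 : R) by exact: sumr_ge0.
have K0' : 0 <= K * 2 `^ p.
  by rewrite mulr_ge0 ?powR_ge0.
move: sumbig; set s := \sum_(j < N | r j) 1 in ss *; set mm' := t `^ (th - 1) * _ in mm *.
set KK := K * _ in K0' *; set sb := \sum_(j < N | big j) _; set tt' := t `^ th in tt *.
have : 0 <= s * tt' by rewrite mulr_ge0.
have : 0 <= KK * (s * tt') by rewrite !mulr_ge0.
nra.
Qed.

End exceptional_steps.

(** * Chains of atoms *)

Section frames.
Context d (T : measurableType d) (R : realType) (P : probability T R).
Variables (F : binary_filtration P) (S : set (T -> R[i]%C)) (H : stable_space F S).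
Variables p th : R.
Hypotheses (p1 : 1 < p) (th01 : 0 < th < 1).
Implicit Types (A B X Y Z : set T) (f g h u v : T -> R[i]%C) (w : T).
Local Notation m := (mass P).
Local Notation J := (integ P).
Local Notation ip := (Re_inner P).
Local Notation vessb := (essb_scalar P).
Local Notation nu := (Lpow P p).
Local Notation avg := (mean_abs P).
Local Notation pr := (is_projection P S).
Local Notation K0 := (stab_cst H).
Local Notation kap := (kappa H).
Local Notation k := (ss_dim H).
Local Notation cls := (atom_at F).
Local Notation Sp n := (bf_split F n.+1).
Local Notation Sm n := (bf_small F n.+1).
Local Notation La n := (bf_large F n.+1).
Local Notation qn := (diff_pow F S p).

Let p_gt0 : 0 < p. Proof. by rewrite (lt_trans _ p1). Qed.
Let p_ge0 : 0 <= p. Proof. exact: ltW. Qed.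
Let th_gt0 : 0 < th. Proof. by case/andP: th01. Qed.
Let th_ge0 : 0 <= th. Proof. exact: ltW. Qed.
Let th_lt1 : th < 1. Proof. by case/andP: th01. Qed.
Let K0_gt0 : 0 < K0. Proof. exact: lt_le_trans (K0_ge2 _). Qed.
Let K0_ge0 : 0 <= K0. Proof. exact: ltW. Qed.

(** The right side depends on [u] only through the bound [al]. Along a chain, [u] and [Y] vary with
    the step while the frame over the top atom stays, so sums over steps reduce to sums for the
    fixed functions [e i]. *)
Lemma frame_nu X e Y u al : all_atoms F X -> frame H X e -> measurable Y ->
  Y `<=` X -> S u -> avg X u <= al ->
  nu Y u <= (k%:R * (K0 * al)) `^ p * \sum_(i < k) nu Y (e i).
Proof.
move=> aX [Se e1 efix] mY YX Su ual; have mX := atom_measurable aX.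
have X0 := atom_gt0 aX; have vu := ss_essb H Su.
have ve i := ss_essb H (Se i).
have al0 : 0 <= al by rewrite (le_trans _ ual)// avg_ge0.
have Ka0 : 0 <= K0 * al by rewrite mulr_ge0.
have hc (i : 'I_k) : `|ip X u (e i) / m X| <= K0 * al.
  rewrite normrM normfV (gtr0_norm X0) ler_pdivrMr//.
  apply: (le_trans (ip_le mX vu (ve i) K0_ge0 (e1 i))).
  rewrite -mulrA; apply: ler_wpM2l => //.
  by rewrite (J_avg u aX); apply: ler_wpM2r => //; exact: m_ge0.
have enrm i : essb P (fun x => nrm (e i) x `^ p) by exact: essb_nrmp.
rewrite -J_sum// -JZ//; last exact: essb_sum.
apply: le_J => //; first exact: essb_nrmp.
  by apply/essbZ/essb_sum.
apply: filterS (efix u Su) => x hx Yx.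
apply: (@le_trans _ _ (((K0 * al) * \sum_(i < k) nrm (e i) x) `^ p)).
  apply: ler_powR2 => //; first exact: nrm_ge0.
  rewrite {1}/nrm hx; last exact: YX.
  rewrite /ss_expand (le_trans (normc_sum_le _ _ _))// mulr_sumr; apply: ler_sum => i _.
  by rewrite normcZ ler_wpM2r// normc_ge0.
rewrite powRM//; last by apply: sumr_ge0 => i _; exact: nrm_ge0.
rewrite [_ * (K0 * al)]mulrC (powRM _ Ka0)// -mulrA ler_wpM2l ?powR_ge0//.
by apply: powR_sum_le => // i; exact: nrm_ge0.
Qed.

Local Notation Y w j := (cls j w `\` cls j.+1 w).

Lemma Ym w j : measurable (Y w j).
Proof. by apply: measurableD; exact: cls_measurable. Qed.

Lemma clsDm w a b : measurable (cls a w `\` cls b w).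
Proof. by apply: measurableD; exact: cls_measurable. Qed.

Lemma step_children w j : Sp j w ->
  (cls j.+1 w = Sm j /\ Y w j = La j) \/ (cls j.+1 w = La j /\ Y w j = Sm j).
Proof.
move=> h; rewrite (cls_sp h) -(bf_cover F j); have dd := bf_disj F j.
case: (sp_cases h) => hh; [left; rewrite cls_sm//|right; rewrite cls_la//]; split=> //.
  by rewrite setDUl setDv set0U; apply/setDidPl; rewrite setIC.
by rewrite setDUl setDv setU0; apply/setDidPl.
Qed.

(** On the removed piece the projection of [g] is [f] itself, and [small_child] bounds the change on
    the rest by the change there, whichever of the two children the removed piece is. *)
Lemma step_small w j g f u : Sp j w -> vessb g -> S f ->
  (forall x, Y w j x -> g x = f x) -> m (Y w j) <= kap * m (cls j w) ->
  pr (cls j w) g u ->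
  qn j g <= (1 + (K0 ^+ 2) `^ p) * nu (Y w j) (fun x => f x - u x).
Proof.
move=> h vg Sf gf small hu; have mY := Ym w j.
have [uZ hZ] := pr_exists H (all_atoms_cls F j.+1 w) vg.
have hY := pr_id mY vg Sf gf.
have XE := cls_sp h.
have cov : Y w j `|` cls j.+1 w = cls j w by rewrite setUC setDUK//; exact: cls_subS.
have dis : Y w j `&` cls j.+1 w = set0 by rewrite setDE -setIA setICl setI0.
have sc := small_child p1 (all_atoms_cls F j w) mY (cls_measurable F j.+1 w) cov dis
  (cls_gt0 F j.+1 w) small vg hu hY hZ.
have e : qn j g = nu (Y w j) (fun x => f x - u x) + nu (cls j.+1 w) (fun x => uZ x - u x).
  rewrite XE in hu.
  case: (step_children h) => -[e1 e2]; rewrite e2 e1; rewrite e2 in hY; rewrite e1 in hZ.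
    by rewrite (qnE H p1 vg hu hZ hY) addrC.
  by rewrite (qnE H p1 vg hu hY hZ).
by rewrite e mulrDl mul1r lerD2l.
Qed.

(** [hcond] is the chain condition raised to the power [tau], with levels as indices: a level at
    which the atom of [w] is not split removes nothing and contributes zero. By [rhok], what a group
    removes is at most the fraction [kap] of the atoms concerned. *)
Variables (rho M : R).
Hypotheses (rho01 : 0 < rho < 1) (M0 : 0 <= M) (rhok : 1 - rho <= kap * rho).
Hypothesis hcond : forall w a b f, (a <= b)%N -> S f ->
  rho * m (cls a w) <= m (cls b w) ->
  \sum_(a <= j < b) nu (Y w j) f `^ th <= M * nu (cls a w `\` cls b w) f `^ th.

Let rho0 : 0 < rho. Proof. by case/andP: rho01. Qed.
Let rho1 : rho < 1. Proof. by case/andP: rho01. Qed.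

Definition group_cst : R := locked (((1 + (K0 ^+ 2) `^ p) * 2 `^ p) `^ th * M *
  (1 + k%:R * ((k%:R * (K0 * K0 ^+ 2)) `^ p * K0 `^ p) `^ th)).

Lemma group_cst_ge0 : 0 <= group_cst.
Proof. by rewrite /group_cst -lock !mulr_ge0 ?powR_ge0// addr_ge0// mulr_ge0 ?powR_ge0. Qed.

Lemma group_small w a b j : (a <= j)%N -> (j < b)%N ->
  rho * m (cls a w) <= m (cls b w) ->
  m (cls a w `\` cls j w) <= kap * m (cls a w) /\ m (Y w j) <= kap * m (cls j w).
Proof.
move=> aj jb h.
have s1 := cls_sub (F := F) (x := w) aj; have s2 := cls_sub (F := F) (x := w) jb.
have s3 := cls_subS (F := F) (n := j) (x := w).
have mc i := cls_measurable F i w.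
rewrite !mD//.
have := le_m P (mc _) (mc _) s1; have := le_m P (mc _) (mc _) s2; have := le_m P (mc _) (mc _) s3.
have := cls_gt0 F a w; have := cls_gt0 F j w; have := kap_gt0 H.
move=> k0 j0 a0 h3 h2 h1.
have kr : kap * rho <= kap by rewrite ler_piMr ?(ltW k0)// ltW.
have rk : 1 - rho <= kap by exact: le_trans kr.
have := ler_wpM2r (ltW a0) rk; have := ler_wpM2r (ltW j0) rk.
have := ler_wpM2l (ltW rho0) h1; rewrite !mulrBl !mul1r => h4 h5 h6.
by split; lra.
Qed.

(** Each step costs at most a constant times the size of [f - u j] on the removed piece. For [f] the
    hypothesis [hcond] applies directly; the [u j] are expanded in a frame over the first atom, with
    coefficients bounded by the average of [g], and [hcond] is applied to the frame functions. *)
Lemma group_sum w a b g f : (a <= b)%N -> vessb g -> S f ->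
  (forall x, (cls a w `\` cls b w) x -> g x = f x) ->
  rho * m (cls a w) <= m (cls b w) ->
  \sum_(a <= j < b | w \in Sp j) qn j g `^ th <=
  group_cst * (nu (cls a w `\` cls b w) f + avg (cls a w) g `^ p * m (cls a w `\` cls b w)) `^ th.
Proof.
move=> ab vg Sf gf hr; set D := cls a w `\` cls b w.
have aX := all_atoms_cls F a w; have mX := atom_measurable aX; have X0 := atom_gt0 aX.
have vf := ss_essb H Sf; have mD' : measurable D by exact: clsDm.
have [e fe] := frame_exists H aX; have [Se e1 _] := fe.
set al := avg (cls a w) g; have al0 : 0 <= al by exact: avg_ge0.
pose u j := ss_proj P S (cls j w) g.
have hu j : pr (cls j w) g (u j) by apply: (ss_projP H) => //; exact: all_atoms_cls.
have Su j : S (u j) by case: (hu j).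
have vu j := ss_essb H (Su j).
have YD j : (a <= j < b)%N -> Y w j `<=` D.
  move=> /andP[aj jb] x [x1 x2]; split; first exact: (cls_sub aj).
  by move=> xb; apply: x2; exact: (cls_sub jb).
(* [u j] is a projection over the smaller atom [cls j w], but this atom fills [cls a w] up to the
   fraction [kap], so stability extends its bound to [cls a w]. *)
have avu j : (a <= j < b)%N -> avg (cls a w) (u j) <= K0 ^+ 2 * al.
  move=> /andP[aj jb]; have [sm1 _] := group_small aj jb hr.
  have aj' := all_atoms_cls F j w; have mj := atom_measurable aj'; have j0 := atom_gt0 aj'.
  have sb := cls_sub (F := F) (x := w) aj.
  have st := stabP aX mj sb sm1 (Su j).
  have := J_le_cst mX (vu j) st; rewrite (J_avg _ aX) ler_pM2r// => h.
  apply: (le_trans h).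
  have h2 : J (cls j w) (nrm (u j)) <= K0 * J (cls j w) (nrm g).
    by rewrite (J_avg (u j) aj') (J_avg g aj') mulrA ler_pM2r//; exact: pr_avg.
  have h3 : J (cls j w) (nrm g) <= al * m (cls a w).
    rewrite -(J_avg _ aX); apply: le_J_set => //; [exact: essb_nrm|exact: nrm_ge0].
  rewrite mulrAC ler_pdivrMr//.
  have -> : K0 ^+ 2 * al * m (cls a w) = K0 * (K0 * (al * m (cls a w))) by ring.
  by rewrite ler_pM2l// (le_trans h2)// ler_pM2l.
have step j : (a <= j < b)%N -> w \in Sp j -> qn j g `^ th <=
    ((1 + (K0 ^+ 2) `^ p) * 2 `^ p) `^ th * (nu (Y w j) f `^ th + nu (Y w j) (u j) `^ th).
  move=> jab /set_mem h; have /andP[aj jb] := jab; have [_ sm2] := group_small aj jb hr.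
  have l := step_small h vg Sf (fun x hx => gf x (YD j jab x hx)) sm2 (hu j).
  have Kp : 0 <= 1 + (K0 ^+ 2) `^ p by rewrite addr_ge0// powR_ge0.
  have l2 : qn j g <= (1 + (K0 ^+ 2) `^ p) * 2 `^ p * (nu (Y w j) f + nu (Y w j) (u j)).
    apply: (le_trans l); rewrite -mulrA ler_wpM2l//.
    by apply: nuB_le => //; exact: Ym.
  apply: (le_trans (ler_powR2 th_ge0 (qn_ge0 _ _ _ _ _) l2)).
  rewrite powRM ?addr_ge0 ?nu_ge0// ?mulr_ge0 ?powR_ge0//.
  rewrite ler_wpM2l ?powR_ge0//; apply: powR_subadd; rewrite ?nu_ge0//.
  by rewrite th_ge0 ltW.
set c1 := (_ * _) `^ th in step *; have c10 : 0 <= c1 by exact: powR_ge0.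
apply: (@le_trans _ _ (\sum_(a <= j < b) c1 * (nu (Y w j) f `^ th + nu (Y w j) (u j) `^ th))).
  rewrite big_mkcond big_nat_cond [leRHS]big_nat_cond; apply: ler_sum => j.
  rewrite andbT => jab; case: ifP => [h|_]; first exact: step.
  by rewrite mulr_ge0// addr_ge0 ?powR_ge0.
rewrite -mulr_sumr /group_cst -lock -!mulrA -/c1 ler_wpM2l// big_split /=.
have Df : nu D f `^ th <= (nu D f + al `^ p * m D) `^ th.
  by apply: ler_powR2; rewrite ?nu_ge0// lerDl mulr_ge0 ?powR_ge0 ?m_ge0.
have Da : (al `^ p * m D) `^ th <= (nu D f + al `^ p * m D) `^ th.
  by apply: ler_powR2; rewrite ?mulr_ge0 ?powR_ge0 ?m_ge0// lerDr nu_ge0.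
set G := (nu D f + _) `^ th in Df Da *.
have l1 : \sum_(a <= j < b) nu (Y w j) f `^ th <= M * G.
  by apply: (le_trans (hcond ab Sf hr)); rewrite ler_wpM2l.
set kk := k%:R * (K0 * K0 ^+ 2); have kk0 : 0 <= kk by rewrite !mulr_ge0.
have l2 : \sum_(a <= j < b) nu (Y w j) (u j) `^ th <=
    (kk * al) `^ p `^ th * \sum_(i < k) \sum_(a <= j < b) nu (Y w j) (e i) `^ th.
  rewrite exchange_big mulr_sumr big_nat_cond [leRHS]big_nat_cond; apply: ler_sum => j.
  rewrite andbT => jab; have := frame_nu aX fe (Ym w j) _ (Su j) (avu j jab).
  have YX : Y w j `<=` cls a w by apply: subset_trans (YD j jab) _; exact: subDsetl.
  move=> /(_ YX) /(ler_powR2 th_ge0 (nu_ge0 _ _ _ _)) h; apply: (le_trans h).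
  have ->: k%:R * (K0 * (K0 ^+ 2 * al)) = kk * al by rewrite /kk; ring.
  rewrite powRM ?powR_ge0//; last by apply: sumr_ge0 => i _; exact: nu_ge0.
  rewrite ler_wpM2l ?powR_ge0//; apply: powR_subadd_sum; rewrite ?th_gt0 ?ltW// => i.
  exact: nu_ge0.
have l3 (i : 'I_k) : \sum_(a <= j < b) nu (Y w j) (e i) `^ th <= M * (K0 `^ p * m D) `^ th.
  apply: (le_trans (hcond ab (Se i) hr)); rewrite ler_wpM2l// ler_powR2 ?nu_ge0//.
  apply: nu_le_cst => //; first exact: (ss_essb H).
  by apply: filterS (e1 i) => x h [hx _]; exact: h.
rewrite [leRHS](_ : _ = M * G + (kk `^ p * K0 `^ p) `^ th * (k%:R * (M * G))); last by ring.
apply: lerD => //; apply: (le_trans l2).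
apply: (@le_trans _ _ ((kk * al) `^ p `^ th * (k%:R * (M * (K0 `^ p * m D) `^ th)))).
  rewrite ler_wpM2l ?powR_ge0//; apply: (le_trans (ler_sum _ (fun i _ => l3 i))).
  by rewrite sumr_const card_ord mulr_natl.
have mD0 : 0 <= m D by exact: m_ge0.
have P0 (x : R) : 0 <= x `^ p by exact: powR_ge0.
rewrite (powRM _ kk0 al0) [X in X * _ <= _](powRM _ (P0 _) (P0 _)).
rewrite [X in _ * (_ * (_ * X)) <= _](powRM _ (P0 _) mD0).
rewrite [X in _ <= X * _](powRM _ (P0 _) (P0 _)).
have aux (x1 x2 x3 x4 q : R) : 0 <= x1 -> 0 <= x3 -> 0 <= q -> x2 * x4 <= G ->
    x1 * x2 * (q * (M * (x3 * x4))) <= x1 * x3 * (q * (M * G)).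
  move=> h1 h3 hq h; have -> : x1 * x2 * (q * (M * (x3 * x4))) =
    x1 * x3 * (q * (M * (x2 * x4))) by ring.
  by apply: ler_wpM2l; [exact: mulr_ge0|apply: ler_wpM2l => //; exact: ler_wpM2l].
apply: aux; [exact: powR_ge0|exact: powR_ge0|exact: ler0n|].
by rewrite -(powRM _ (P0 _) mD0).
Qed.

End frames.

(** Induction step of a geometric sum: [s1] is the earlier part, [s2] the crossing step, [s3] the
    last group, and the constant [ci] solves the fixed point equation that closes the induction. *)
Lemma geometric_step (R : realFieldType) (s1 s2 s3 w1 w2 c2 gam ci cg : R) :
  s1 <= ci * w1 -> s2 <= c2 * w2 -> s3 <= cg * w2 -> ci * (1 - gam) = cg + c2 ->
  ci * w1 <= ci * (gam * w2) -> s1 + s2 + s3 <= ci * w2.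
Proof.
move=> l1 l2 l3 e l4; have -> : ci * w2 = (ci * (1 - gam)) * w2 + ci * (gam * w2) by ring.
by rewrite e mulrDl; lra.
Qed.

Lemma le_mix (R : realFieldType) (x y z : R) : 0 <= x -> 0 <= y -> 0 <= z ->
  2 * y + z * x <= (2 + z) * (x + y).
Proof. by move=> x0 y0 z0; have := mulr_ge0 z0 y0; rewrite mulrDl !mulrDr; lra. Qed.

(** * Long chains, cut into groups *)

Section chains.
Context d (T : measurableType d) (R : realType) (P : probability T R).
Variables (F : binary_filtration P) (S : set (T -> R[i]%C)) (H : stable_space F S).
Variables p th : R.
Hypotheses (p1 : 1 < p) (th01 : 0 < th < 1).
Implicit Types (A B X Y Z : set T) (f g h u v : T -> R[i]%C) (w : T).
Local Notation m := (mass P).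
Local Notation J := (integ P).
Local Notation vessb := (essb_scalar P).
Local Notation nu := (Lpow P p).
Local Notation avg := (mean_abs P).
Local Notation K0 := (stab_cst H).
Local Notation kap := (kappa H).
Local Notation cls := (atom_at F).
Local Notation mx := (running_max F).
Local Notation Sp n := (bf_split F n.+1).
Local Notation Sm n := (bf_small F n.+1).
Local Notation qn := (diff_pow F S p).
Local Notation Y w j := (cls j w `\` cls j.+1 w).

Let p_gt0 : 0 < p. Proof. by rewrite (lt_trans _ p1). Qed.
Let p_ge0 : 0 <= p. Proof. exact: ltW. Qed.
Let pB_gt0 : 0 < p - 1. Proof. by rewrite subr_gt0. Qed.
Let th_gt0 : 0 < th. Proof. by case/andP: th01. Qed.
Let th_ge0 : 0 <= th. Proof. exact: ltW. Qed.
Let K0_gt0 : 0 < K0. Proof. exact: lt_le_trans (K0_ge2 _). Qed.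
Let K0_ge0 : 0 <= K0. Proof. exact: ltW. Qed.

Variables (rho M : R).
Hypotheses (rho01 : 0 < rho < 1) (M0 : 0 <= M) (rhok : 1 - rho <= kap * rho).
Hypothesis hcond : forall w a b f, (a <= b)%N -> S f ->
  rho * m (cls a w) <= m (cls b w) ->
  \sum_(a <= j < b) nu (Y w j) f `^ th <= M * nu (cls a w `\` cls b w) f `^ th.

Let rho0 : 0 < rho. Proof. by case/andP: rho01. Qed.
Let rho1 : rho < 1. Proof. by case/andP: rho01. Qed.
Local Notation group_cst := (group_cst H p th M).

(** Groups are formed from the lower end upwards. Minimality of [s] leaves two cases: the top of the
    chain is reached, or the step from [s'] to [s] crosses the factor [rho] and belongs to no
    group. *)
Lemma tail_start w a b : (a <= b)%N -> exists s, [/\ (a <= s)%N, (s <= b)%N,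
  rho * m (cls s w) <= m (cls b w) &
  s = a \/ exists s', [/\ s = s'.+1, (a <= s')%N & m (cls b w) < rho * m (cls s' w)]].
Proof.
move=> ab; have ex : exists s, (a <= s)%N && (rho * m (cls s w) <= m (cls b w)).
  by exists b; rewrite ab ler_piMl ?m_ge0// ltW.
have [s /andP[as_ hs] hmin] := ex_minnP ex.
have sb : (s <= b)%N by apply: hmin; rewrite ab ler_piMl ?m_ge0// ltW.
exists s; split=> //; move: as_ hmin hs sb; case: s => [|s'].
  by rewrite leqn0 => /eqP -> *; left.
rewrite leq_eqVlt => /predU1P[->|]; first by left.
rewrite ltnS => as' hmin _ _; right; exists s'; split=> //.
rewrite ltNge; apply/negP => hle.
by have := hmin s'; rewrite as' hle ltnn => /(_ isT).
Qed.

Lemma mclsD w a b : (a <= b)%N -> m (cls a w `\` cls b w) = m (cls a w) - m (cls b w).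
Proof.
by move=> ab; apply: mD; [exact: cls_measurable..|exact: cls_sub].
Qed.

Lemma le_mcls w a b : (a <= b)%N -> m (cls b w) <= m (cls a w).
Proof.
by move=> ab; apply: le_m; [exact: cls_measurable..|exact: cls_sub].
Qed.

(** Everything a chain costs is charged to its gap [cls a w] minus [cls b w], never to the atom
    below; for the chains used later these gaps are disjoint. *)
Definition gap_pow N g f w a b : R := nu (cls a w `\` cls b w) f +
  J (cls a w `\` cls b w) (fun x => mx g N x `^ p).

Let emx g N : essb P (fun x => mx g N x `^ p).
Proof. by apply: essb_powR => //; [exact: mx_ge0|exact: essb_mx]. Qed.

Lemma gap_pow_ge0 N g f w a b : 0 <= gap_pow N g f w a b.
Proof. by rewrite addr_ge0 ?nu_ge0// J_ge0// => x _; exact: powR_ge0. Qed.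

Lemma G_le N g f w a b a' b' : vessb f -> (a <= a')%N -> (b' <= b)%N ->
  gap_pow N g f w a' b' <= gap_pow N g f w a b.
Proof.
move=> vf aa bb; have sub : cls a' w `\` cls b' w `<=` cls a w `\` cls b w.
  move=> x [h1 h2]; split; first exact: cls_sub aa _ h1.
  by move=> h; apply: h2; exact: cls_sub bb _ h.
have mm i j := clsDm F w i j.
apply: lerD; first exact: nu_le_set.
by apply: le_J_set => // x; exact: powR_ge0.
Qed.

Lemma avg_le_mx N g w a b : (a <= N)%N ->
  avg (cls a w) g `^ p * m (cls a w `\` cls b w) <=
  J (cls a w `\` cls b w) (fun x => mx g N x `^ p).
Proof.
move=> aN; have mm := clsDm F w a b.
rewrite -J_cst//; apply: le_J => //; first exact: essb_cst.
apply: aeW => x [ax _]; apply: ler_powR2 => //; first exact: avg_ge0.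
by rewrite -(cls_eq ax); exact: le_mx.
Qed.

Lemma group_sum_gap N w a b g f : (a <= b)%N -> (b <= N)%N -> vessb g -> S f ->
  (forall x, (cls a w `\` cls b w) x -> g x = f x) ->
  rho * m (cls a w) <= m (cls b w) ->
  \sum_(a <= j < b | w \in Sp j) qn j g `^ th <= group_cst * gap_pow N g f w a b `^ th.
Proof.
move=> ab bN vg Sf gf hr.
apply: (le_trans (group_sum p1 th01 rho01 M0 rhok hcond ab vg Sf gf hr)).
apply: ler_wpM2l; first exact: group_cst_ge0.
apply: ler_powR2 => //; first by rewrite addr_ge0 ?nu_ge0// mulr_ge0 ?powR_ge0 ?m_ge0.
by rewrite lerD2l; apply: avg_le_mx; exact: leq_trans bN.
Qed.

Let qpow0 j g : 0 <= qn j g `^ th. Proof. exact: powR_ge0. Qed.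

Let sum_qn_sub (Q1 Q2 : pred nat) a b g : (forall j, Q1 j -> Q2 j) ->
  \sum_(a <= j < b | Q1 j) qn j g `^ th <= \sum_(a <= j < b | Q2 j) qn j g `^ th.
Proof.
move=> h; rewrite big_mkcond [leRHS]big_mkcond; apply: ler_sum => j _.
by case: ifP => [/h ->//|_]; case: ifP.
Qed.

(* Going up from the end of the chain, at most [L] steps have to be set aside
   until the measure has grown by the factor [rho ^- L]. *)
Lemma peel L N w a b g f : (a <= b)%N -> (b <= N)%N -> vessb g -> S f ->
  (forall x, (cls a w `\` cls b w) x -> g x = f x) ->
  exists c (r : seq nat), [/\ (a <= c)%N, (c <= b)%N, (size r <= L)%N,
    c = a \/ m (cls b w) <= rho ^+ L * m (cls c w) &
    \sum_(c <= j < b | (w \in Sp j) && (j \notin r)) qn j g `^ th <=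
      L%:R * group_cst * gap_pow N g f w a b `^ th].
Proof.
move=> + + vg Sf; elim: L b => [|L IH] b ab bN gf.
  exists b, [::]; split=> //; first by right; rewrite expr0 mul1r.
  by rewrite big_geq// !mul0r.
have [s [as_ sb hs hor]] := tail_start w ab.
have vf := ss_essb H Sf.
have gf' : forall x, (cls s w `\` cls b w) x -> g x = f x.
  by move=> x [sx bx]; apply: gf; split=> //; exact: cls_sub as_ _ sx.
have hgrp := group_sum_gap sb bN vg Sf gf' hs.
have hgrp' : \sum_(s <= j < b | w \in Sp j) qn j g `^ th <= group_cst * gap_pow N g f w a b `^ th.
  apply: (le_trans hgrp); apply: ler_wpM2l; first exact: group_cst_ge0.
  by apply: ler_powR2 => //; [exact: gap_pow_ge0|exact: G_le].
have Gp : 0 <= group_cst * gap_pow N g f w a b `^ th by rewrite mulr_ge0 ?powR_ge0// group_cst_ge0.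
case: hor => [sa|[s' [es as' hlt]]].
  subst s; exists a, [::]; split=> //; first by left.
  apply: (le_trans (sum_qn_sub a b g (Q2 := fun j => w \in Sp j) _)) => [j /andP[]//|].
  by apply: (le_trans hgrp'); rewrite -mulrA ler_peMl// ler1n.
have s'b : (s' <= b)%N by rewrite (leq_trans _ sb)// es.
have [||c [r [ac cs' sr hc hsum]]] := IH s' as'.
- exact: leq_trans bN.
- move=> x [ax sx]; apply: gf; split=> // bx; apply: sx; exact: cls_sub s'b _ bx.
exists c, (s' :: r); split; [exact: ac|exact: leq_trans s'b|exact: sr| |].
  case: hc => [->|hc]; [by left|right].
  rewrite exprS -mulrA; apply: (le_trans (ltW hlt)).
  by apply: ler_wpM2l hc; exact: ltW.
have cs : (c <= s)%N by rewrite es (leq_trans cs').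
rewrite (big_cat_nat cs sb) /= -natr1 !mulrDl mul1r; apply: lerD; last first.
  by apply: le_trans hgrp'; apply: sum_qn_sub => j /andP[].
(* The crossing step [s'] is the last index below [s], and it is on the list of steps set aside, so
   its term is zero. *)
rewrite es big_mkcond /= (big_nat_recr _ _ _ cs') /= in_cons eqxx andbF addr0 -big_mkcond /=.
apply: (@le_trans _ _ (L%:R * group_cst * gap_pow N g f w a s' `^ th)).
  apply: le_trans hsum; apply: sum_qn_sub => j; rewrite in_cons negb_or.
  by move=> /andP[-> /andP[]].
apply: ler_wpM2l; first by rewrite mulr_ge0// group_cst_ge0.
by apply: ler_powR2 => //; [exact: gap_pow_ge0|exact: G_le].
Qed.

(** The solution of [C * (1 - gam) = group_cst + c] for the decay factor
    [gam = rho ^ ((p - 1) * th)] and the cost [c] of a crossing step. *)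
Definition initial_cst : R :=
  locked ((group_cst + (step_cst H p * 2 `^ p) `^ th) / (1 - rho `^ ((p - 1) * th))).

Let gam_lt1 : rho `^ ((p - 1) * th) < 1.
Proof.
have e : 0 < (p - 1) * th by rewrite mulr_gt0.
by rewrite -[rho]invrK -powR_inv1 ?invr_ge0 ?(ltW rho0)// -powRrM mulN1r powR_lt1// invf_gt1.
Qed.

Lemma initial_cst_ge0 : 0 <= initial_cst.
Proof.
rewrite /initial_cst -lock; apply: divr_ge0; last by rewrite subr_ge0 ltW.
by apply: addr_ge0; [exact: group_cst_ge0|exact: powR_ge0].
Qed.

(* [|X|^{1-p} HH^p] bounds [\|P_X h\|_p^p] when [h] lives on a subset of [X] and
   [HH] is its [L^1]-norm. *)
Let W w n (HH : R) : R := m (cls n w) `^ (1 - p) * HH `^ p.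

Let W_ge0 w n HH : 0 <= W w n HH. Proof. by rewrite mulr_ge0 ?powR_ge0. Qed.

Let powR_1p (x : R) : 0 < x -> x `^ (1 - p) * x `^ p = x.
Proof.
move=> x0; rewrite -powRD ?subrK ?powRr1 ?(ltW x0)//.
by apply/implyP; rewrite gt_eqF.
Qed.

Let powR_decr (x y : R) : 0 < x -> x <= y -> y `^ (1 - p) <= x `^ (1 - p).
Proof.
move=> x0 xy; have -> : 1 - p = - (p - 1) by ring.
rewrite !powRN lef_pV2 ?posrE ?powR_gt0//; last exact: lt_le_trans xy.
by apply: ler_powR2 => //; exact: ltW.
Qed.

Let W_avg w n h : W w n (J (cls n w) (nrm h)) = avg (cls n w) h `^ p * m (cls n w).
Proof.
have aX := all_atoms_cls F n w; have X0 := atom_gt0 aX.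
rewrite /W (J_avg h aX) (powRM _ (avg_ge0 _ _ _) (ltW X0)) mulrCA.
by rewrite powR_1p.
Qed.

(** The function [h] lives on [cls b w], so its average over an earlier atom is inversely
    proportional to the measure of that atom. Each drop of the measure by [rho] enlarges [W] at
    least by [rho ^ (1 - p)]; the groups and crossing steps are thus dominated by the last ones. *)
Lemma initial_sum w a b h n : (a <= n)%N -> (n <= b)%N -> vessb h ->
  (forall x, (cls a w `\` cls b w) x -> h x = 0) ->
  \sum_(a <= j < n | w \in Sp j) qn j h `^ th <=
  initial_cst * W w n (J (cls b w) (nrm h)) `^ th.
Proof.
move=> + + vh h0; set HH := J (cls b w) (nrm h).
have JE j : (a <= j <= b)%N -> J (cls j w) (nrm h) = HH.
  move=> /andP[aj jb]; have sb := cls_sub (F := F) (x := w) jb.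
  have mj := cls_measurable F j w; have mb := cls_measurable F b w.
  have := JDset mj mb sb (essb_nrm vh).
  rewrite (_ : J (_ `\` _) _ = 0); first by rewrite /HH; lra.
  rewrite -(mul0r (m (cls j w `\` cls b w))) -J_cst; last exact: clsDm.
  apply: eq_J => x [jx bx]; rewrite /nrm h0 ?Normc.normc0//; split=> //.
  exact: cls_sub aj _ jx.
have H0 : 0 <= HH by apply: J_ge0 => x _; exact: nrm_ge0.
have Wle i j : (i <= j)%N -> W w i HH `^ th <= W w j HH `^ th.
  move=> ij; apply: ler_powR2 => //; apply: ler_wpM2r; first exact: powR_ge0.
  by apply: powR_decr; [exact: cls_gt0|exact: le_mcls].
elim/ltn_ind: n => n IH an nb.
have [s [as_ sn hs hor]] := tail_start w an.
have S0 := ss_zero H.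
have hgrp : \sum_(s <= j < n | w \in Sp j) qn j h `^ th <= group_cst * W w n HH `^ th.
  have h0' x : (cls s w `\` cls n w) x -> h x = 0.
    move=> [sx nx]; apply: h0; split; first exact: cls_sub as_ _ sx.
    by move=> bx; apply: nx; exact: cls_sub nb _ bx.
  apply: (le_trans (group_sum p1 th01 rho01 M0 rhok hcond sn vh S0 h0' hs)).
  apply: ler_wpM2l; first exact: group_cst_ge0.
  apply: le_trans (Wle _ _ sn); apply: ler_powR2 => //.
    by rewrite addr_ge0 ?nu_ge0// mulr_ge0 ?powR_ge0 ?m_ge0.
  rewrite nu0//; last exact: clsDm.
  rewrite add0r -(JE s) ?as_ ?(leq_trans sn)// W_avg ler_wpM2l ?powR_ge0//.
  by rewrite mclsD// gerBl m_ge0.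
have CiE : initial_cst * (1 - rho `^ ((p - 1) * th)) = group_cst + (step_cst H p * 2 `^ p) `^ th.
  by rewrite /initial_cst -lock divfK// gt_eqF// subr_gt0.
have Wn : 0 <= W w n HH `^ th by exact: powR_ge0.
have CC : group_cst <= initial_cst.
  apply: (@le_trans _ _ (initial_cst * (1 - rho `^ ((p - 1) * th)))).
    by rewrite CiE lerDl powR_ge0.
  by rewrite ler_piMr ?initial_cst_ge0// gerBl powR_ge0.
case: hor => [sa|[s' [es as' hlt]]].
  by rewrite -sa; apply: (le_trans hgrp); rewrite ler_wpM2r.
have s'n : (s' < n)%N by rewrite -es.
have IHs := IH s' s'n as' (ltnW (leq_trans s'n nb)).
have step : (if w \in Sp s' then qn s' h `^ th else 0) <=
    (step_cst H p * 2 `^ p) `^ th * W w n HH `^ th.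
  case: ifP => [/set_mem hw|_]; last by rewrite mulr_ge0 ?powR_ge0.
  apply: (@le_trans _ _ ((step_cst H p * 2 `^ p) `^ th * W w s HH `^ th)); last first.
    by apply: ler_wpM2l; [exact: powR_ge0|exact: Wle].
  have C10 : 0 <= step_cst H p * 2 `^ p by rewrite mulr_ge0 ?powR_ge0// step_cst_ge0.
  rewrite -(powRM _ C10 (W_ge0 _ _ _)).
  apply: ler_powR2 => //; first exact: qn_ge0.
  apply: (le_trans (qn_le H p1 s' vh)); rewrite -!mulrA.
  apply: ler_wpM2l; first exact: step_cst_ge0.
  have aSm := sm_atom F s'; have aSp := sp_atom F s'; have aX := all_atoms_cls F s w.
  have JS : J (Sp s') (nrm h) = HH.
    by rewrite -(cls_sp hw) JE// as' ltnW// (leq_trans s'n nb).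
  have JX : J (cls s w) (nrm h) = HH by rewrite JE// as_ (leq_trans sn nb).
  have X0 := atom_gt0 aX.
  have mX : m (cls s w) <= m (Sp s') by rewrite -(cls_sp hw) es le_mcls.
  have avS : avg (Sp s') h <= HH / m (cls s w).
    by rewrite /avg JS ler_wpM2l// lef_pV2// posrE// (lt_le_trans X0).
  (* If the chain continues through the large child, [h] vanishes almost everywhere on the small
     one, since all of its mass lies in [cls b w]. *)
  have [mS avSm] : m (Sm s') <= m (cls s w) /\ avg (Sm s') h <= HH / m (cls s w).
    case: (step_children hw) => -[e1 e2].
      by rewrite es e1; split=> //; rewrite /avg -e1 -es JX.
    rewrite es e1; split; first exact: sm_le_la.
    have JSm : J (Sm s') (nrm h) = 0.
      rewrite -e2 JDset//; [|exact: cls_measurable..|exact: cls_subS|exact: essb_nrm].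
      by rewrite (cls_sp hw) JS -es JX subrr.
    rewrite /avg JSm mul0r -e1 -es; apply: divr_ge0 => //; exact: ltW.
  have avs0 : 0 <= avg (Sm s') h + avg (Sp s') h by rewrite addr_ge0 ?avg_ge0.
  apply: (@le_trans _ _ (m (cls s w) * (2 * (HH / m (cls s w))) `^ p)).
    apply: ler_pM; rewrite ?m_ge0 ?powR_ge0//.
    by apply: ler_powR2 => //; rewrite mulr_natl mulr2n; exact: lerD.
  have q0 : 0 <= HH / m (cls s w) by rewrite divr_ge0// ltW.
  rewrite (powRM _ _ q0)// mulrCA ler_wpM2l ?powR_ge0// mulrC.
  by rewrite -JX W_avg.
have lastW : W w s' HH `^ th <= rho `^ ((p - 1) * th) * W w n HH `^ th.
  rewrite powRrM -(powRM _ (powR_ge0 _ _) (W_ge0 _ _ _)).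
  apply: ler_powR2 => //; rewrite /W mulrA; apply: ler_wpM2r; first exact: powR_ge0.
  have n0 := cls_gt0 F n w; have s0 := cls_gt0 F s' w.
  have -> : rho `^ (p - 1) = rho^-1 `^ (1 - p).
    by rewrite -powR_inv1 ?(ltW rho0)// -powRrM; congr (_ `^ _); ring.
  have ir : 0 <= rho^-1 by rewrite invr_ge0 ltW.
  rewrite -(powRM _ ir (ltW n0)); apply: powR_decr; first by rewrite mulr_gt0 ?invr_gt0.
  by rewrite mulrC ler_pdivrMr// mulrC ltW.
rewrite es in hgrp sn; rewrite (big_cat_nat (leq_trans as' (leqnSn s')) sn) /=.
rewrite [X in X + _]big_mkcond (big_nat_recr _ _ _ as') /= -big_mkcond /=.
by apply: (geometric_step IHs step hgrp CiE); apply: ler_wpM2l; [exact: initial_cst_ge0|].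
Qed.

(** After [L] drops of the measure by [rho], the end of the chain is at most the fraction [kap] of
    the atom above. From there upwards the gap alone determines elements of [S] on the whole
    atom. *)
Variable L : nat.
Hypothesis hL : rho ^+ L <= kap.

Definition chain_cst : R := locked (L%:R * group_cst + initial_cst * (2 `^ p * (2 + K0 `^ p)) `^ th).

Lemma chain_cst_ge0 : 0 <= chain_cst.
Proof.
by rewrite /chain_cst -lock addr_ge0// mulr_ge0 ?powR_ge0 ?initial_cst_ge0 ?group_cst_ge0.
Qed.

(** [peel] handles the levels from [c] on. Before [c], the difference [g - f] vanishes on the gap
    and [initial_sum] applies; its mass on [cls b w] is bounded by the average of [g] over [cls c w]
    and by [f] on the gap. *)
Lemma chain_sum N w a b g f : (a <= b)%N -> (b <= N)%N -> vessb g -> S f ->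
  (forall x, (cls a w `\` cls b w) x -> g x = f x) ->
  exists r : seq nat, (size r <= L)%N /\
    \sum_(a <= j < b | (w \in Sp j) && (j \notin r)) qn j g `^ th <=
      chain_cst * gap_pow N g f w a b `^ th.
Proof.
move=> ab bN vg Sf gf; have vf := ss_essb H Sf.
have [c [r [ac cb sr hc hsum]]] := peel L ab bN vg Sf gf.
exists r; split=> //; rewrite (big_cat_nat ac cb) /= /chain_cst -lock mulrDl addrC.
apply: lerD => //; case: hc => [ca|hc].
  rewrite ca big_geq// mulr_ge0 ?powR_ge0// mulr_ge0 ?powR_ge0 ?initial_cst_ge0//.
apply: (@le_trans _ _ (\sum_(a <= j < c | w \in Sp j) qn j g `^ th)).
  by apply: sum_qn_sub => j /andP[].
(* Subtracting an element of [S] changes no step, and on the atoms of the chain [g - f] coincides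
   with [h]. *)
pose gf' x := g x - f x; pose h := restr gf' (cls b w).
have vgf : vessb gf' by exact: vessbB.
have vh : vessb h by apply: vessb_restr => //; exact: cls_measurable.
have qh j : (a <= j < c)%N -> w \in Sp j -> qn j g = qn j h.
  move=> /andP[aj jc] /set_mem hw; rewrite -(qn_sub H p1 j vg Sf).
  apply: (eq_qn H p1 vgf vh) => x; rewrite -(cls_sp hw) => xj.
  have [xb|xb] := pselect (cls b w x); first by rewrite /h restr_in.
  rewrite /h restr_out// /gf' gf ?subrr//; split=> //; exact: cls_sub aj _ xj.
have -> : \sum_(a <= j < c | w \in Sp j) qn j g `^ th = \sum_(a <= j < c | w \in Sp j) qn j h `^ th.
  rewrite [LHS]big_mkcond [RHS]big_mkcond; apply: eq_big_nat => j jac.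
  by case: ifP => // hj; rewrite (qh _ jac hj).
have h0 x : (cls a w `\` cls b w) x -> h x = 0 by move=> [_ ?]; rewrite /h restr_out.
apply: (le_trans (initial_sum ac cb vh h0)); rewrite -mulrA.
apply: ler_wpM2l; first exact: initial_cst_ge0.
have G0 := gap_pow_ge0 N g f w a b.
have cc0 : 0 <= 2 `^ p * (2 + K0 `^ p) by rewrite mulr_ge0 ?addr_ge0 ?powR_ge0.
rewrite -(powRM _ cc0 G0); apply: ler_powR2 => //.
set HH := J _ _.
have mcb := cls_sub (F := F) (x := w) cb.
have mc := cls_measurable F c w; have mb := cls_measurable F b w.
have aX := all_atoms_cls F c w; have X0 := atom_gt0 aX.
set D := cls c w `\` cls b w.
have mD : measurable D by exact: clsDm.
have small : m (cls b w) <= kap * m (cls c w).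
  by apply: (le_trans hc); apply: ler_wpM2r; [exact: m_ge0|exact: hL].
(* Since [kap <= 1 / 2], at least half of [cls c w] is gap, so the average of [g] over [cls c w] can
   be charged to the maximal function on the gap. *)
have half : m (cls c w) <= 2 * m D.
  rewrite /D mclsD//; have := kap_le H; have := ler_wpM2r (ltW X0) (kap_le H); lra.
have DG : nu D f + J D (fun x => mx g N x `^ p) <= gap_pow N g f w a b.
  exact: (@G_le N g f w a b c b).
set gg := avg (cls c w) g * m (cls c w); set ff := K0 * J D (nrm f).
have HHle : HH <= gg + ff.
  have l1 : HH <= J (cls b w) (nrm g) + J (cls b w) (nrm f).
    rewrite /HH -JD//; [|exact: essb_nrm..].
    apply: le_J => //; [exact: essb_nrm|by apply: essbD; exact: essb_nrm|].
    by apply: aeW => x bx; rewrite /nrm /h restr_in// normcB_le.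
  apply: (le_trans l1); apply: lerD.
    rewrite /gg -(J_avg g aX); apply: le_J_set => //; [exact: essb_nrm|exact: nrm_ge0].
  apply: (@le_trans _ _ (J (cls c w) (nrm f))).
    by apply: le_J_set => //; [exact: essb_nrm|exact: nrm_ge0].
  have XD : cls c w `\` D = cls b w.
    by rewrite /D setDD; apply/setIidPr.
  have DX : D `<=` cls c w by exact: subDsetl.
  (* What the gap misses of [cls c w] is [cls b w], a fraction of at most [kap]; stability carries
     [f] from the gap to [cls b w]. *)
  have st : {ae P, forall x, cls c w x -> nrm f x <= K0 / m (cls c w) * J D (nrm f)}.
    by apply: (stabP aX mD DX _ Sf); rewrite XD.
  apply: (le_trans (J_le_cst mc vf st)); rewrite /ff mulrAC divfK// gt_eqF//.
have gg0 : 0 <= gg by rewrite mulr_ge0 ?avg_ge0// ltW.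
have ff0 : 0 <= ff by rewrite mulr_ge0// J_ge0// => x _; exact: nrm_ge0.
have HH0 : 0 <= HH by apply: J_ge0 => x _; exact: nrm_ge0.
have P0 : 0 <= m (cls c w) `^ (1 - p) by exact: powR_ge0.
have K0p : 0 <= K0 `^ p by exact: powR_ge0.
have gpart : m (cls c w) `^ (1 - p) * gg `^ p <= 2 * J D (fun x => mx g N x `^ p).
  rewrite /gg (powRM _ (avg_ge0 _ _ _) (ltW X0)) mulrCA (powR_1p X0).
  apply: (@le_trans _ _ (2 * (avg (cls c w) g `^ p * m D))).
    rewrite [leRHS]mulrCA; apply: ler_wpM2l => //; exact: powR_ge0.
  by apply: ler_wpM2l => //; apply: avg_le_mx; exact: leq_trans bN.
have fpart : m (cls c w) `^ (1 - p) * ff `^ p <= K0 `^ p * nu D f.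
  have J0 : 0 <= J D (nrm f) by apply: J_ge0 => x _; exact: nrm_ge0.
  rewrite /ff (powRM _ K0_ge0 J0) mulrCA; apply: ler_wpM2l => //.
  apply: (@le_trans _ _ (m (cls c w) `^ (1 - p) * (m (cls c w) `^ (p - 1) * nu D f))).
    apply: ler_wpM2l; first exact: P0.
    apply: (le_trans (nu_holder p1 mD vf)); apply: ler_wpM2r; first exact: nu_ge0.
    apply: ler_powR2; [exact: ltW|exact: m_ge0|apply: le_m => //; exact: subDsetl].
  have -> : 1 - p = - (p - 1) by ring.
  by rewrite powRN mulKf// gt_eqF// powR_gt0.
apply: (@le_trans _ _ (m (cls c w) `^ (1 - p) * (2 `^ p * (gg `^ p + ff `^ p)))).
  apply: ler_wpM2l => //; apply: le_trans (powRD_le p_gt0 gg0 ff0).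
  exact: ler_powR2.
rewrite mulrCA -mulrA; apply: ler_wpM2l; first exact: powR_ge0.
rewrite mulrDr; apply: (le_trans (lerD gpart fpart)).
have nD0 : 0 <= nu D f by exact: nu_ge0.
have jD0 : 0 <= J D (fun x => mx g N x `^ p) by apply: J_ge0 => x _; exact: powR_ge0.
apply: (@le_trans _ _ ((2 + K0 `^ p) * (nu D f + J D (fun x => mx g N x `^ p)))).
  exact: le_mix.
by apply: ler_wpM2l; [apply: addr_ge0; [|exact: K0p]|exact: DG].
Qed.

End chains.

(** * Sums of pieces and branching *)

Section trees.
Context d (T : measurableType d) (R : realType) (P : probability T R).
Variable F : binary_filtration P.
Implicit Types (A B W X Y Z : set T) (s : seq (set T)) (w x : T).
Local Notation cls := (atom_at F).
Local Notation Sp n := (bf_split F n.+1).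
Local Notation Sm n := (bf_small F n.+1).
Local Notation La n := (bf_large F n.+1).

Definition branching s k := (exists2 B, B \in s & B `<=` Sm k) /\
                            (exists2 B, B \in s & B `<=` La k).

Let new A s k := [/\ A `<=` Sm k, exists2 B, B \in s & B `<=` La k &
                      ~ exists2 B, B \in s & B `<=` Sm k] \/
                  [/\ A `<=` La k, exists2 B, B \in s & B `<=` Sm k &
                      ~ exists2 B, B \in s & B `<=` La k].

Let branching_cons A s k : all_atoms F A -> branching (A :: s) k ->
  ~ branching s k -> new A s k.
Proof.
move=> aA [[B1 B1s B1k] [B2 B2s B2k]] nk; have [x Ax] := atom_nonempty aA.
move: B1s B2s; rewrite !in_cons => /predU1P[e1|B1s] /predU1P[e2|B2s].
- exfalso; apply: (@sm_la _ _ _ _ F k x); [apply: B1k|apply: B2k]; by rewrite ?e1 ?e2.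
- left; split; [by rewrite -e1|by exists B2|move=> h; apply: nk; split=> //; by exists B2].
- right; split; [by rewrite -e2|by exists B1|move=> h; apply: nk; split=> //; by exists B1].
- by exfalso; apply: nk; split; [exists B1|exists B2].
Qed.

Let new_lt A s k l : all_atoms F A -> (k < l)%N -> new A s k -> new A s l -> False.
Proof.
move=> aA kl nk nl; have [x Ax] := atom_nonempty aA.
have [xl [B Bs Bl]] : Sp l x /\ exists2 B, B \in s & B `<=` Sp l.
  by case: nl => -[Al [B Bs Bl] _]; split; first [apply: sm_sub; exact: Al|apply: la_sub; exact: Al|
    exists B => //; apply: subset_trans Bl _; first [exact: la_sub|exact: sm_sub]].
case: nk => -[Ak _]; apply; exists B => //; apply: (subset_trans Bl).
  by case: (sp_gt_level kl xl (sm_sub (Ak _ Ax))) => -[// h _]; case: (sm_la (Ak _ Ax) h).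
by case: (sp_gt_level kl xl (la_sub (Ak _ Ax))) => -[// h _]; case: (sm_la h (Ak _ Ax)).
Qed.

(* All branching nodes created by adding [A] contain [A], and the lower one of
   two such nodes would create an old member next to [A] below the upper one. *)
Lemma branching_count s : (forall B, B \in s -> all_atoms F B) ->
  exists r : seq nat, (size r <= size s)%N /\ forall k, branching s k -> k \in r.
Proof.
elim: s => [|A s IH] aS; first by exists [::]; split=> // k [[B]].
have [|r [sr hr]] := IH; first by move=> B Bs; apply: aS; rewrite in_cons Bs orbT.
have aA : all_atoms F A by apply: aS; rewrite in_cons eqxx.
have [[k0 [h0 n0]]|no] := pselect (exists k, branching (A :: s) k /\ ~ branching s k).
  exists (k0 :: r); split=> // k hk; have [/hr|nk] := pselect (branching s k).
    by rewrite in_cons => ->; rewrite orbT.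
  have e0 := branching_cons aA h0 n0; have e := branching_cons aA hk nk.
  rewrite in_cons; apply/orP; left; apply/eqP.
  by case: (ltngtP k k0) => // l; [case: (new_lt aA l e e0)|case: (new_lt aA l e0 e)].
exists r; split=> [|k hk]; first exact: leqW.
by apply: hr; apply: contrapT => nk; apply: no; exists k.
Qed.

(** The possible lower ends of chains: the atoms in the list [s] and the atoms at which the tree
    spanned by them branches. *)
Definition pivot s W := W \in s \/ exists2 k, W = Sp k & branching s k.
Local Notation node := pivot.

(** A member of [s] that meets the gap contains all of [X]; hence a sum of pieces over [s] agrees on
    the gap with one element of [S]. *)
Definition good s W X := forall B, B \in s -> (exists2 x, B x & (X `\` W) x) -> X `<=` B.

(** A member of [s] properly inside [X1] cannot meet the gap and so lies in [W1]. Below a branching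
    atom there are members under both children; both lie in [W1], and an atom that meets both
    children contains the branching atom. *)
Lemma node_in_good s W1 W2 X1 : (forall B, B \in s -> all_atoms F B) ->
  all_atoms F W1 -> W1 `<=` X1 -> good s W1 X1 -> node s W2 -> W2 `<=` X1 ->
  W2 <> X1 -> W2 `<=` W1.
Proof.
move=> aS aW1 WX1 g1 nW2 WX2 ne.
have H B : B \in s -> B `<=` X1 -> B <> X1 -> B `<=` W1.
  move=> Bs BX nBX x Bx; apply: contrapT => nx; apply: nBX.
  apply/seteqP; split=> //; apply: g1 => //; exists x => //; split=> //; exact: BX.
case: nW2 => [W2s|[k eW [[B1 B1s B1k] [B2 B2s B2k]]]]; first exact: H.
subst W2.
have B1W : B1 `<=` W1.
  apply: H => //; first by apply: subset_trans WX2; apply: subset_trans B1k (@sm_sub _ _ _ _ F k).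
  by move=> e; apply: (@sm_neq _ _ _ _ F k); apply/seteqP; split; [exact: sm_sub|];
    rewrite e in B1k; exact: subset_trans WX2 B1k.
have B2W : B2 `<=` W1.
  apply: H => //; first by apply: subset_trans WX2; apply: subset_trans B2k (@la_sub _ _ _ _ F k).
  by move=> e; apply: (@la_neq _ _ _ _ F k); apply/seteqP; split; [exact: la_sub|];
    rewrite e in B2k; exact: subset_trans WX2 B2k.
have [x1 hx1] := atom_nonempty (aS _ B1s); have [x2 hx2] := atom_nonempty (aS _ B2s).
case: (laminar aW1 (sp_atom F k) (B1W _ hx1) (sm_sub (B1k _ hx1))) => // WS.
have [->//|nWS] := pselect (W1 = Sp k); exfalso.
case: (atom_in_child aW1 WS nWS) => h.
  exact: sm_la (h _ (B2W _ hx2)) (B2k _ hx2).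
exact: sm_la (B1k _ hx1) (h _ (B1W _ hx1)).
Qed.

Lemma node_atom s W : (forall B, B \in s -> all_atoms F B) -> node s W -> all_atoms F W.
Proof. by move=> aS [/aS//|[k -> _]]; exact: sp_atom. Qed.

(** If the gaps share a point, [node_in_good] applies in both directions and gives mutual inclusion
    of [W1] and [W2]: each pivot is a proper part of the other top atom, since the common point is
    in both tops and in neither pivot. *)
Lemma good_disjoint s W1 W2 X1 X2 x : (forall B, B \in s -> all_atoms F B) ->
  node s W1 -> node s W2 -> all_atoms F X1 -> all_atoms F X2 ->
  W1 `<=` X1 -> W2 `<=` X2 -> good s W1 X1 -> good s W2 X2 ->
  (X1 `\` W1) x -> (X2 `\` W2) x -> W1 = W2.
Proof.
move=> aS; wlog : W1 W2 X1 X2 / X1 `<=` X2.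
  move=> H n1 n2 a1 a2 w1 w2 g1 g2 h1 h2; case: (laminar a1 a2 h1.1 h2.1) => h.
    exact: (H W1 W2 X1 X2).
  by apply/esym; exact: (H W2 W1 X2 X1).
move=> X12 n1 n2 a1 a2 w1 w2 g1 g2 [x1 nx1] [x2 nx2].
have aW1 := node_atom aS n1; have aW2 := node_atom aS n2.
have W1X2 : W1 <> X2 by move=> e; apply: nx1; rewrite e.
have W12 := node_in_good aS aW2 w2 g2 n1 (subset_trans w1 X12) W1X2.
have [y Wy] := atom_nonempty aW1.
case: (laminar a1 aW2 (w1 _ Wy) (W12 _ Wy)) => h; first by case: nx2; exact: h.
apply/seteqP; split=> //; apply: (node_in_good aS aW1 w1 g1 n2 h) => e.
by apply: nx2; rewrite e.
Qed.

(** Without branching, all members of [s] properly inside the split atom lie under one child. Follow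
    a point of [B0] downwards to the last atom that still contains them all: there, a member is met
    or the tree branches. *)
Lemma hull s j B0 : (forall B, B \in s -> all_atoms F B) -> B0 \in s ->
  B0 `<=` Sp j -> B0 <> Sp j -> ~ branching s j ->
  exists W, [/\ node s W, W `<=` Sp j, W <> Sp j & good s W (Sp j)].
Proof.
move=> aS B0s B0j nB0 nb.
have [w B0w] := atom_nonempty (aS _ B0s); have [n0 eB0] := atom_level (aS _ B0s) B0w.
have wj := B0j _ B0w.
have inchild B : B \in s -> B `<=` Sp j -> B <> Sp j -> B `<=` cls j.+1 w.
  move=> Bs Bj nB; case: (atom_in_child (aS _ Bs) Bj nB) => hB;
  case: (atom_in_child (aS _ B0s) B0j nB0) => hB0.
  - by rewrite cls_sm//; exact: hB0.
  - by exfalso; apply: nb; split; [exists B|exists B0].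
  - by exfalso; apply: nb; split; [exists B0|exists B].
  - by rewrite cls_la//; exact: hB0.
pose Q n := forall B, B \in s -> B `<=` Sp j -> B <> Sp j -> B `<=` cls n w.
(* The search ends at the latest at the level of [B0]: an atom of that level around [w] that
   contains all the members, [B0] included, is [B0]. *)
pose n1 := maxn n0 j.+1.
have ex : exists n, `[< Q n >] && (j < n <= n1)%N.
  by exists j.+1; rewrite ltnSn leq_maxr/= andbT; apply/asboolP.
have bd n : `[< Q n >] && (j < n <= n1)%N -> (n <= n1)%N by move=> /and3P[].
have [n /and3P[/asboolP Qn jn nn1] nmax] := ex_maxnP ex bd.
have cj : cls n w `<=` cls j.+1 w by exact: cls_sub.
have cSp : cls j.+1 w `<=` Sp j by rewrite -(cls_sp wj); exact: cls_subS.
have properS : cls j.+1 w <> Sp j.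
  by case: (sp_cases wj) => h; [rewrite cls_sm//; exact: sm_neq|rewrite cls_la//; exact: la_neq].
exists (cls n w); split.
- have [e|lt] := eqVneq n n1.
    left; suff -> : cls n w = B0 by [].
    by apply/seteqP; split; [rewrite eB0; apply: cls_sub; rewrite e leq_maxl|exact: Qn].
  have {}lt : (n < n1)%N by rewrite ltn_neqAle lt.
  have nQ : ~ Q n.+1.
    move=> Qn1; have := nmax n.+1; rewrite ltnn => /(_ _)/notF; apply.
    by rewrite lt ltnS (ltnW jn) !andbT; exact/asboolP.
  have /existsNP[B nB] := nQ; move: nB => /not_implyP[Bs /not_implyP[Bj /not_implyP[nBj nBn]]].
  have wn : Sp n w.
    by apply: contrapT => h; apply: nBn; rewrite cls_other//; exact: Qn.
  have eW := cls_sp wn; have Bn : B `<=` Sp n by rewrite -eW; exact: Qn.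
  have [BW|BW] := pselect (B = Sp n); first by left; rewrite eW -BW.
  right; exists n; first exact: eW.
  have n0n : (n < n0)%N.
    by move: lt; rewrite /n1 /maxn; case: ifP => // _; rewrite ltnS leqNgt jn.
  have B0n : B0 `<=` cls n.+1 w by rewrite eB0; exact: cls_sub.
  case: (sp_cases wn) => hw; move: nBn B0n; [rewrite cls_sm//|rewrite cls_la//] => nBn B0n.
    split; first by exists B0.
    by exists B => //; case: (atom_in_child (aS _ Bs) Bn BW).
  split; last by exists B0.
  by exists B => //; case: (atom_in_child (aS _ Bs) Bn BW).
- exact: subset_trans cj cSp.
- by move=> e; apply: properS; apply/seteqP; split=> //; rewrite -e.
- move=> B Bs [x Bx [xj nx]]; case: (laminar (aS _ Bs) (sp_atom F j) Bx xj) => // Bj.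
  by have [->//|nB] := pselect (B = Sp j); case: nx; exact: (Qn B).
Qed.

End trees.

Section disjoint_families.
Context d (T : measurableType d) (R : realType) (P : probability T R).

Lemma sum_J_disjoint (I : eqType) (l : seq I) (D : I -> set T) (f : T -> R) :
  uniq l -> (forall i, i \in l -> measurable (D i)) ->
  (forall i j x, i \in l -> j \in l -> D i x -> D j x -> i = j) ->
  essb P f -> (forall x, 0 <= f x) ->
  \sum_(i <- l) integ P (D i) f <= integ P setT f.
Proof.
move=> ul mD dD hf f0.
suff [U [mU _ ->]] : exists U, [/\ measurable U,
    forall x, U x -> exists2 i, i \in l & D i x &
    \sum_(i <- l) integ P (D i) f = integ P U f] by exact: le_J_set.
elim: l ul mD dD => [|i l IH] /= ul mD dD.
  by exists set0; split=> //; rewrite big_nil J_set0.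
move: ul => /andP[il ul]; have [||U [mU hU e]] := IH ul.
- by move=> j jl; apply: mD; rewrite in_cons jl orbT.
- by move=> j k x jl kl; apply: dD; rewrite in_cons ?jl ?kl orbT.
have mi : measurable (D i) by apply: mD; rewrite in_cons eqxx.
exists (D i `|` U); split; first exact: measurableU.
  move=> x [h|/hU[j jl h]]; first by exists i => //; rewrite in_cons eqxx.
  by exists j => //; rewrite in_cons jl orbT.
rewrite big_cons e JU//; apply/seteqP; split=> // x [ix /hU[j jl jx]].
have := dD i j x; rewrite !in_cons eqxx jl orbT => /(_ isT isT ix jx) ij.
by move: il; rewrite ij jl.
Qed.

End disjoint_families.

(** Arithmetic of the final count: [e] is the number of exceptional steps, [k] the number of chains,
    [a] and [b] their costs, [mp] the integral of the maximal function and [cd] Doob's constant. *)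
Lemma combine_sums (R : realFieldType) (cw cc cd l n e k tt t' g mp a b : R) :
  0 <= cw -> 0 <= cc -> 0 <= cd -> 0 <= tt -> 0 <= t' -> 0 <= g -> 0 <= n -> 0 <= l ->
  a <= cw * (e * tt + t' * mp) -> b <= cc * (k * tt + t' * (g + mp)) ->
  e <= n + 2 * n * l -> k <= 2 * n -> mp <= cd * g ->
  a + b <= (cw * (1 + 2 * l) + cc * 2 + (cw + cc) * (1 + cd)) * (n * tt + t' * g).
Proof.
move=> cw0 cc0 cd0 tt0 t0 g0 n0 l0 ha hb he hk hm.
have ha' : a <= cw * ((1 + 2 * l) * (n * tt) + cd * (t' * g)).
  apply: (le_trans ha); apply: ler_wpM2l => //; apply: lerD.
    rewrite mulrA; apply: ler_wpM2r => //; apply: (le_trans he); lra.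
  by rewrite mulrCA; apply: ler_wpM2l.
have hb' : b <= cc * (2 * (n * tt) + (1 + cd) * (t' * g)).
  apply: (le_trans hb); apply: ler_wpM2l => //; apply: lerD.
    by rewrite mulrA; apply: ler_wpM2r.
  rewrite mulrCA; apply: ler_wpM2l => //; lra.
have x0 : 0 <= n * tt by exact: mulr_ge0.
have y0 : 0 <= t' * g by exact: mulr_ge0.
move: (n * tt) (t' * g) x0 y0 ha' hb' => x y x0 y0 ha' hb'.
apply: (le_trans (lerD ha' hb')).
rewrite -subr_ge0 (_ : _ - _ = (cw + cc) * (1 + cd) * x +
  (cw * (1 + 2 * l) + cc * 2 + cw) * y); last by ring.
by rewrite !(addr_ge0, mulr_ge0)//; lra.
Qed.

Lemma optimize_threshold (R : realType) (x I n c th : R) : 0 < th -> 0 <= I -> 0 < n ->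
  0 <= c -> (forall t, 0 < t -> x <= c * (n * t `^ th + t `^ (th - 1) * I)) ->
  x <= 2 * c * n `^ (1 - th) * I `^ th.
Proof.
move=> th0 I0 n0 c0 h; have [e|In] := eqVneq I 0; last first.
  have Ip : 0 < I by rewrite lt_neqAle eq_sym In.
  apply: (le_trans (h (I / n) (divr_gt0 Ip n0))); rewrite -!mulrA mulrCA.
  apply: ler_wpM2l => //; rewrite mulr_natl mulr2n.
  have ni : 0 <= n^-1 by rewrite invr_ge0 ltW.
  have P r : (I / n) `^ r = I `^ r * n `^ (- r).
    by rewrite (powRM _ I0 ni) -(powR_inv1 (ltW n0)) -powRrM mulN1r.
  rewrite !P; have e1 : n * n `^ (- th) = n `^ (1 - th).
    rewrite -{1}(powRr1 (ltW n0)) -powRD ?opprK//.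
    by apply/implyP => _; rewrite gt_eqF.
  have e2 : I * I `^ (th - 1) = I `^ th by exact: mulr_powRB1.
  rewrite le_eqVlt; apply/orP; left; apply/eqP.
  rewrite opprB mulrCA e1.
  have -> : I `^ (th - 1) * n `^ (1 - th) * I = n `^ (1 - th) * (I * I `^ (th - 1)) by ring.
  by rewrite e2 mulrC.
rewrite e powR0 ?gt_eqF// mulr0 leNgt; apply/negP => x0.
(* For [I = 0] the threshold [I / n] is not positive. A [t] so small that [c * n * t ^ th] stays
   below [x] gives the contradiction instead. *)
pose t := (x / (2 * (c * n + 1))) `^ th^-1.
have cn : 0 < c * n + 1 by rewrite ltr_wpDl// mulr_ge0// ltW.
have q0 : 0 < x / (2 * (c * n + 1)) by rewrite divr_gt0// mulr_gt0.
have t0 : 0 < t by rewrite powR_gt0.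
have := h t t0; rewrite e mulr0 addr0 /t powRVK ?gt_eqF ?(ltW q0)// mulrA.
rewrite leNgt => /negP; apply.
rewrite mulrA ltr_pdivrMr ?mulr_gt0// mulrC ltr_pM2l//.
have : 0 <= c * n by rewrite mulr_ge0// ltW.
lra.
Qed.

(** * The chain condition bounds the steps of a sum of [n] pieces *)

Section sufficiency.
Context d (T : measurableType d) (R : realType) (P : probability T R).
Variables (F : binary_filtration P) (S : set (T -> R[i]%C)) (H : stable_space F S).
Variables p th : R.
Hypotheses (p1 : 1 < p) (th01 : 0 < th < 1).
Implicit Types (A B W X Y Z : set T) (f g h u v : T -> R[i]%C) (w : T).
Local Notation m := (mass P).
Local Notation J := (integ P).
Local Notation vessb := (essb_scalar P).
Local Notation nu := (Lpow P p).
Local Notation kap := (kappa H).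
Local Notation cls := (atom_at F).
Local Notation mx := (running_max F).
Local Notation Sp n := (bf_split F n.+1).
Local Notation qn := (diff_pow F S p).
Local Notation Y w j := (cls j w `\` cls j.+1 w).
Local Notation node := (pivot F).

Let p_gt0 : 0 < p. Proof. by rewrite (lt_trans _ p1). Qed.
Let p_ge0 : 0 <= p. Proof. exact: ltW. Qed.
Let th_gt0 : 0 < th. Proof. by case/andP: th01. Qed.

Variables (rho M : R).
Hypotheses (rho01 : 0 < rho < 1) (M0 : 0 <= M) (rhok : 1 - rho <= kap * rho).
Hypothesis hcond : forall w a b f, (a <= b)%N -> S f ->
  rho * m (cls a w) <= m (cls b w) ->
  \sum_(a <= j < b) nu (Y w j) f `^ th <= M * nu (cls a w `\` cls b w) f `^ th.
Variable L : nat.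
Hypothesis hL : rho ^+ L <= kap.
Local Notation chain_cst := (chain_cst H p th rho M L).
Local Notation exceptional_cst := (exceptional_cst H p th).

Section one_function.
Variables (n : nat) (v : 'I_n -> T -> R[i]%C) (A : 'I_n -> set T).
Hypothesis Sv : forall i, S (v i).
Hypothesis aA : forall i, all_atoms F (A i).
Let g := fun x => \sum_(i < n) restr (v i) (A i) x.
Let s := [seq A i | i <- enum 'I_n].

Let vg : vessb g.
Proof.
apply: vessb_sum => i; apply: vessb_restr; first exact: atom_measurable (aA i).
exact: (ss_essb H).
Qed.

Let in_s i : A i \in s. Proof. by apply: map_f; rewrite mem_enum. Qed.
Let as_ B : B \in s -> all_atoms F B. Proof. by move=> /mapP[i _ ->]. Qed.

Let one_piece X D : D `<=` X ->
  (forall B, B \in s -> (exists2 x, B x & D x) -> X `<=` B) ->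
  exists2 f, S f & forall x, D x -> g x = f x.
Proof.
move=> DX h; exists (fun x => \sum_(i < n | `[< X `<=` A i >]) v i x).
  exact: (ss_sum H).
move=> x Dx; rewrite /g [RHS]big_mkcond; apply: eq_bigr => i _.
case: asboolP => [XA|nXA]; first by rewrite restr_in//; exact/XA/DX.
by rewrite restr_out// => Ax; apply: nXA; apply: h => //; exists x.
Qed.

Let inactive j : (forall B, B \in s -> B `<=` Sp j -> B = Sp j) -> qn j g = 0.
Proof.
move=> h; have [||f Sf gf] := @one_piece (Sp j) (Sp j) => //.
  move=> B Bs [x Bx Sx]; case: (laminar (as_ Bs) (sp_atom F j) Bx Sx) => // /h -> //.
have vf := ss_essb H Sf.
by rewrite (eq_qn H p1 vg vf gf) (qn_eq0 H p1 j vf Sf).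
Qed.

Let node_chain N W : node s W -> exists (lev : pred nat) (r : seq nat) (X D : set T),
  [/\ [/\ all_atoms F X, W `<=` X, good s W X, measurable D & D `<=` X `\` W],
    (size r <= L)%N,
    forall j, (j < N)%N -> W `<=` Sp j -> W <> Sp j -> good s W (Sp j) -> lev j &
    \sum_(j < N | lev j && ((j : nat) \notin r)) qn j g `^ th <=
      chain_cst * (nu D g + J D (fun x => mx g N x `^ p)) `^ th].
Proof.
move=> nW; have aW := node_atom as_ nW; have [w Ww] := atom_nonempty aW.
have [b eb] := atom_level aW Ww.
have ex : exists a, `[< good s W (cls a w) >] && (a <= b)%N.
  exists b; rewrite leqnn andbT; apply/asboolP => B _ [x _ []].
  by rewrite -eb.
have [a /andP[/asboolP ga ab] amin] := ex_minnP ex.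
have WX : W `<=` cls a w by rewrite eb; exact: cls_sub.
(* Only the steps before [N] are summed, so the chain is cut off at level [N]; a chain starting
   later becomes empty. *)
set a' := minn a N; set b' := minn b N.
have ab' : (a' <= b')%N by rewrite /a' /b' leq_min !geq_min ab leqnn orbT.
have b'N : (b' <= N)%N by rewrite geq_minr.
set D := cls a' w `\` cls b' w.
have DX : D `<=` cls a w `\` W.
  move=> x [xa xb]; have [aN|Na] := leqP a N.
    move: xa xb; rewrite /a' (minn_idPl aN) => xa xb; split=> //.
    by rewrite eb => xb2; apply: xb; exact: cls_sub (geq_minl b N) _ xb2.
  exfalso; apply: xb; move: xa; rewrite /a' /b' (minn_idPr (ltnW Na)).
  by rewrite (minn_idPr (ltnW (leq_trans Na ab))).
have [||f Sf gf] := @one_piece (cls a w) D.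
- by move=> x /DX[].
- by move=> B Bs [x Bx /DX Dx]; apply: ga => //; exists x.
have [r [sr hr]] := chain_sum p1 th01 rho01 M0 rhok hcond hL ab' b'N vg Sf gf.
exists (fun j => (a' <= j < b')%N && (w \in Sp j)), r, (cls a w), D.
split; [|exact: sr| |].
- by split; [exact: all_atoms_cls|exact: WX|exact: ga|exact: clsDm|exact: DX].
- move=> j jN Wj nWj gj; have wj := Wj _ Ww; have e := cls_sp wj.
  have jb : (j < b)%N.
    rewrite ltnNge; apply/negP => bj; apply: nWj; apply/seteqP; split=> //.
    by rewrite eb -e; exact: cls_sub.
  rewrite mem_set// andbT /a' /b' geq_min leq_min jb jN andbT.
  by rewrite amin// (ltnW jb) andbT e; exact/asboolP.
- rewrite -(big_mkord (fun j => (a' <= j < b')%N && (w \in Sp j) && (j \notin r))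
    (fun j => qn j g `^ th)).
  have -> : nu D g = nu D f by exact: eq_nu.
  apply: le_trans hr; rewrite [leRHS](big_nat_widenl a' 0)// [leRHS](big_nat_widen 0 b' N)//=.
  rewrite le_eqVlt; apply/orP; left; apply/eqP; apply: eq_bigl => j.
  by case: (a' <= j)%N; case: (j < b')%N; rewrite /= ?andbT ?andbF.
Qed.

Definition Sigma_cst : R :=
  exceptional_cst * (1 + 2 * L%:R) + chain_cst * 2 + (exceptional_cst + chain_cst) * (1 + doob_cst p).

(** Every step before [N] is inactive, branching, set aside by a chain, or covered by the chain of
    the pivot that [hull] provides. The [n] pieces and at most [n] branching atoms make at most
    [2 * n] chains, hence at most [n + 2 * n * L] exceptional steps. *)
Let threshold_sum N t : 0 < t ->
  \sum_(j < N) qn j g `^ th <= Sigma_cst * (n%:R * t `^ th + t `^ (th - 1) * nu setT g).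
Proof.
move=> t0; have [r0 [sr0 hr0]] := branching_count as_.
(* The list [r0] may contain levels that do not branch; without this filter their atoms need not be
   pivots and the gaps need not be disjoint. *)
pose r1 := [seq k <- r0 | `[< branching F s k >]].
pose Ws := undup (s ++ [seq Sp k | k <- r1]).
have ss : size s = n by rewrite size_map size_enum_ord.
have sr1 : (size r1 <= n)%N by rewrite -ss (leq_trans _ sr0)// size_filter count_size.
have sWs : (size Ws <= 2 * n)%N.
  rewrite (leq_trans (size_undup _))// size_cat ss size_map mul2n -addnn leq_add2l.
  by rewrite (leq_trans _ sr1).
have nWs W : W \in Ws -> node s W.
  rewrite mem_undup mem_cat => /orP[Ws'|/mapP[k]]; first by left.
  by rewrite mem_filter => /andP[/asboolP hk _] ->; right; exists k.
have Wsn W : node s W -> W \in Ws.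
  rewrite mem_undup mem_cat; case=> [->//|[k -> hk]]; apply/orP; right.
  by apply: map_f; rewrite mem_filter hr0// andbT; exact/asboolP.
have /choice[lev /choice[r /choice[X /choice[D hD]]]] : forall W, exists (lev : pred nat)
  (r : seq nat) (X D : set T), W \in Ws ->
  [/\ [/\ all_atoms F X, W `<=` X, good s W X, measurable D & D `<=` X `\` W],
    (size r <= L)%N,
    forall j, (j < N)%N -> W `<=` Sp j -> W <> Sp j -> good s W (Sp j) -> lev j &
    \sum_(j < N | lev j && ((j : nat) \notin r)) qn j g `^ th <=
      chain_cst * (nu D g + J D (fun x => mx g N x `^ p)) `^ th].
  move=> W; have [/nWs/(node_chain N)[lev [r [X [D hD]]]]|_] := boolP (W \in Ws).
    by exists lev, r, X, D.
  by exists pred0, [::], set0, set0.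
pose exc := r1 ++ flatten [seq r W | W <- Ws].
have sexc : (size exc <= n + 2 * n * L)%N.
  rewrite size_cat leq_add// size_flatten /shape -map_comp sumnE big_map.
  apply: (@leq_trans (\sum_(W <- Ws) L)).
    rewrite [leqLHS]big_seq [leqRHS]big_seq; apply: leq_sum => W /hD[_ + _ _].
    by [].
  by rewrite big_const_seq count_predT iter_addn_0 mulnC leq_mul2r sWs orbT.
have qp j : 0 <= qn j g `^ th by exact: powR_ge0.
have split_sum : \sum_(j < N) qn j g `^ th <= \sum_(j < N | (j : nat) \in exc) qn j g `^ th +
    \sum_(W <- Ws) \sum_(j < N | lev W j && ((j : nat) \notin r W)) qn j g `^ th.
  rewrite (bigID (fun j : 'I_N => (j : nat) \in exc)) /= lerD2l.
  rewrite (eq_bigr (fun W => \sum_(j < N)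
    if lev W j && ((j : nat) \notin r W) then qn j g `^ th else 0)); last first.
    by move=> W _; rewrite big_mkcond.
  rewrite exchange_big /= big_mkcond; apply: ler_sum => j _.
  have pos W : 0 <= (if lev W j && ((j : nat) \notin r W) then qn j g `^ th else 0).
    by case: ifP.
  case: ifPn => [jexc|_]; last exact: sumr_ge0.
  have [/inactive e|] := pselect (forall B, B \in s -> B `<=` Sp j -> B = Sp j).
    by apply: (@le_trans _ _ 0); [rewrite e powR0 ?gt_eqF|exact: sumr_ge0].
  move=> /existsNP[B0 nB0]; move: nB0 => /not_implyP[B0s /not_implyP[B0j nB0]].
  have nb : ~ branching F s j.
    move=> hb; move: jexc; rewrite mem_cat mem_filter hr0// andbT negb_or.
    by move=> /andP[/asboolPn].
  have [W [nW Wj nWj gW]] := hull as_ B0s B0j nB0 nb.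
  have WWs := Wsn _ nW; have [_ _ hlev _] := hD _ WWs.
  have jr : (j : nat) \notin r W.
    move: jexc; rewrite mem_cat negb_or => /andP[_]; apply: contra => jr.
    by apply/flattenP; exists (r W) => //; exact: map_f.
  rewrite (bigD1_seq W)//=; last exact: undup_uniq.
  by rewrite hlev//= jr lerDl sumr_ge0.
apply: (le_trans split_sum); rewrite /Sigma_cst.
have t00 := ltW t0.
apply: (@combine_sums _ _ _ _ _ _ (\sum_(j < N | (j : nat) \in exc) 1)
  (\sum_(W <- Ws) 1) _ _ _ (max_pow F p g N)); rewrite ?powR_ge0 ?nu_ge0 ?ler0n//.
- exact: exceptional_cst_ge0.
- exact: chain_cst_ge0.
- by rewrite /doob_cst divr_ge0 ?powR_ge0// subr_ge0 ltW.
- exact: (exceptional_sum H p1 th01 (fun j => j \in exc) N vg t0).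
(* Once the threshold has made the bounds affine, the integrals over the disjoint gaps add up to at
   most the integrals over the whole space. *)
- apply: (@le_trans _ _ (\sum_(W <- Ws) chain_cst * (t `^ th +
      (nu (D W) g + J (D W) (fun x => mx g N x `^ p)) * t `^ (th - 1)))).
    rewrite [leLHS]big_seq [leRHS]big_seq; apply: ler_sum => W /hD[_ _ _ h].
    apply: (le_trans h); apply: ler_wpM2l; first exact: chain_cst_ge0.
    apply: powR_threshold => //; rewrite addr_ge0 ?nu_ge0//.
    by apply: J_ge0 => x _; exact: powR_ge0.
  rewrite -mulr_sumr; apply: ler_wpM2l; first exact: chain_cst_ge0.
  rewrite big_split /= mulr_suml; apply: lerD.
    by apply: ler_sum => W _; rewrite mul1r.
  rewrite -mulr_suml mulrC; apply: ler_wpM2l; first exact: powR_ge0.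
  have emx : essb P (fun x => mx g N x `^ p).
    by apply: essb_powR => //; [exact: mx_ge0|exact: essb_mx].
  have egp := essb_nrmp p1 vg.
  rewrite big_split /=; apply: lerD; apply: sum_J_disjoint => //; try exact: undup_uniq;
    try (by move=> W /hD[[]]); try (by move=> x; exact: powR_ge0).
  + move=> W1 W2 x h1 h2 d1 d2; have [[a1 w1 g1 _ s1] _ _ _] := hD _ h1.
    have [[a2 w2 g2 _ s2] _ _ _] := hD _ h2.
    exact: (good_disjoint as_ (nWs _ h1) (nWs _ h2) a1 a2 w1 w2 g1 g2 (s1 _ d1) (s2 _ d2)).
  + move=> W1 W2 x h1 h2 d1 d2; have [[a1 w1 g1 _ s1] _ _ _] := hD _ h1.
    have [[a2 w2 g2 _ s2] _ _ _] := hD _ h2.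
    exact: (good_disjoint as_ (nWs _ h1) (nWs _ h2) a1 a2 w1 w2 g1 g2 (s1 _ d1) (s2 _ d2)).
- apply: (@le_trans _ _ (size exc)%:R); last first.
    by rewrite -!natrM -natrD ler_nat.
  rewrite -(big_mkord (fun j => j \in exc) (fun=> 1)) big_const_seq iter_addr_0.
  rewrite -mulr_natl mulr1 ler_nat -size_filter; apply: uniq_leq_size.
    by rewrite filter_uniq// iota_uniq.
  by move=> j; rewrite mem_filter => /andP[].
- by rewrite big_const_seq count_predT iter_addr_0 -mulr_natl mulr1 -natrM ler_nat.
- exact: doob.
Qed.

Lemma qn_sum_Sigma N : (0 < n)%N ->
  \sum_(j < N) qn j g `^ th <= 2 * Sigma_cst * n%:R `^ (1 - th) * nu setT g `^ th.
Proof.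
move=> n0; apply: optimize_threshold => //; rewrite ?nu_ge0 ?ltr0n//.
  have c0 := chain_cst_ge0 H p1 th01 rho01 M0 L; have w0 := exceptional_cst_ge0 H p th01.
  have d0 : 0 <= doob_cst p by rewrite /doob_cst divr_ge0 ?powR_ge0// subr_ge0 ltW.
  by rewrite /Sigma_cst; apply: addr_ge0; [apply: addr_ge0|]; apply: mulr_ge0 => //;
    apply: addr_ge0 => //; apply: mulr_ge0.
by move=> t t0; exact: threshold_sum.
Qed.

End one_function.

End sufficiency.

(** * Necessity *)

Section necessity.
Context d (T : measurableType d) (R : realType) (P : probability T R).
Variables (F : binary_filtration P) (S : set (T -> R[i]%C)) (H : stable_space F S).
Variables p th : R.
Hypotheses (p1 : 1 < p) (th01 : 0 < th < 1).
Implicit Types (A B Y Z : set T) (f g h u v : T -> R[i]%C).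
Local Notation m := (mass P).
Local Notation J := (integ P).
Local Notation vessb := (essb_scalar P).
Local Notation nu := (Lpow P p).
Local Notation avg := (mean_abs P).
Local Notation K0 := (stab_cst H).
Local Notation kap := (kappa H).
Local Notation k := (ss_dim H).
Local Notation Sp n := (bf_split F n.+1).
Local Notation Sm n := (bf_small F n.+1).
Local Notation La n := (bf_large F n.+1).
Local Notation qn := (diff_pow F S p).

Let p_gt0 : 0 < p. Proof. by rewrite (lt_trans _ p1). Qed.
Let p_ge0 : 0 <= p. Proof. exact: ltW. Qed.
Let th_gt0 : 0 < th. Proof. by case/andP: th01. Qed.
Let th_ge0 : 0 <= th. Proof. exact: ltW. Qed.
Let th_le1 : th <= 1. Proof. by case/andP: th01 => _ /ltW. Qed.
Let K0_gt0 : 0 < K0. Proof. exact: lt_le_trans (K0_ge2 _). Qed.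
Let K0_ge0 : 0 <= K0. Proof. exact: ltW. Qed.

(** [A1] is the price of writing [f] as [(f - u) + u], and [A2] that of expanding [u] by [frame_nu]
    when its mean is at most [K0 ^+ 2] times a given number. *)
Let A1 : R := locked ((2 `^ p) `^ th).
Let A2 : R := locked (((k%:R * (K0 * K0 ^+ 2)) `^ p) `^ th).

Let A1_ge0 : 0 <= A1. Proof. by rewrite /A1 -lock powR_ge0. Qed.
Let A2_ge0 : 0 <= A2. Proof. by rewrite /A2 -lock powR_ge0. Qed.

Section one_chain.
Variables (n : nat) (X : nat -> set T).
Hypothesis aX : forall j, (j <= n)%N -> all_atoms F (X j).
Hypothesis childX : forall j, (j < n)%N -> is_child F (X j) (X j.+1).

Lemma chain_child j : (j < n)%N -> exists l, X j = Sp l /\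
  ((X j.+1 = Sm l /\ X j `\` X j.+1 = La l) \/ (X j.+1 = La l /\ X j `\` X j.+1 = Sm l)).
Proof.
move=> /childX[l [e1 e2]]; exists l; split=> //; rewrite e1 -(bf_cover F l).
have dd := bf_disj F l; case: e2 => ->; [left|right]; split=> //.
  by rewrite setDUl setDv set0U; apply/setDidPl; rewrite setIC.
by rewrite setDUl setDv setU0; apply/setDidPl.
Qed.

Lemma chain_subS j : (j < n)%N -> X j.+1 `<=` X j.
Proof.
by move=> /chain_child[l [-> [[-> _]|[-> _]]]]; [exact: sm_sub|exact: la_sub].
Qed.

Lemma chain_sub i j : (i <= j)%N -> (j <= n)%N -> X j `<=` X i.
Proof.
elim: j => [|j IH]; first by rewrite leqn0 => /eqP -> _.
rewrite leq_eqVlt => /predU1P[-> _ //|ij] jn.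
by apply: (subset_trans (chain_subS jn)); apply: IH => //; exact: ltnW.
Qed.

Lemma chain_proper i j : (i < j)%N -> (j <= n)%N -> X j <> X i.
Proof.
move=> ij jn e; have h := chain_sub ij jn; rewrite e in h.
have [l [e1 e2]] := chain_child (leq_trans ij jn); rewrite e1 in h.
by case: e2 => -[e2 _]; rewrite e2 in h; [apply: (@sm_neq _ _ _ _ F l)|apply: (@la_neq _ _ _ _ F l)];
  apply/seteqP; split=> //; [exact: sm_sub|exact: la_sub].
Qed.

Let D := X 0%N `\` X n.
Local Notation Y j := (X j `\` X j.+1).

Let mX j : (j <= n)%N -> measurable (X j).
Proof. by move=> /aX; exact: atom_measurable. Qed.

Let mD' : measurable D.
Proof. by apply: measurableD; exact: mX. Qed.

Let mY j : (j < n)%N -> measurable (Y j).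
Proof. by move=> jn; apply: measurableD; apply: mX => //; exact: ltnW. Qed.

Let YD j : (j < n)%N -> Y j `<=` D.
Proof.
move=> jn x [xj xj1]; split; first exact: chain_sub (leq0n j) (ltnW jn) _ xj.
by move=> xn; apply: xj1; exact: chain_sub jn (leqnn n) _ xn.
Qed.

(** [hB] is the Bernstein inequality, for partial sums and in [p]-th powers, on the functions
    [restr f D]. These consist of two pieces however long the chain is, so [CB] does not depend on
    [n]. *)
Variables (CB rho : R).
Hypotheses (CB0 : 0 <= CB) (rho1 : rho < 1) (rhok : 1 - rho <= kap).
Hypothesis hrho : rho * m (X 0%N) <= m (X n).
Hypothesis hB : forall f, S f -> forall N,
  \sum_(j < N) qn j (restr f D) `^ th <= CB * nu setT (restr f D) `^ th.

Let nu_restr f : S f -> nu setT (restr f D) = nu D f.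
Proof.
move=> Sf; have vf := ss_essb H Sf.
have vr : vessb (restr f D) by exact: vessb_restr.
have -> : nu setT (restr f D) = nu D (restr f D) + nu (~` D) (restr f D).
  by rewrite -nuU ?setUCr ?setICr//; exact: measurableC.
have -> : nu D (restr f D) = nu D f by apply: eq_nu => x Dx; rewrite restr_in.
rewrite -[RHS]addr0; congr (_ + _); rewrite -(@nu0 _ _ _ P p p1 (~` D)); last exact: measurableC.
by apply: eq_nu => x Dx; rewrite restr_out.
Qed.

(** The atoms of the chain are pairwise different, so they are split at different levels and the
    steps along the chain form a subfamily of all steps. *)
Let sum_steps f : S f -> forall l : nat -> nat, (forall j, (j < n)%N -> X j = Sp (l j)) ->
  \sum_(j < n) qn (l j) (restr f D) `^ th <= CB * nu D f `^ th.
Proof.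
move=> Sf l hl; rewrite -nu_restr//.
pose N := (\max_(j < n) l j).+1.
apply: le_trans (hB Sf N).
have lN (j : 'I_n) : (l j < N)%N by rewrite ltnS; exact: (leq_bigmax j).
pose ll (j : 'I_n) : 'I_N := Ordinal (lN j).
have inj : injective ll.
  move=> i j /(congr1 val)/= e; apply: val_inj => /=.
  have eX : X i = X j by rewrite !hl// e.
  case: (ltngtP i j) => // ij; exfalso.
    by apply: (chain_proper ij _) => //; exact: ltnW.
  by apply: (chain_proper ij _) => //; exact: ltnW.
rewrite (eq_bigr (fun j => qn (ll j) (restr f D) `^ th))//.
rewrite -(big_imset (fun j : 'I_N => qn j (restr f D) `^ th))/=; last by move=> *; exact: inj.
rewrite big_mkcond; apply: ler_sum => j _; case: ifP => // _; exact: powR_ge0.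
Qed.

Lemma chain_mD : m D <= (1 - rho) * m (X 0%N).
Proof.
rewrite mD; [|exact: mX|exact: mX|exact: chain_sub].
by rewrite mulrBl mul1r lerD2l lerN2.
Qed.

Variable e : nat -> T -> R[i]%C.
Hypothesis fe : frame H (X 0%N) e.

(** The unknown of the absorption argument: the left side of the chain condition for all frame
    functions together. It is finite for each chain, but no bound uniform in the chain is known
    beforehand. *)
Definition Zsum : R := \sum_(i < k) \sum_(j < n) nu (Y j) (e i) `^ th.

Let X0pos : 0 < m (X 0%N). Proof. by apply: (@atom_gt0 _ _ _ _ F); exact: aX. Qed.

Lemma necessity_step f : S f ->
  \sum_(j < n) nu (Y j) f `^ th <=
  A1 * (CB * nu D f `^ th + A2 * ((J D (nrm f) / m (X 0%N)) `^ p) `^ th * Zsum).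
Proof.
move=> Sf; have vf := ss_essb H Sf; pose g := restr f D.
have vg : vessb g by exact: vessb_restr.
have /choice[l hl] : forall j, exists l, (j < n)%N -> X j = Sp l /\
  ((X j.+1 = Sm l /\ Y j = La l) \/ (X j.+1 = La l /\ Y j = Sm l)).
  move=> j; have [jn|nj] := ltnP j n; last by exists 0%N.
  by have [l hl] := chain_child jn; exists l.
have steps := sum_steps Sf (fun j jn => (hl j jn).1).
pose u j := ss_proj P S (X j) g.
have hu j : (j < n)%N -> is_projection P S (X j) g (u j).
  by move=> jn; apply: (ss_projP H) => //; apply: aX; exact: ltnW.
have gf j : (j < n)%N -> is_projection P S (Y j) g f.
  move=> jn; apply: pr_id => //; first exact: mY.
  by move=> x /(YD jn) Dx; rewrite /g restr_in.
have JX j : (j <= n)%N -> J (X j) (nrm g) <= J D (nrm f).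
  move=> jn; apply: (@le_trans _ _ (J setT (nrm g))).
    by apply: le_J_set => //; [exact: mX|exact: essb_nrm|exact: nrm_ge0].
  have -> : J setT (nrm g) = J setT (fun x => nrm f x * \1_D x).
    apply: eq_J => x _; rewrite /g /nrm restrE indicE.
    by case: ifP => _; rewrite ?mulr1// mulr0 Normc.normc0.
  by rewrite J_indic setTI.
set al := J D (nrm f) / m (X 0%N).
have avu j : (j < n)%N -> avg (X 0%N) (u j) <= K0 ^+ 2 * al.
  move=> jn; have aj : all_atoms F (X j) by apply: aX; exact: ltnW.
  have mj := atom_measurable aj; have j0 := atom_gt0 aj.
  have a0 : all_atoms F (X 0%N) by exact: aX.
  have sb : X j `<=` X 0%N by apply: chain_sub => //; exact: ltnW.
  have Sj : S (u j) by case: (hu j jn).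
  have sm1 : m (X 0%N `\` X j) <= kap * m (X 0%N).
    apply: (@le_trans _ _ (m D)).
      apply: le_m => //; first by apply: measurableD => //; exact: mX.
      by move=> x [x0 nx]; split=> // xn; apply: nx; exact: chain_sub (ltnW jn) (leqnn n) _ xn.
    by apply: (le_trans chain_mD); apply: ler_wpM2r => //; exact: ltW.
  have st := stabP a0 mj sb sm1 Sj.
  have := J_le_cst (mX (leq0n n)) (ss_essb H Sj) st; rewrite (J_avg _ a0) ler_pM2r// => h.
  apply: (le_trans h).
  have h2 : J (X j) (nrm (u j)) <= K0 * J (X j) (nrm g).
    rewrite (J_avg (u j) aj) (J_avg g aj) mulrA ler_pM2r//; apply: pr_avg => //; exact: hu.
  have -> : K0 ^+ 2 * al = K0 / m (X 0%N) * (K0 * J D (nrm f)) by rewrite /al; ring.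
  apply: ler_wpM2l; first by rewrite divr_ge0// ltW.
  by apply: (le_trans h2); apply: ler_wpM2l => //; apply: JX; exact: ltnW.
have stepj (j : 'I_n) : nu (Y j) f `^ th <= A1 * (qn (l j) g `^ th + nu (Y j) (u j) `^ th).
  have jn := ltn_ord j; have huj := hu j jn; have gfj := gf j jn.
  have Sj : S (u j) by case: huj.
  have vu := ss_essb H Sj.
  have l1 : nu (Y j) (fun x => f x - u j x) <= qn (l j) g.
    have [e1 e2] := hl j jn; rewrite e1 in huj.
    case: e2 => -[_ e3]; rewrite e3 in gfj *.
      have [u' hu'] := pr_exists H (sm_atom F (l j)) vg.
      by rewrite (qnE H p1 vg huj hu' gfj) lerDr nu_ge0.
    have [u' hu'] := pr_exists H (la_atom F (l j)) vg.
    by rewrite (qnE H p1 vg huj gfj hu') lerDl nu_ge0.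
  have mj := mY jn.
  have l2 : nu (Y j) f <= 2 `^ p * (qn (l j) g + nu (Y j) (u j)).
    have -> : nu (Y j) f = nu (Y j) (fun x => (f x - u j x) + u j x).
      by apply: eq_nu => x _; rewrite subrK.
    apply: (le_trans (nuD_le p1 mj (vessbB vf vu) vu)).
    by apply: ler_wpM2l; [exact: powR_ge0|rewrite lerD2r].
  apply: (le_trans (ler_powR2 th_ge0 (nu_ge0 _ _ _ _) l2)).
  have s0 : 0 <= qn (l j) g + nu (Y j) (u j) by rewrite addr_ge0 ?qn_ge0 ?nu_ge0.
  rewrite /A1 -lock (powRM _ (powR_ge0 _ _) s0); apply: ler_wpM2l; first exact: powR_ge0.
  by apply: powR_subadd; rewrite ?th_ge0 ?qn_ge0 ?nu_ge0.
apply: (le_trans (ler_sum _ (fun j _ => stepj j))).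
rewrite -mulr_sumr; apply: ler_wpM2l; first exact: A1_ge0.
rewrite big_split /=; apply: lerD; first exact: steps.
rewrite /Zsum exchange_big mulr_sumr; apply: ler_sum => j _ /=.
have jn := ltn_ord j; have Sj : S (u j) by case: (hu j jn).
have YX : Y j `<=` X 0%N by apply: subset_trans (YD jn) _; exact: subDsetl.
have := frame_nu p1 (aX (leq0n n)) fe (mY jn) YX Sj (avu j jn).
move=> /(ler_powR2 th_ge0 (nu_ge0 _ _ _ _)) h; apply: (le_trans h).
have kk0 : 0 <= k%:R * (K0 * K0 ^+ 2) by rewrite !mulr_ge0// ?sqr_ge0.
have al0 : 0 <= al by rewrite divr_ge0 ?(ltW X0pos)// J_ge0// => x _; exact: nrm_ge0.
have -> : k%:R * (K0 * (K0 ^+ 2 * al)) = (k%:R * (K0 * K0 ^+ 2)) * al by ring.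
have s0 : 0 <= \sum_(i < k) nu (Y j) (e i) by apply: sumr_ge0 => i _; exact: nu_ge0.
rewrite (powRM _ (powR_ge0 _ _) s0) (powRM _ kk0 al0) (powRM _ (powR_ge0 _ _) (powR_ge0 _ _)).
rewrite /A2 -lock; apply: ler_wpM2l; first by rewrite mulr_ge0 ?powR_ge0.
by apply: powR_subadd_sum; rewrite ?th_gt0// => i; exact: nu_ge0.
Qed.

Hypothesis hdelta : k%:R * A1 * A2 * (K0 `^ p * (1 - rho) `^ p) `^ th <= 1 / 2.

Let mD0 : 0 <= m D. Proof. exact: m_ge0. Qed.
Let P0 (x r : R) : 0 <= x `^ r. Proof. exact: powR_ge0. Qed.

(** [necessity_step] for each frame function bounds [Zsum] by a term without it plus a multiple of
    itself. Frame functions are bounded by [K0] and [D] is at most the fraction [1 - rho] of the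
    first atom, so by [hdelta] this multiple is at most one half. *)
Lemma Zsum_le : Zsum <= 2 * k%:R * A1 * CB * (K0 `^ p * m D) `^ th.
Proof.
have [Se e1 _] := fe; have Z0 : 0 <= Zsum.
  by apply: sumr_ge0 => i _; apply: sumr_ge0 => j _; exact: powR_ge0.
have one (i : 'I_k) : \sum_(j < n) nu (Y j) (e i) `^ th <=
    A1 * (CB * (K0 `^ p * m D) `^ th + A2 * (K0 `^ p * (1 - rho) `^ p) `^ th * Zsum).
  apply: (le_trans (necessity_step (Se i))); apply: ler_wpM2l; first exact: A1_ge0.
  have vei := ss_essb H (Se i).
  have eD : {ae P, forall x, D x -> nrm (e i) x <= K0}.
    by apply: filterS (e1 i) => x h [x0 _]; exact: h.
  apply: lerD.
    apply: ler_wpM2l => //; apply: ler_powR2 => //; first exact: nu_ge0.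
    exact: nu_le_cst.
  apply: ler_wpM2r => //; apply: ler_wpM2l; first exact: A2_ge0.
  have d0 : 0 <= 1 - rho by rewrite subr_ge0 ltW.
  apply: ler_powR2 => //; rewrite -(powRM _ K0_ge0 d0); apply: ler_powR2 => //.
    by rewrite divr_ge0 ?(ltW X0pos)// J_ge0// => x _; exact: nrm_ge0.
  rewrite ler_pdivrMr// -mulrA; apply: (le_trans (J_le_cst mD' vei eD)).
  by apply: ler_wpM2l => //; exact: chain_mD.
have : Zsum <= k%:R * (A1 * (CB * (K0 `^ p * m D) `^ th + A2 * (K0 `^ p * (1 - rho) `^ p) `^ th * Zsum)).
  by apply: (le_trans (ler_sum _ (fun i _ => one i))); rewrite sumr_const card_ord mulr_natl.
move: hdelta Z0; move: A1 A2 ((K0 `^ p * (1 - rho) `^ p) `^ th) ((K0 `^ p * m D) `^ th) k%:R Zsum.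
move=> a1 a2 x y q z h z0 hz.
have {}hz : z <= q * a1 * CB * y + (q * a1 * a2 * x) * z by apply: (le_trans hz); lra.
have := ler_wpM2r z0 h; lra.
Qed.

Definition necessity_cst : R := A1 * (CB + A2 * (2 * k%:R * A1 * CB * (K0 `^ p) `^ th)).

Lemma chain_necessity f : S f ->
  \sum_(j < n) nu (Y j) f `^ th <= necessity_cst * nu D f `^ th.
Proof.
move=> Sf; have vf := ss_essb H Sf; apply: (le_trans (necessity_step Sf)).
rewrite /necessity_cst -[leRHS]mulrA; apply: ler_wpM2l; first exact: A1_ge0.
rewrite mulrDl lerD2l -[leRHS]mulrA -[leLHS]mulrA; apply: ler_wpM2l; first exact: A2_ge0.
have J0 : 0 <= J D (nrm f) by apply: J_ge0 => x _; exact: nrm_ge0.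
have q0 : 0 <= J D (nrm f) / m (X 0%N) by rewrite divr_ge0// ltW.
(* Hölder's inequality on [D]. The factor [m D] is the one that [Zsum_le] supplies, so for general
   [f] no further smallness is required. *)
have key : (J D (nrm f) / m (X 0%N)) `^ p * m D <= nu D f.
  have iX : 0 <= (m (X 0%N))^-1 by rewrite invr_ge0 ltW.
  rewrite (powRM _ J0 iX); apply: (@le_trans _ _ ((m D / m (X 0%N)) `^ p * nu D f)).
    rewrite (powRM _ mD0 iX) -(mulr_powRB1 mD0 p_gt0).
    have := ler_wpM2r mD0 (ler_wpM2r (P0 (m (X 0%N))^-1 p) (nu_holder p1 mD' vf)).
    by move=> h; apply: (le_trans h); rewrite le_eqVlt; apply/orP; left; apply/eqP; ring.
  apply: ler_piMl; first exact: nu_ge0.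
  have a0 : 0 <= m D / m (X 0%N) by rewrite divr_ge0// ltW.
  have a1 : m D / m (X 0%N) <= 1.
    rewrite ler_pdivrMr// mul1r; apply: le_m; [exact: mD'|exact: mX|exact: subDsetl].
  by apply: (le_trans (ler_powR2 p_ge0 a0 a1)); rewrite powR1.
apply: (le_trans (ler_wpM2l (P0 _ th) Zsum_le)).
rewrite (powRM _ (P0 K0 p) mD0).
have {}key := ler_powR2 th_ge0 (mulr_ge0 (P0 _ _) mD0) key.
rewrite (powRM _ (P0 _ p) mD0) in key.
have c0 : 0 <= 2 * k%:R * A1 * CB * (K0 `^ p) `^ th.
  apply: mulr_ge0; last exact: powR_ge0.
  by apply: mulr_ge0 => //; apply: mulr_ge0; [exact: mulr_ge0|exact: A1_ge0].
have := ler_wpM2l c0 key; apply: le_trans.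
have aux (x c y z : R) : x * (c * (y * z)) <= c * y * (x * z).
  by rewrite le_eqVlt; apply/orP; left; apply/eqP; ring.
exact: aux.
Qed.

End one_chain.

Lemma chain_necessity_ex (CB : R) : 0 <= CB -> exists rho M : R, [/\ 0 < rho < 1, 0 <= M &
  forall n (X : nat -> set T), (forall j, (j <= n)%N -> all_atoms F (X j)) ->
    (forall j, (j < n)%N -> is_child F (X j) (X j.+1)) ->
    rho * m (X 0%N) <= m (X n) ->
    (forall f, S f -> forall N, \sum_(j < N) qn j (restr f (X 0%N `\` X n)) `^ th <=
       CB * nu setT (restr f (X 0%N `\` X n)) `^ th) ->
    forall f, S f -> \sum_(j < n) nu (X j `\` X j.+1) f `^ th <=
      M * nu (X 0%N `\` X n) f `^ th].
Proof.
move=> CB0; pose q : R := locked (k%:R * A1 * A2 * (K0 `^ p) `^ th).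
have q0 : 0 <= q.
  rewrite /q -lock; apply: mulr_ge0; last exact: powR_ge0.
  by apply: mulr_ge0; [apply: mulr_ge0; [exact: ler0n|exact: A1_ge0]|exact: A2_ge0].
(* [del] becomes [1 - rho]: at most [kap] for stability along the chain, and so small that [q] times
   its power [p * th] is at most one half for the absorption. Adding 1 to [q] covers [q = 0]. *)
pose del := Num.min kap ((2 * (q + 1))^-1 `^ (p * th)^-1).
have k0 := kap_gt0 H; have q1 : 0 < 2 * (q + 1) by rewrite mulr_gt0// ltr_wpDl.
have pth : 0 < p * th by rewrite mulr_gt0.
have d0 : 0 < del by rewrite lt_min k0 powR_gt0 ?invr_gt0.
have dk : del <= kap by rewrite ge_min lexx.
have d1 : del < 1 by apply: (le_lt_trans dk); have := kap_le H; lra.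
have dq : del `^ p `^ th <= (2 * (q + 1))^-1.
  rewrite -powRrM -[leRHS](@powRVK _ (p * th)) ?gt_eqF ?invr_ge0 ?(ltW q1)//.
  by apply: ler_powR2; [exact: ltW|exact: ltW|rewrite ge_min lexx orbT].
exists (1 - del), (necessity_cst CB); split.
- by rewrite subr_gt0 d1/= gtrBl.
- apply: mulr_ge0; first exact: A1_ge0.
  apply: addr_ge0 => //; apply: mulr_ge0; first exact: A2_ge0.
  apply: mulr_ge0; last exact: powR_ge0.
  by apply: mulr_ge0 => //; apply: mulr_ge0; [exact: mulr_ge0|exact: A1_ge0].
move=> n X aX cX hr hB f Sf.
have [e fe] := frame_exists H (aX 0%N isT).
have e1 : 1 - (1 - del) = del by ring.
apply: (chain_necessity aX cX CB0 _ _ hr hB fe _ Sf); rewrite ?e1//.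
  by rewrite gtrBl.
have -> : (K0 `^ p * del `^ p) `^ th = (K0 `^ p) `^ th * (del `^ p) `^ th.
  by rewrite (powRM _ (powR_ge0 _ _) (powR_ge0 _ _)).
rewrite mulrA (_ : k%:R * A1 * A2 * (K0 `^ p) `^ th = q); last by rewrite /q -lock.
apply: (le_trans (ler_wpM2l q0 dq)); rewrite invfM mulrCA.
have : q / (q + 1) <= 1 by rewrite ler_pdivrMr ?mul1r ?lerDl// ltr_wpDl.
lra.
Qed.

End necessity.

(** * Back to the projectors *)

Section scalars.
Context d (T : measurableType d) (R : realType) (P : probability T R).
Variables (F : binary_filtration P) (K : scalar_field) (S : set (T -> R[i]%C)).
Hypotheses (fS : finite_dim_space K S) (stS : stable F S).
Implicit Types (A : set T) (f g h u v : T -> R[i]%C).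
Local Notation m := (mass P).
Local Notation vessb := (essb_scalar P).

Let scalarsD (a b : R[i]%C) : scalars K a -> scalars K b -> scalars K (a + b).
Proof. by case: K => //=; rewrite ImD => -> ->; rewrite addr0. Qed.

Let scalarsZ (r : R) (a : R[i]%C) : scalars K a -> scalars K (r%:C%C * a).
Proof. by case: K => //=; rewrite ImZ => ->; rewrite mulr0. Qed.

Let S_add f g : S f -> S g -> S (fun x => f x + g x).
Proof.
move: fS => [k [b [_ ->]]] [c [hc ->]] [c' [hc' ->]].
exists (fun i => c i + c' i); split; first by move=> i; exact: scalarsD.
by apply/funext => x; rewrite -big_split; apply: eq_bigr => i _; rewrite mulrDl.
Qed.

Let S_scale (r : R) f : S f -> S (fun x => r%:C%C * f x).
Proof.
move: fS => [k [b [_ ->]]] [c [hc ->]].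
exists (fun i => r%:C%C * c i); split; first by move=> i; exact: scalarsZ.
by apply/funext => x; rewrite mulr_sumr; apply: eq_bigr => i _; rewrite mulrA.
Qed.

Let S_zero : S (fun=> 0).
Proof.
move: fS => [k [b [_ ->]]]; exists (fun=> 0); split.
  by move=> i; case: K.
by apply/funext => x; rewrite big1// => i _; rewrite mul0r.
Qed.

(** The imaginary unit, or zero in the real case, so that one formula for coordinates over the reals
    serves both cases. *)
Let iu : R[i]%C := if K is ComplexScalars then 'i%C else 0.

Let iuE (c : R[i]%C) : scalars K c -> c = (complex.Re c)%:C%C + (complex.Im c)%:C%C * iu.
Proof.
rewrite /iu; case: K => /=; last by move=> _; rewrite mulrC -complexE.
by case: c => a b /= ->; rewrite mulr0 addr0.
Qed.

Let S_basis : exists (n : nat) (b : nat -> T -> R[i]%C), (forall i, S (b i)) /\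
  forall f, S f -> exists c : nat -> R, f = fun x => \sum_(i < n) (c i)%:C%C * b i x.
Proof.
have S0 := S_zero; have SD := S_add.
move: fS S0 SD => [k [b [_ SE]]] S0 SD.
have Sc (a : R[i]%C) i : scalars K a -> S (fun x => a * b i x).
  move=> ha; rewrite SE; exists (fun j => if j == i then a else 0); split.
    by move=> j; case: ifP => // _; case: K.
  apply/funext => x; rewrite (bigD1 i)//= eqxx big1 ?addr0// => j /negbTE ->.
  by rewrite mul0r.
(* The given functions followed by their multiples by [iu]; real and imaginary parts of the
   coefficients become the coordinates. Beyond [k + k] the value is the zero function, which also
   belongs to [S]. *)
pose bb (j : nat) : T -> R[i]%C := if insub j is Some i then b i
  else if insub (j - k)%N is Some i then fun x => iu * b i x else fun=> 0.
exists (k + k)%N, bb; split.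
  move=> j; rewrite /bb; case: insubP => [i _ _|_].
    have -> : b i = fun x => 1 * b i x by apply/funext => x; rewrite mul1r.
    by apply: Sc; case: K.
  case: insubP => [i _ _|_] //; apply: Sc; rewrite /iu; by case: K.
move=> f; rewrite SE => -[c [hc ->]].
pose re (j : nat) := if insub j is Some i then complex.Re (c i)
  else if insub (j - k)%N is Some i then complex.Im (c i) else 0.
exists re; apply/funext => x; rewrite big_split_ord /= -big_split /=.
apply: eq_bigr => i _; rewrite /re /bb (insubT (fun j => (j < k)%N) (ltn_ord i)).
have nk : ~~ (k + i < k)%N by rewrite -leqNgt leq_addr.
rewrite insubN// addKn (insubT (fun j => (j < k)%N) (ltn_ord i)).
have -> : Sub (nat_of_ord i) (ltn_ord i) = i by apply: val_inj.
by rewrite {1}(iuE (hc i)) mulrDl mulrA.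
Qed.

Let S_measurable f : S f -> measurable_scalar f.
Proof.
move: fS => [k [b [hb ->]]] [c [_ ->]].
have re i : measurable_fun setT (fun x => complex.Re (c i * b i x)).
  have [[h1 h2] _] := hb i.
  have -> : (fun x => complex.Re (c i * b i x)) = fun x =>
      complex.Re (c i) * complex.Re (b i x) - complex.Im (c i) * complex.Im (b i x).
    by apply/funext => x; case: (c i) => a1 a2; case: (b i x).
  by apply: measurable_funB; apply: measurable_funM.
have im i : measurable_fun setT (fun x => complex.Im (c i * b i x)).
  have [[h1 h2] _] := hb i.
  have -> : (fun x => complex.Im (c i * b i x)) = fun x =>
      complex.Re (c i) * complex.Im (b i x) + complex.Im (c i) * complex.Re (b i x).
    by apply/funext => x; case: (c i) => a1 a2; case: (b i x).
  by apply: measurable_funD; apply: measurable_funM.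
split.
  by under eq_fun do rewrite Re_sum; exact: measurable_sum.
by under eq_fun do rewrite Im_sum; exact: measurable_sum.
Qed.

Let S_measurable_nrm f : S f -> measurable_fun setT (nrm f).
Proof.
move=> /S_measurable[mr mi].
have -> : nrm f = fun x => (dot (f x) (f x)) `^ 2^-1.
  apply/funext => x; rewrite -normc_sqr powR12_sqrt ?sqr_ge0// sqrtr_sqr.
  by rewrite ger0_norm// nrm_ge0.
apply: (measurableT_comp (measurable_powR _)).
by apply: measurable_funD; apply: measurable_funM.
Qed.

Let stable_real_constants (c1 c2 : R) f A : 0 < c1 -> 0 < c2 -> all_atoms F A -> S f ->
  (c2%:E * P A <= P (A `&` [set x | c1%:E * Lpnorm P +oo (restr f A)
                                    <= (Normc.normc (f x))%:E]))%E ->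
  exists N : R, [/\ 0 <= N, {ae P, forall x, A x -> nrm f x <= N} &
    c2 * m A <= m (A `&` [set x | c1 * N <= nrm f x])].
Proof.
move=> c10 c20 aA Sf h; have mA := atom_measurable aA; have A0 := atom_gt0 aA.
have PT : (0 < P setT)%E by rewrite probability_setT lte01.
have e : Lpnorm P +oo (restr f A) = ess_sup P (fun x => (nrm (restr f A) x)%:E).
  rewrite /Lpnorm Lnorm.unlock; case: ifPn => [_|/negP]; last by case.
  congr ess_sup; apply/funext => x /=.
  by rewrite ger0_norm// normc_ge0.
rewrite e in h; set N := ess_sup _ _ in h.
have N0 : (0 <= N)%E.
  rewrite /N; apply: ess_sup_gee; first exact: PT.
  by apply: aeW => x; rewrite lee_fin nrm_ge0.
have Nfin : N \is a fin_num.
  (* With an infinite norm the level set would be empty, although stability gives it positive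
     measure. *)
  rewrite ge0_fin_numE//; rewrite ltey; apply/eqP => Ny.
  move: h; rewrite Ny gt0_muley ?lte_fin// (_ : _ `&` _ = set0).
    by rewrite measure0 -EFin_m// -EFinM lee_fin leNgt mulr_gt0.
  by apply/seteqP; split=> // x [_]; rewrite /= leye_eq.
have [r Nr] : exists r, N = r%:E by exists (fine N); rewrite fineK.
exists r; split; first by move: N0; rewrite Nr lee_fin.
  apply: filterS (ess_sup_ge P (fun x => (nrm (restr f A) x)%:E)) => x hx Ax.
  by move: hx; rewrite -/N Nr lee_fin /nrm restr_in.
rewrite -lee_fin EFinM !EFin_m//; last first.
  apply: measurableI => //.
  have := S_measurable_nrm Sf measurableT (measurable_itv `[c1 * r, +oo[).
  by rewrite setTI; congr measurable; apply/seteqP; split => x /=; rewrite in_itv/= andbT.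
apply: (le_trans h); rewrite (_ : [set x | _] = [set x | c1 * r <= nrm f x])//.
by apply/seteqP; split=> x /=; rewrite Nr -EFinM lee_fin.
Qed.

Lemma ess_bounded_space f : S f -> vessb f.
Proof.
move=> Sf; have [c1 [c2 [/andP[c10 _] /andP[c20 _] hst]]] := stS.
have aT : all_atoms F setT by exists 0%N => //; apply/atomsE; exists point.
have [N [N0 fN _]] := stable_real_constants c10 c20 aT Sf (hst _ aT _ Sf).
have [mr mi] := S_measurable Sf.
split; split=> //; exists N; apply: filterS fN => x /(_ I) fx.
  by rewrite (le_trans (Re_le_normc _)).
by rewrite (le_trans (Im_le_normc _)).
Qed.

Lemma stable_space_exists : exists H : stable_space F S, True.
Proof.
have [c1 [c2 [/andP[c10 c11] /andP[c20 c21] hst]]] := stS.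
have [n hb] := S_basis.
have stab A f : all_atoms F A -> S f ->
    exists N : R, [/\ 0 <= N, {ae P, forall x, A x -> nrm f x <= N} &
      c2 * m A <= m (A `&` [set x | c1 * N <= nrm f x])].
  by move=> aA Sf; apply: stable_real_constants => //; exact: hst.
by exists (StableSpace c10 c20 c11 c21 S_zero S_add S_scale ess_bounded_space hb stab).
Qed.

Lemma scalar_alternative : (forall f, S f -> S (fun x => 'i%C * f x)) \/
  (forall f, S f -> forall x, complex.Im (f x) = 0).
Proof.
move: fS => [k [b [hb SE]]]; case: K hb SE => hb SE.
  right=> f; rewrite SE => -[c [hc ->]] x; rewrite Im_sum big1// => i _.
  have := (hb i).2 x; have := hc i => /=.
  by case: (c i) => a1 a2 /= ->; case: (b i x) => b1 b2 /= ->; rewrite mulr0 mul0r addr0.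
left=> f; rewrite SE => -[c [hc ->]]; exists (fun i => 'i%C * c i); split=> //.
by apply/funext => x; rewrite mulr_sumr; apply: eq_bigr => i _; rewrite mulrA.
Qed.

End scalars.

(** * The projectors, glued from projections over atoms *)

Section orthogonal_projection.
Context d (T : measurableType d) (R : realType) (P : probability T R).
Variables (F : binary_filtration P) (S : set (T -> R[i]%C)) (H : stable_space F S).
Variable p : R.
Hypothesis p1 : 1 < p.

(** Under either alternative, real orthogonality to [S] implies the complex one: the imaginary part
    of the inner product is tested by multiplying with the imaginary unit, or everything is real. *)
Definition scalar_compatible (g : T -> R[i]%C) :=
  (forall f, S f -> S (fun x => 'i%C * f x)) \/
  (forall f, S f -> forall x, complex.Im (f x) = 0) /\
    (forall x, complex.Im (g x) = 0).

Implicit Types (A B : set T) (f g h u v w : T -> R[i]%C).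
Local Notation m := (mass P).
Local Notation J := (integ P).
Local Notation vessb := (essb_scalar P).
Local Notation nu := (Lpow P p).
Local Notation pr := (is_projection P S).
Local Notation cls := (atom_at F).
Local Notation Sp n := (bf_split F n.+1).
Local Notation Sm n := (bf_small F n.+1).
Local Notation La n := (bf_large F n.+1).
Local Notation qn := (diff_pow F S p).
Local Notation K0 := (stab_cst H).
Local Notation avg := (mean_abs P).

Lemma Lpnorm_nu f : vessb f -> Lpnorm P p%:E f = (nu setT f `^ p^-1)%:E.
Proof.
move=> vf; rewrite /Lpnorm Lnorm.unlock.
have -> : (\int[P]_x `|(Normc.normc (f x))%:E| `^ p)%E = (nu setT f)%:E.
  rewrite /Lpow /integ /Rintegral fineK.
    apply: eq_integral => x _; rewrite gee0_abs ?lee_fin ?normc_ge0//.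
  by apply: integrable_fin_num => //; apply: essb_integrable => //; exact: essb_nrmp.
by [].
Qed.

Lemma nu_restr f A : measurable A -> vessb f -> nu setT (restr f A) = nu A f.
Proof.
move=> mA vf; have vr : vessb (restr f A) by exact: vessb_restr.
have -> : nu setT (restr f A) = nu A (restr f A) + nu (~` A) (restr f A).
  by rewrite -nuU ?setUCr ?setICr//; exact: measurableC.
have -> : nu A (restr f A) = nu A f by apply: eq_nu => x Ax; rewrite restr_in.
rewrite -[RHS]addr0; congr (_ + _); rewrite -(@nu0 _ _ _ P p p1 (~` A)); last exact: measurableC.
by apply: eq_nu => x Ax; rewrite restr_out.
Qed.

Lemma piecewiseP n f : piecewise F S n f <->
  forall x, exists2 u, S u & forall y, cls n x y -> f y = u y.
Proof.
split=> [h x|h A /atomsE[x ->]].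
  have [|u Su e] := h (cls n x); first by apply/atomsE; exists x.
  by exists u => // y xy; rewrite -(restr_in f xy) e restr_in.
have [u Su e] := h x; exists u => //; apply/funext => y; rewrite !restrE.
by case: ifP => // /set_mem /e.
Qed.

Lemma piecewise_vessb n f : piecewise F S n f -> vessb f.
Proof.
have mS k : measurable (Sm k) by exact/atom_measurable/sm_atom.
have mL k : measurable (La k) by exact/atom_measurable/la_atom.
have mX k : measurable (Sp k) by exact/atom_measurable/sp_atom.
elim: n f => [|n IH] f /piecewiseP hf.
  have [u Su e] := hf point; rewrite (_ : f = u); first exact: (ss_essb H).
  by apply/funext => x; apply: e.
have [x hx] := sm_nonempty F n; have [y hy] := la_nonempty F n.
have [u Su e] := hf x; have [v Sv e'] := hf y.
rewrite (_ : f = fun z => restr f (~` Sp n) z + restr u (Sm n) z + restr v (La n) z).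
  apply: vessbD; [apply: vessbD|]; try (apply: vessb_restr => //; exact: (ss_essb H)).
  apply: (IH); apply/piecewiseP => z; have [hz|hz] := pselect (Sp n z).
    exists (fun=> 0); first exact: ss_zero H.
    by move=> t; rewrite (cls_sp hz) => ht; rewrite restr_out//; apply.
  have [w Sw ew] := hf z; exists w => // t zt; rewrite restr_in.
    by apply: ew; rewrite cls_other.
  by move=> ht; apply: hz; rewrite -(cls_sp ht) (cls_eq zt); exact: cls_self.
apply/funext => z; have [hz|hz] := pselect (Sp n z); last first.
  rewrite restr_in// !restr_out ?addr0//; first by move/la_sub.
  by move/sm_sub.
rewrite [restr f _ _]restr_out; last by apply.
case: (sp_cases hz) => h.
  rewrite restr_in// restr_out; last exact: sm_la h.
  by rewrite add0r addr0; apply: e; rewrite cls_sm.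
rewrite restr_out; last by move=> /sm_la; apply.
by rewrite restr_in// !add0r; apply: e'; rewrite cls_la.
Qed.

Let Im_mul_conj (z w : R[i]%C) : complex.Im (z * w^*%C) = dot z ('i%C * w).
Proof. by case: z => a b; case: w => c e; rewrite /dot /=; ring. Qed.

Let Re_mul_conj (z w : R[i]%C) : complex.Re (z * w^*%C) = dot z w.
Proof. by case: z => a b; case: w => c e; rewrite /dot /=; ring. Qed.

Let ip_pieces n g h u : vessb g -> piecewise F S n h -> piecewise F S n u ->
  (forall x, exists2 v, pr (cls n x) g v & forall y, cls n x y -> h y = v y) ->
  J setT (fun x => dot (g x - h x) (u x)) = 0.
Proof.
move=> vg ph pu hh; have vh := piecewise_vessb ph; have vu := piecewise_vessb pu.
apply: (@J_atoms_eq0 _ _ _ _ F n); first by apply: essb_dot => //; exact: vessbB.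
move=> x; have [v [Sv hv] e] := hh x; have [u' Su' e'] := (piecewiseP n u).1 pu x.
rewrite -[RHS](hv u' Su'); apply: eq_J => y xy; by rewrite e// e'.
Qed.

(** The projections over the single atoms, glued together, satisfy the defining property, so [xget]
    returns a genuine solution. Conversely, testing a solution with functions of [S] cut off to one
    atom shows that it is a projection there. *)
Lemma orth_projP n g : vessb g -> scalar_compatible g ->
  vessb (orth_proj F S n g) /\
  forall x, exists2 v, pr (cls n x) g v & forall y, cls n x y -> orth_proj F S n g y = v y.
Proof.
move=> vg hg; pose h x := ss_proj P S (cls n x) g x.
have hh x : exists2 v, pr (cls n x) g v & forall y, cls n x y -> h y = v y.
  exists (ss_proj P S (cls n x) g); first by apply: (ss_projP H) => //; exact: all_atoms_cls.
  by move=> y xy; rewrite /h (cls_eq xy).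
have ph : piecewise F S n h.
  by apply/piecewiseP => x; have [v [Sv _] e] := hh x; exists v.
have ex : exists h, piecewise F S n h /\
    forall u, piecewise F S n u -> inner P (fun x => g x - h x) u = 0.
  exists h; split=> // u pu; rewrite /inner.
  have eRe : \int[P]_x complex.Re ((g x - h x) * (u x)^*%C) = 0.
    rewrite -[RHS](ip_pieces vg ph pu hh); apply: eq_Rintegral => x _.
    by rewrite Re_mul_conj.
  have eIm : \int[P]_x complex.Im ((g x - h x) * (u x)^*%C) = 0.
    case: hg => [Si|[Sr gr]].
      have pu' : piecewise F S n (fun x => 'i%C * u x).
        apply/piecewiseP => x; have [v Sv e] := (piecewiseP n u).1 pu x.
        by exists (fun x => 'i%C * v x); [exact: Si|move=> y xy; rewrite e].
      rewrite -[RHS](ip_pieces vg ph pu' hh); apply: eq_Rintegral => x _.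
      by rewrite Im_mul_conj.
    rewrite -(mul0r (m setT)) -J_cst//; apply: eq_Rintegral => x _.
    have [v Sv ->] := (piecewiseP n u).1 pu x; last exact: cls_self.
    have [v' [Sv' _] ->] := hh x; last exact: cls_self.
    have := Sr _ Sv x; have := Sr _ Sv' x; have := gr x.
    case: (g x) => a b; case: (v x) => a' b'; case: (v' x) => a'' b'' /= -> -> ->.
    by ring.
  by rewrite eRe eIm.
(* The selected solution may differ from [h] on a null set, so its form on each atom is derived from
   its own defining property. *)
have [ph' oh'] := xgetPex (fun=> 0) ex; rewrite -/(orth_proj F S n g) in ph' oh'.
split; first exact: piecewise_vessb ph'.
move=> x; have [v Sv e] := (piecewiseP n _).1 ph' x; exists v => //; split=> // w Sw.
have mx := cls_measurable F n x.
have pw : piecewise F S n (restr w (cls n x)).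
  apply/piecewiseP => y; have [xy|nxy] := pselect (cls n x y).
    by exists w => // z; rewrite (cls_eq xy) => xz; rewrite restr_in.
  exists (fun=> 0); first exact: ss_zero H.
  move=> z yz; rewrite restr_out// => xz; apply: nxy.
  by rewrite -(cls_eq xz) (cls_eq yz); exact: cls_self.
have := congr1 (@complex.Re R) (oh' _ pw); rewrite /inner /= => h0.
rewrite -[RHS]h0 /Re_inner -[in LHS](setTI (cls n x)) -J_indic; apply: eq_Rintegral => y _.
rewrite Re_mul_conj restrE indicE; have [xy|nxy] := pselect (cls n x y).
  by rewrite !mem_set//= mulr1 e.
by rewrite !memNset//= mulr0 /dot /= !mulr0 addr0.
Qed.

Let mSp n : measurable (Sp n). Proof. exact/atom_measurable/sp_atom. Qed.

Lemma diff_proj_vessb n g : vessb g -> scalar_compatible g ->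
  vessb (diff_proj F S n g).
Proof.
move=> vg cg; case: n => [|n]; first by case: (orth_projP 0 vg cg).
by apply: vessbB; [case: (orth_projP n.+1 vg cg)|case: (orth_projP n vg cg)].
Qed.

(** Away from the split atom both levels project over the same atoms, so the difference vanishes
    there almost everywhere; on the two children it is the difference of the local projections. *)
Lemma nu_diff_projS n g : vessb g -> scalar_compatible g ->
  nu setT (diff_proj F S n.+1 g) = qn n g.
Proof.
move=> vg cg; have vd := diff_proj_vessb n.+1 vg cg.
have [_ h1] := orth_projP n.+1 vg cg; have [_ h0] := orth_projP n vg cg.
have z : nu (~` Sp n) (diff_proj F S n.+1 g) = 0.
  rewrite /Lpow -[~` _]setTI -J_indic; apply: (@J_atoms_eq0 _ _ _ _ F n).
    apply: essbM; [exact: essb_nrmp|].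
    by apply: essb_indic; exact: measurableC.
  move=> x; have [hx|hx] := pselect (Sp n x).
    rewrite (cls_sp hx) J_indic setICr; exact: J_set0.
  have sub y : cls n x y -> ~ Sp n y.
    by move=> xy hy; apply: hx; rewrite -(cls_sp hy) (cls_eq xy); exact: cls_self.
  rewrite J_indic (_ : _ `&` _ = cls n x); last first.
    by apply/seteqP; split=> [y []//|y xy]; split=> //; exact: sub.
  have [u pu eu] := h0 x; have [v pv ev] := h1 x.
  have mx := cls_measurable F n x; have vu := ss_essb H pu.1; have vv := ss_essb H pv.1.
  rewrite (cls_other hx) in pv ev.
  rewrite -(nu0 P p1 mx).
  transitivity (nu (cls n x) (fun y => v y - u y)).
    by apply: eq_nu => y xy /=; rewrite ev// eu.
  apply: nu_eq_ae => //; [exact: vessbB|exact: ss_essb H _ (ss_zero H)|].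
  by apply: filterS (pr_unique H mx vg pv pu) => y e xy; rewrite e// subrr.
rewrite {1}/Lpow (J_split F n); last exact: essb_nrmp.
rewrite -/(nu (~` Sp n) (diff_proj F S n.+1 g)) z add0r.
have [x hx] := sm_nonempty F n; have [y hy] := la_nonempty F n.
have [u pu eu] := h0 x; have [v pv ev] := h1 x; have [w pw ew] := h1 y.
rewrite (cls_sp (sm_sub hx)) in pu eu; rewrite (cls_sm hx) in pv ev.
rewrite (cls_la hy) in pw ew; rewrite (qnE H p1 vg pu pv pw).
apply: congr2; apply: eq_J => t ht; rewrite /nrm /=.
  by rewrite (ev _ ht) (eu _ (sm_sub ht)).
by rewrite (ew _ ht) (eu _ (la_sub ht)).
Qed.

Lemma nu_orth_proj0 g : vessb g -> scalar_compatible g ->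
  nu setT (orth_proj F S 0 g) <= (K0 ^+ 2) `^ p * nu setT g.
Proof.
move=> vg cg; have [_ /(_ point)[u pu eu]] := orth_projP 0 vg cg.
have aT : all_atoms F setT by exact: (all_atoms_cls F 0 point).
have vu := ss_essb H pu.1; have Jg : 0 <= J setT (nrm g) by apply: J_ge0 => x _; exact: nrm_ge0.
have -> : nu setT (orth_proj F S 0 g) = nu setT u by apply: eq_nu => x _; exact: eu.
apply: (le_trans (nu_le_cst p1 _ vu (pr_bound H aT vg pu))) => //.
rewrite /avg m_setT divr1 mulr1 powRM ?sqr_ge0//.
apply: ler_wpM2l; first exact: powR_ge0.
by have := nu_holder p1 measurableT vg; rewrite m_setT powR1 mul1r.
Qed.

End orthogonal_projection.

Section power_means.
Variables (R : realType) (p tau : R).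
Hypotheses (p0 : 0 < p) (tau0 : 0 < tau).

Lemma root_le s C B : 0 <= s -> 0 <= C -> 0 <= B -> s <= C * B `^ (tau / p) ->
  s `^ tau^-1 <= C `^ tau^-1 * B `^ p^-1.
Proof.
move=> s0 C0 B0 h.
have -> : p^-1 = tau / p * tau^-1 by rewrite mulrAC divff ?mul1r// gt_eqF.
rewrite powRrM -powRM ?powR_ge0//.
by apply: ler_powR2 => //; rewrite invr_ge0 ltW.
Qed.

Lemma le_of_root s C B : 0 <= s -> 0 <= B -> s `^ tau^-1 <= C * B `^ p^-1 ->
  s <= `|C| `^ tau * B `^ (tau / p).
Proof.
move=> s0 B0 h; rewrite -[leLHS](powRVK (p := tau))//; last by rewrite gt_eqF.
rewrite [tau / p]mulrC powRrM -powRM ?powR_ge0//.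
apply: ler_powR2; [exact: ltW|exact: powR_ge0|apply: le_trans h _].
by apply: ler_wpM2r; [exact: powR_ge0|exact: ler_norm].
Qed.

Lemma series_root_le (u : nat -> R) s : (forall j, 0 <= u j) ->
  (forall N, \sum_(j < N) u j <= s) ->
  ((\sum_(0 <= j <oo) (u j)%:E) `^ tau^-1 <= (s `^ tau^-1)%:E)%E.
Proof.
move=> u0 h; have s0 : 0 <= s by have := h 0%N; rewrite big_ord0.
have hs : (\sum_(0 <= j <oo) (u j)%:E <= s%:E)%E.
  apply: lime_le; first by apply: is_cvg_nneseries => n _ _; rewrite lee_fin.
  by apply: nearW => n; rewrite big_mkord sumEFin lee_fin.
rewrite -poweR_EFin; apply: gt0_ler_poweR => //; first by rewrite invr_ge0 ltW.
- rewrite in_itv/= leey andbT; apply: nneseries_ge0 => n _ _; by rewrite lee_fin.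
- by rewrite in_itv/= leey andbT lee_fin.
Qed.

Lemma series_root_ge (u : nat -> R) c N : (forall j, 0 <= u j) ->
  ((\sum_(0 <= j <oo) (u j)%:E) `^ tau^-1 <= c%:E)%E ->
  (\sum_(j < N) u j) `^ tau^-1 <= c.
Proof.
move=> u0; rewrite -lee_fin -poweR_EFin; apply: le_trans.
have hs : ((\sum_(j < N) u j)%:E <= \sum_(0 <= j <oo) (u j)%:E)%E.
  rewrite -sumEFin -(big_mkord xpredT (fun j => (u j)%:E)).
  by apply: nneseries_lim_ge => n _ _; rewrite lee_fin.
have s0 : 0 <= \sum_(j < N) u j by exact: sumr_ge0.
apply: gt0_ler_poweR => //; first by rewrite invr_ge0 ltW.
- by rewrite in_itv/= leey andbT lee_fin.
- by rewrite in_itv/= leey andbT; apply: le_trans hs; rewrite lee_fin.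
Qed.

Lemma add_le_scaled (a b c e n x : R) : 0 <= x -> 0 <= c -> 1 <= n ->
  a <= c * x -> b <= e * n * x -> a + b <= (c + `|e|) * n * x.
Proof.
move=> x0 c0 n1 ha hb; rewrite mulrDl mulrDl; apply: lerD.
  by apply: le_trans ha _; apply: ler_wpM2r => //; rewrite ler_peMr.
apply: le_trans hb _; apply: ler_wpM2r => //; apply: ler_wpM2r; last exact: ler_norm.
exact: le_trans n1.
Qed.

End power_means.

(** * From powers back to norms, and the two implications *)

Section equivalence.
Context d (T : measurableType d) (R : realType) (P : probability T R).
Variables (F : binary_filtration P) (K : scalar_field) (S : set (T -> R[i]%C)).
Variables (H : stable_space F S) (p tau : R).
Hypotheses (fS : finite_dim_space K S) (p1 : 1 < p) (tau0 : 0 < tau) (taup : tau < p).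
Implicit Types (A B X Y Z : set T) (f g h u v : T -> R[i]%C) (w : T).
Local Notation m := (mass P).
Local Notation vessb := (essb_scalar P).
Local Notation nu := (Lpow P p).
Local Notation kap := (kappa H).
Local Notation K0 := (stab_cst H).
Local Notation cls := (atom_at F).
Local Notation Sp n := (bf_split F n.+1).
Local Notation th := (tau / p).

Let p0 : 0 < p. Proof. by rewrite (lt_trans _ p1). Qed.
Let th01 : 0 < th < 1. Proof. by rewrite divr_gt0// ltr_pdivrMr// mul1r. Qed.

Lemma Lpnorm_power f : vessb f ->
  (Lpnorm P p%:E f `^ tau = (nu setT f `^ th)%:E)%E.
Proof. by move=> vf; rewrite (Lpnorm_nu p1)// poweR_EFin -powRrM mulrC. Qed.

Lemma Sigma_vessb n g : Sigma F S n g -> vessb g.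
Proof.
move=> [v [A [h ->]]]; apply: vessb_sum => i; apply: vessb_restr.
  exact: atom_measurable (h i).2.
exact: ss_essb H _ (h i).1.
Qed.

Lemma Sigma_scalar_compatible n g : Sigma F S n g -> scalar_compatible S g.
Proof.
move=> [v [A [h ->]]]; case: (scalar_alternative fS) => hS; [by left|right].
split=> // x; rewrite Im_sum big1// => i _; rewrite restrE; case: ifP => // _.
exact: hS (h i).1 _.
Qed.

(** The difference of [f] cut off to [X] and to [Z]: two pieces, for which the factor in the
    Bernstein inequality is an absolute constant. *)
Lemma Sigma_diff X Z f : all_atoms F X -> all_atoms F Z -> Z `<=` X -> S f ->
  Sigma F S 2 (restr f (X `\` Z)).
Proof.
move=> aX aZ ZX Sf.
exists (fun i => if i == ord0 then f else fun x => (- 1)%:C%C * f x).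
exists (fun i => if i == ord0 then X else Z); split=> [i|].
  by case: ifP => _; split=> //; exact: ss_scale H _ _ Sf.
apply/funext => x; rewrite !big_ord_recl big_ord0 /= addr0.
have [xZ|xZ] := pselect (Z x).
  rewrite [LHS]restr_out; last by case.
  by rewrite !restr_in//; [rewrite rmorphN1 mulN1r subrr|exact: ZX].
rewrite [X in _ + X]restr_out// addr0; have [xX|xX] := pselect (X x).
  by rewrite !restr_in.
by rewrite !restr_out//; case.
Qed.

(** Passing from levels to children: levels that do not split the atom of [w] repeat the same atom,
    contribute an empty difference, and are left out of the chain. *)
Lemma level_chain w k a : exists n (X : nat -> set T),
  [/\ X 0%N = cls a w, X n = cls (a + k) w,
    forall j, (j <= n)%N -> all_atoms F (X j),
    forall j, (j < n)%N -> is_child F (X j) (X j.+1) &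
    forall f, \sum_(a <= j < a + k) nu (cls j w `\` cls j.+1 w) f `^ th =
              \sum_(j < n) nu (X j `\` X j.+1) f `^ th].
Proof.
elim: k a => [|k IH] a.
  exists 0%N, (fun=> cls a w); rewrite addn0; split=> // [j _|f].
    exact: all_atoms_cls.
  by rewrite big_geq// big_ord0.
have [n [X [X0 Xn aX cX sX]]] := IH a.+1; rewrite addSnnS in Xn sX.
have lt_a : (a < a + k.+1)%N by rewrite addnS ltnS leq_addr.
have [hw|hw] := pselect (Sp a w); last first.
  exists n, X; split=> // [|f]; first by rewrite X0 cls_other.
  rewrite big_ltn// sX cls_other// setDv nu_set0 powR0 ?add0r//.
  by rewrite gt_eqF//; case/andP: th01.
exists n.+1, (fun j => if j is i.+1 then X i else cls a w); split=> //.
- by case=> [_|j /aX//]; exact: all_atoms_cls.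
- case=> [_|j /cX//] /=; exists a; rewrite X0 (cls_sp hw); split=> //.
  by case: (sp_cases hw) => h; [left; rewrite cls_sm|right; rewrite cls_la].
- by move=> f; rewrite big_ltn// big_ord_recl /= X0 sX.
Qed.

Definition chain_bound rho M := forall n (X : nat -> set T),
  (forall j, (j <= n)%N -> all_atoms F (X j)) -> rho * m (X 0%N) <= m (X n) ->
  (forall j, (j < n)%N -> is_child F (X j) (X j.+1)) -> forall f, S f ->
  \sum_(j < n) nu (X j `\` X j.+1) f `^ th <= M * nu (X 0%N `\` X n) f `^ th.

Lemma chain_sum_power n (X : nat -> set T) f : S f ->
  (forall j, (j <= n)%N -> all_atoms F (X j)) ->
  (\sum_(1 <= i < n.+1) Lpnorm P p%:E (restr f (X i.-1 `\` X i)) `^ tau =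
   (\sum_(j < n) nu (X j `\` X j.+1) f `^ th)%:E)%E.
Proof.
move=> Sf aX; rewrite big_add1 /= big_mkord -sumEFin; apply: eq_bigr => j _.
have vf := ss_essb H Sf.
have mX : measurable (X j `\` X j.+1).
  by apply: measurableD; apply: atom_measurable; apply: aX => //; exact: ltnW.
by rewrite Lpnorm_power ?nu_restr//; exact: vessb_restr.
Qed.

Lemma chain_conditionP : chain_condition F S p tau <->
  exists rho M, [/\ 0 < rho < 1, 0 <= M & chain_bound rho M].
Proof.
split=> [[rho [M [r01 h]]]|[rho [M [r01 M0 h]]]].
  (* The constant of the chain condition comes without a sign; its absolute value serves as well. *)
  exists rho, (`|M| `^ tau); split=> // n X aX hr cX f Sf.
  have vf := ss_essb H Sf; have a0 := aX 0%N (leq0n n); have an := aX n (leqnn n).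
  have m0 := atom_measurable a0; have mn := atom_measurable an.
  apply: le_of_root => //.
  - by apply: sumr_ge0 => j _; exact: powR_ge0.
  - exact: nu_ge0.
  have := h n X aX _ cX f Sf; rewrite chain_sum_power//.
  rewrite (Lpnorm_nu p1); last by apply: vessb_restr => //; exact: measurableD.
  rewrite (nu_restr p1)//; last exact: measurableD.
  rewrite poweR_EFin -EFinM lee_fin; apply.
  by rewrite -!EFin_m// -EFinM lee_fin.
exists rho, (M `^ tau^-1); split=> // n X aX hr cX f Sf.
have vf := ss_essb H Sf; have a0 := aX 0%N (leq0n n); have an := aX n (leqnn n).
have m0 := atom_measurable a0; have mn := atom_measurable an.
rewrite chain_sum_power// (Lpnorm_nu p1); last by apply: vessb_restr => //; exact: measurableD.
rewrite (nu_restr p1)//; last exact: measurableD.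
rewrite poweR_EFin -EFinM lee_fin; apply: root_le => //.
- by apply: sumr_ge0 => j _; exact: powR_ge0.
- exact: nu_ge0.
- by apply: h => //; move: hr; rewrite -!EFin_m// -EFinM lee_fin.
Qed.

Lemma series_diff_proj n g : Sigma F S n g ->
  (\sum_(0 <= j <oo) Lpnorm P p%:E (diff_proj F S j g) `^ tau =
   \sum_(0 <= j <oo) (nu setT (diff_proj F S j g) `^ th)%:E)%E.
Proof.
move=> hg; apply: eq_eseriesr => j _; apply: Lpnorm_power.
apply: (diff_proj_vessb H); first exact: Sigma_vessb hg.
exact: Sigma_scalar_compatible hg.
Qed.

Lemma chain_sufficient rho M : 0 < rho < 1 -> 0 <= M -> chain_bound rho M ->
  bernstein F S p tau.
Proof.
move=> /andP[r0 r1] M0 hb; have k0 := kap_gt0 H.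
(* A larger [rho] admits fewer chains, so the bound persists; [(1 + kap)^-1] is the value at which
   [1 - r] equals [kap * r]. *)
pose r := Num.max rho (1 + kap)^-1.
have r01 : 0 < r < 1.
  by rewrite lt_max r0 gt_max r1 /= invf_lt1; lra.
have rk : 1 - r <= kap * r.
  have : (1 + kap) * (1 + kap)^-1 <= (1 + kap) * r.
    by apply: ler_wpM2l; [lra|rewrite le_max lexx orbT].
  rewrite divff; lra.
have [L hL] : exists L, r ^+ L <= kap.
  have r_lt1 : `|r| < 1 by case/andP: r01 => a b; rewrite ger0_norm ?(ltW a).
  have /cvgrPdist_le/(_ _ k0)[L _ /(_ L (leqnn L))] := cvg_expr r_lt1.
  by rewrite /= sub0r normrN => h; exists L; apply: le_trans (ler_norm _) h.
have hcond w a b f : (a <= b)%N -> S f -> r * m (cls a w) <= m (cls b w) ->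
    \sum_(a <= j < b) nu (cls j w `\` cls j.+1 w) f `^ th <=
    M * nu (cls a w `\` cls b w) f `^ th.
  move=> /subnKC <- Sf hr; have [n [X [X0 Xn aX cX ->]]] := level_chain w (b - a) a.
  rewrite -X0 -Xn; apply: hb => //; rewrite X0 Xn.
  apply: le_trans hr; apply: ler_wpM2r; first exact: m_ge0.
  by rewrite le_max lexx.
(* The first summand pays for the projection of level 0, which belongs to no split; the factor
   [n ^ (1 - th)], at least 1, is harmless there. *)
pose C := ((K0 ^+ 2) `^ p) `^ th + `|2 * Sigma_cst H p th r M L|.
have C0 : 0 <= C by rewrite addr_ge0 ?powR_ge0.
exists (C `^ tau^-1) => n n0 g hg; have vg := Sigma_vessb hg.
have cg := Sigma_scalar_compatible hg.
rewrite (series_diff_proj hg) (Lpnorm_nu p1)// -!EFinM.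
(* This matches the exponent of the Bernstein inequality with the power of [n] in [qn_sum_Sigma]
   after taking the root of order [tau]. *)
have -> : tau^-1 - p^-1 = (1 - th) * tau^-1.
  by rewrite mulrBl mul1r mulrAC divff ?mul1r// gt_eqF.
rewrite powRrM -powRM ?powR_ge0//.
apply: (le_trans (@series_root_le _ _ tau0 _ (C * n%:R `^ (1 - th) * nu setT g `^ th) _ _)).
- by move=> j; exact: powR_ge0.
- case=> [|N]; first by rewrite big_ord0; do ?apply: mulr_ge0 => //; exact: powR_ge0.
  rewrite big_ord_recl /=; under eq_bigr => j _ do rewrite (nu_diff_projS H p1)//.
  have [v [A [hvA gE]]] := hg.
  have := qn_sum_Sigma p1 th01 r01 M0 rk hcond hL (fun i => (hvA i).1) (fun i => (hvA i).2) N n0.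
  rewrite -gE => hq; have n1 : 1 <= n%:R `^ (1 - th) :> R.
    apply: (@le_trans _ _ (1 `^ (1 - th))); first by rewrite powR1.
    apply: ler_powR2 => //; last by rewrite ler1n.
    by rewrite subr_ge0 ltW//; case/andP: th01.
  have h0 : nu setT (orth_proj F S 0 g) `^ th <= ((K0 ^+ 2) `^ p) `^ th * nu setT g `^ th.
    rewrite -powRM ?powR_ge0 ?nu_ge0//; apply: ler_powR2; rewrite ?nu_ge0//.
      by apply: ltW; case/andP: th01.
    exact: (nu_orth_proj0 H p1).
  by apply: add_le_scaled => //; exact: powR_ge0.
rewrite lee_fin; apply: root_le => //; rewrite ?mulr_ge0 ?powR_ge0 ?nu_ge0//.
Qed.

Lemma chain_necessary : bernstein F S p tau ->
  exists rho M, [/\ 0 < rho < 1, 0 <= M & chain_bound rho M].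
Proof.
move=> [C hC]; pose CB := `|C * 2 `^ (tau^-1 - p^-1)| `^ tau.
have [rho [M [r01 M0 h]]] := chain_necessity_ex H p1 th01 (powR_ge0 _ _ : 0 <= CB).
exists rho, M; split=> // n X aX hr cX; apply: h => // f Sf N.
set g := restr f _; have hg : Sigma F S 2 g.
  apply: Sigma_diff => //; [exact: aX|exact: aX|exact: (chain_sub cX)].
have vg := Sigma_vessb hg; have cg := Sigma_scalar_compatible hg.
have := hC 2%N isT g hg; rewrite (series_diff_proj hg) (Lpnorm_nu p1)// -!EFinM.
(* [N] steps correspond to the differences with indices 1 to [N]; the term of index 0 is dropped. *)
move=> /(series_root_ge tau0 N.+1 (fun j => powR_ge0 _ _)) /(le_of_root tau0) hs.
apply: le_trans (hs _ _); last exact: nu_ge0.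
  rewrite big_ord_recl /=; under [X in _ + X]eq_bigr => j _ do rewrite (nu_diff_projS H p1)//.
  by rewrite lerDr powR_ge0.
by apply: sumr_ge0 => j _; exact: powR_ge0.
Qed.

End equivalence.

Theorem theorem1p1 (R : realType) (d : measure_display) (T : measurableType d)
    (P : probability T R) (F : binary_filtration P)
    (K : scalar_field) (S : set (T -> R[i]%C)) (p tau : R) :
  finite_dim_space K S -> stable F S ->
  1 < p -> 0 < tau < p ->
  bernstein F S p tau <-> chain_condition F S p tau.
Proof.
move=> fS stS p1 /andP[t0 tp]; have [H _] := stable_space_exists fS stS.
split=> [/(chain_necessary H fS p1 t0 tp)/(chain_conditionP H p1 t0)//|].
by move=> /(chain_conditionP H p1 t0)[rho [M [r01 M0]]]; exact: (chain_sufficient H fS p1 t0 tp r01 M0).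
Qed.
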